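(* Let $\psi:\Sigma^n\to\mathcal{H}^{n+1}$ be a complete spacelike hypersurface with constant mean curvature $H$ in the steady state space. If $\Sigma$ is bounded away from the infinity of $\mathcal{H}^{n+1}$, then necessarily $H=1$. Moreover, in the case $n=2$, there exists $\tau>0$ such that $\Sigma^2=L_\tau$ (that is, $\psi(\Sigma)=L_\tau$).
   Context: Let $n\ge 1$ and let $\mathbb{R}^{n+2}_1$ be $\mathbb{R}^{n+2}$ with coordinates $(x_0,\dots,x_{n+1})$ and the Lorentzian metric $\langle\,,\rangle=-(dx_0)^2+(dx_1)^2+\dots+(dx_{n+1})^2$. De Sitter space is $\mathbb{S}^{n+1}_1=\{x\in\mathbb{R}^{n+2}_1:\langle x,x\rangle=1\}$ with the induced Lorentzian metric. Fix a non-zero null past-pointing vector $a\in\mathbb{R}^{n+2}_1$, i.e. $\langle a,a\rangle=0$ and $\langle a,e_0\rangle>0$ where $e_0=(1,0,\dots,0)$ (time orientation: $e_0$ is future-pointing). The steady state space is the open region $\mathcal{H}^{n+1}=\{x\in\mathbb{S}^{n+1}_1:\langle x,a\rangle>0\}$ with the induced metric. For $\tau>0$, let $L_\tau=\{x\in\mathcal{H}^{n+1}:\langle x,a\rangle=\tau\}$. A spacelike hypersurface is a smooth immersion $\psi:\Sigma^n\to\mathcal{H}^{n+1}$ of a connected $n$-dimensional manifold $\Sigma^n$ whose induced metric on $\Sigma$ is Riemannian; it is complete if this induced metric is complete. Let $N$ be its future-pointing Gauss map: the unique globally defined unit timelike ($\langle N,N\rangle=-1$) normal field on $\Sigma$ tangent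 to $\mathcal{H}^{n+1}$ which is future-directed (equivalently, $\langle N,a\rangle>0$). The mean curvature is $H=-\frac{1}{n}\mathrm{tr}(A)$, where $A$ is the shape operator with respect to $N$, $AX=-\overline{\nabla}_XN$, with $\overline{\nabla}$ the Levi-Civita connection of $\mathcal{H}^{n+1}$. With this convention the mean curvature vector is $\overrightarrow{H}=HN$. $\Sigma$ is bounded away from the infinity if there exist $0<\underline{\tau}<\overline{\tau}$ such that $\psi(\Sigma)\subset\{x\in\mathcal{H}^{n+1}:\underline{\tau}\le\langle x,a\rangle\le\overline{\tau}\}$. *)

(* Defs.v *)
From HB Require Import structures.
From mathcomp Require Import all_boot all_order all_algebra.
From mathcomp Require Import all_classical all_reals all_analysis.
Set Implicit Arguments.
Unset Strict Implicit.
Unset Printing Implicit Defensive.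
Import Order.TTheory GRing.Theory Num.Theory.
Import numFieldNormedType.Exports.
Local Open Scope classical_set_scope.
Local Open Scope ring_scope.

(* C^k on U.  U is meant to be open and V finite-dimensional (here V is
   'rV[R]_n or R^o): then all directional derivatives being C^k is the same as
   the differential being C^k. *)
Fixpoint Ck (R : realType) (V W : normedModType R) (k : nat) (U : set V)
    (f : V -> W) : Prop :=
  match k with
  | 0 => forall x, U x -> {for x, continuous f}
  | k'.+1 => (forall x, U x -> differentiable f x) /\
             (forall v, Ck k' U (fun x => 'D_v f x))
  end.

Definition smooth_on (R : realType) (V W : normedModType R) (U : set V)
    (f : V -> W) : Prop := forall k, Ck k U f.

(* A homeomorphism between the open sets dom and cod.  The values of the total
   functions outside these sets are irrelevant. *)
Record chart (R : realType) (n : nat) (M : topologicalType) := Chart {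
  dom : set M;
  cod : set 'rV[R]_n;
  to_coord : M -> 'rV[R]_n;
  of_coord : 'rV[R]_n -> M;
  open_dom : open dom;
  open_cod : open cod;
  to_coord_cod : forall p, dom p -> cod (to_coord p);
  of_coord_dom : forall x, cod x -> dom (of_coord x);
  to_coordK : forall p, dom p -> of_coord (to_coord p) = p;
  of_coordK : forall x, cod x -> to_coord (of_coord x) = x;
  to_coord_cont : forall p, dom p -> {for p, continuous to_coord};
  of_coord_cont : forall x, cod x -> {for x, continuous of_coord} }.

(* The atlas need not be maximal: the notions below do not depend on the choice
   of an atlas in its compatibility class. *)
Record smoothManifold (R : realType) (n : nat) := SmoothManifold {
  points :> topologicalType;
  atlas : set (chart R n points);
  manifold_hausdorff : hausdorff_space points;
  manifold_countable : @second_countable points;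
  atlas_cover : forall p : points, exists2 c, atlas c & dom c p;
  atlas_compatible : forall c1 c2, atlas c1 -> atlas c2 ->
    smooth_on (cod c1 `&` of_coord c1 @^-1` dom c2)
              (to_coord c2 \o of_coord c1) }.

Section Manifolds.
Context {R : realType} {n : nat} {M : smoothManifold R n}.
Implicit Types (c : chart R n M) (p q : M) (x v : 'rV[R]_n).

Definition smooth_map (m : nat) (f : M -> 'rV[R]_m) : Prop :=
  forall c, atlas c -> smooth_on (cod c) (f \o of_coord c).

(* df_p(v), the tangent vector v at p being given by its components in c. *)
Definition differential (m : nat) (f : M -> 'rV[R]_m) c p v : 'rV[R]_m :=
  'd (f \o of_coord c) (to_coord c p) v.

(* Smooth up to the endpoints of [0, 1]: gamma is smooth near each t. *)
Definition smooth_arc (gamma : R -> M) : Prop :=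
  forall t : R, 0 <= t <= 1 -> forall c, atlas c -> dom c (gamma t) ->
  exists U : set R^o, [/\ open U, U t, U `<=` gamma @^-1` dom c &
    smooth_on U (to_coord c \o gamma : R^o -> 'rV[R]_n)].

End Manifolds.

Section SteadyState.
Context {R : realType}.

Definition lorentz (m : nat) (x y : 'rV[R]_m.+1) : R :=
  - (x 0 0 * y 0 0) + \sum_(i < m) x 0 (lift 0 i) * y 0 (lift 0 i).

Definition e0 (m : nat) : 'rV[R]_m.+1 := delta_mx 0 0.

Definition null_past_pointing (m : nat) (a : 'rV[R]_m.+1) : Prop :=
  [/\ a != 0, lorentz a a = 0 & 0 < lorentz a (e0 m)].

Definition de_sitter (m : nat) : set 'rV[R]_m.+1 := [set x | lorentz x x = 1].

Definition steady_state (m : nat) (a : 'rV[R]_m.+1) : set 'rV[R]_m.+1 :=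
  [set x | de_sitter x /\ 0 < lorentz x a].

Definition slice (m : nat) (a : 'rV[R]_m.+1) (tau : R) : set 'rV[R]_m.+1 :=
  [set x | steady_state a x /\ lorentz x a = tau].

Section Hypersurface.
Context {n : nat} {M : smoothManifold R n}.
Implicit Types (c : chart R n M) (p q : M) (psi N : M -> 'rV[R]_n.+2)
  (a : 'rV[R]_n.+2).

Definition induced_metric psi c p (v w : 'rV[R]_n) : R :=
  lorentz (differential psi c p v) (differential psi c p w).

Record spacelike_hypersurface a psi : Prop := {
  hyp_nonempty : [set: M] !=set0;
  hyp_connected : connected [set: M];
  hyp_smooth : smooth_map psi;
  hyp_steady : forall p, steady_state a (psi p);
  hyp_immersion : forall c p, atlas c -> dom c p ->
    injective (differential psi c p);
  hyp_spacelike : forall c p, atlas c -> dom c p ->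
    forall v, v != 0 -> 0 < induced_metric psi c p v v }.

(* By the chain rule the induced metric gives the velocity of gamma the squared
   norm <(psi o gamma)', (psi o gamma)'>. *)
Definition arc_length psi (gamma : R -> M) : R :=
  Rintegral lebesgue_measure `[0, 1]
    (fun t => let u := derive1 (psi \o gamma) t in Num.sqrt (lorentz u u)).

(* q is joined to p by a piecewise smooth curve of length l. *)
Inductive joined psi p : M -> R -> Prop :=
| joined_refl : joined psi p p 0
| joined_arc (gamma : R -> M) (l : R) :
    joined psi p (gamma 0) l -> smooth_arc gamma ->
    joined psi p (gamma 1) (l + arc_length psi gamma).

Definition riem_dist psi p q : R := inf [set l | joined psi p q l].

Definition complete_hypersurface psi : Prop :=
  forall u : nat -> M,
    (forall e : R, 0 < e -> exists k0 : nat, forall j k : nat,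
      (k0 <= j)%N -> (k0 <= k)%N -> riem_dist psi (u j) (u k) < e) ->
    exists p, (fun k => riem_dist psi (u k) p) @ \oo --> (0 : R).

Record future_gauss_map psi N : Prop := {
  gauss_smooth : smooth_map N;
  gauss_unit : forall p, lorentz (N p) (N p) = -1;
  gauss_tangent : forall p, lorentz (N p) (psi p) = 0;
  gauss_normal : forall c p v, atlas c -> dom c p ->
    lorentz (N p) (differential psi c p v) = 0;
  gauss_future : forall p, lorentz (N p) (e0 n.+1) < 0 }.

(* The Levi-Civita connection of de Sitter space, applied to a field X along psi
   tangent to it: the projection of the flat derivative orthogonally to the
   unit normal psi p of de Sitter space. *)
Definition ds_connection psi (X : M -> 'rV[R]_n.+2) c p (v : 'rV[R]_n) :
    'rV[R]_n.+2 :=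
  let DX := differential X c p v in DX - lorentz DX (psi p) *: psi p.

(* A is the matrix in the coordinates c of the shape operator v |-> v *m A of
   the tangent space at p (row-vector convention). *)
Definition is_shape_operator psi N c p (A : 'M[R]_n) : Prop :=
  forall v, differential psi c p (v *m A) = - ds_connection psi N c p v.

Definition mean_curvature_at psi N p (H : R) : Prop :=
  forall c, atlas c -> dom c p ->
  exists2 A, is_shape_operator psi N c p A & H = - (n%:R^-1 * \tr A).

Definition bounded_away_from_infinity a psi : Prop :=
  exists tau1 tau2 : R, [/\ 0 < tau1, tau1 < tau2 &
    forall p, tau1 <= lorentz (psi p) a <= tau2].

End Hypersurface.
End SteadyState.

(* Main.v *)
Require Import Defs.
From HB Require Import structures.
From mathcomp Require Import all_boot all_order all_algebra.
From mathcomp Require Import all_classical all_reals all_analysis.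
From mathcomp Require Import ring lra.
Set Implicit Arguments.
Unset Strict Implicit.
Unset Printing Implicit Defensive.
Import Order.TTheory GRing.Theory Num.Theory.
Import numFieldNormedType.Exports.
Local Open Scope classical_set_scope.
Local Open Scope ring_scope.

(** The null vector a extends to a frame a, b, E_1, ..., E_n in which the Lorentz
    product is that of the half-space model (null_frame): in the coordinates
    y_i = <x, E_i> / <x, a> and f = 1 / <x, a> the steady state space is the region
    f > 0 with the metric (|dy|^2 - df^2) / f^2, and the L_tau are the
    horizontal hyperplanes.

    The hypersurface is an entire graph. A bound <x, a> <= tau makes the
    induced metric at most tau^2 |dy|^2, and the projection to y is a local
    diffeomorphism by the inverse function theorem. Hence completeness
    allows one to lift straight segments of R^n, and the lifts from a base point fit
    together to a global section, which is onto by connectedness (entire_graph).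
    So the hypersurface is the graph of a function f on R^n with values in a
    compact interval of positive numbers, |Df| < 1, and the definition of the mean
    curvature becomes, with w = (1 - |Df|^2)^(-1/2),
        div (w Df) = (n / f) (w - H)        (graph_equation).

    H = 1. Since f is bounded, f - eps |z|^2 has a maximum, at which Df is small,
    w is close to one and the second derivatives of f are at most 2 eps; so
    (n / f) (1 - H) is at most a small number. The same at almost minima gives the
    other inequality (mean_curvature_eq1).

    Dimension two. For H = 1 one has div (w Df) = (2 / f) (w - 1), which is at
    least a constant times w |Df|^2. Testing with the square of a cutoff would give Df = 0 by the parabolicity of the
    plane if w were bounded. It need not be, so the cutoff is taken to be a function of
    better coordinates. The tensor
        T = (f^-2 (1/w - 1) + c) I + f^-2 w Df Df^T
    is divergence free, so its cofactor matrix B is the Jacobian matrix of a map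
    xi of the plane; xi is proper, and the energy of a function of xi is at
    most a constant times the squared gradient of that function times det B,
    uniformly in w (conjugate_coordinates). For a logarithmic cutoff in |xi| this
    is O(eps) after integration. The integral of (function of |xi|) det B is not
    computed by a change of variables: it is the integral of the divergence of a
    field T m(|xi|^2) xi (cutoff_pointwise, cutoff_integral_le). Letting
    eps tend to 0 gives Df = 0 (gradient_eq0), so that f is constant and the
    graph is a slice. *)

(** * Differentiability and the classes C^k *)

Section Differentials.
Context {R : realType} {V W : normedModType R}.

(** The epsilon form of differentiability; the candidate L must be known to be
    continuous because the normed spaces are arbitrary. *)
Lemma differentiableI (f : V -> W) (L : {linear V -> W}) (x : V) :
  continuous L ->
  (forall e : R, 0 < e ->
     \forall h \near (0:V), `|f (h + x) - f x - L h| <= e * `|h|) ->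
  differentiable f x /\ 'd f x = L :> (V -> W).
Proof.
move=> cL H.
have E : f \o shift x = cst (f x) + L +o_ (0:V) id.
  apply/eqaddoP => e e0; have := H e e0; apply: filterS => h /=.
  by rewrite !fctE opprD addrA.
have D := diff_unique cL E; split=> //.
by apply/diff_locallyP; rewrite D.
Qed.

Lemma differentiable_near0 (f : V -> W) (x : V) : differentiable f x ->
  forall e : R, 0 < e ->
    \forall h \near (0:V), `|f (h + x) - f x - 'd f x h| <= e * `|h|.
Proof.
move=> /diff_locallyP [_ /eqaddoP H] e e0; have := H e e0; apply: filterS => h /=.
by rewrite !fctE opprD addrA.
Qed.

Lemma near_eq_differentiable (f g : V -> W) (x : V) :
  (\near x, f x = g x) -> differentiable f x ->
  differentiable g x /\ 'd g x = 'd f x :> (V -> W).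
Proof.
move=> fg df.
have fgx : f x = g x by exact: nbhs_singleton fg.
have fg0 : \forall h \near (0 : V), f (h + x) = g (h + x).
  by have := fg; rewrite (near_shift 0) subr0.
apply: (@differentiableI g ('d f x) x) => [|e e0]; first exact: diff_continuous.
apply: filterS2 fg0 (differentiable_near0 df e0) => h.
by rewrite -fgx => <-.
Qed.

End Differentials.

Section CkCalculus.
Context {R : realType}.
Implicit Types (V W : normedModType R).

Lemma CkS V W k (U : set V) (f : V -> W) : Ck k.+1 U f -> Ck k U f.
Proof.
elim: k f => [|k IH] f; first by case=> df _ x /df /differentiable_continuous.
by case=> df Df; split=> // v; apply: IH; exact: Df.
Qed.

Lemma Ck_sub V W k (U U' : set V) (f : V -> W) :
  U' `<=` U -> Ck k U f -> Ck k U' f.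
Proof.
move=> sU; elim: k f => [|k IH] f /=; first by move=> H x /sU /H.
by case=> df Df; split=> [x /sU /df //|v]; exact: IH.
Qed.

Lemma near_eq_open V (W : Type) (U : set V) (f g : V -> W) x :
  open U -> (forall x, U x -> f x = g x) -> U x -> \near x, f x = g x.
Proof.
move=> oU fg Ux.
have Ux' : nbhs x U by exact: open_nbhs_nbhs.
by apply: filterS Ux' => y /fg.
Qed.

Lemma Ck_ext V W k (U : set V) (f g : V -> W) :
  open U -> (forall x, U x -> f x = g x) -> Ck k U f -> Ck k U g.
Proof.
move=> oU; elim: k f g => [|k IH] f g fg /=.
  move=> cf x Ux; have E := near_eq_open oU fg Ux.
  rewrite /prop_for /continuous_at -(fg x Ux).
  by apply: cvg_trans (cf x Ux); exact: near_eq_cvg.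
case=> df Df; split=> [x Ux|v].
  by case: (near_eq_differentiable (near_eq_open oU fg Ux) (df x Ux)).
apply: IH (Df v) => x Ux.
exact: near_eq_derive (near_eq_open oU fg Ux).
Qed.

Lemma Ck_cst V W k (U : set V) (a : W) : Ck k U (cst a).
Proof.
elim: k a => [|k IH] a /=; first by move=> x _; exact: cvg_cst.
split=> [x _|v]; first exact: differentiable_cst.
suff -> : (fun x => 'D_v (cst a) x) = cst 0 by [].
by apply/funext => x; rewrite derive_cst.
Qed.

Lemma CkD V W k (U : set V) (f g : V -> W) : open U ->
  Ck k U f -> Ck k U g -> Ck k U (fun x => f x + g x).
Proof.
move=> oU; elim: k f g => [|k IH] f g /=.
  by move=> cf cg x Ux; apply: cvgD; [exact: cf|exact: cg].
case=> df Df [dg Dg]; split=> [x Ux|v].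
  by apply: differentiableD; [exact: df|exact: dg].
apply: (Ck_ext oU _ (IH _ _ (Df v) (Dg v))) => x Ux.
by rewrite deriveD //; apply: diff_derivable; [exact: df|exact: dg].
Qed.

Lemma Ck_sum V W k (U : set V) (I : finType) (f : I -> V -> W) : open U ->
  (forall i, Ck k U (f i)) -> Ck k U (fun x => \sum_i f i x).
Proof.
move=> oU cf.
elim: (index_enum I) => [|i s IH].
  by apply: (Ck_ext oU _ (Ck_cst k U (0 : W))) => x _; rewrite big_nil.
by apply: (Ck_ext oU _ (CkD oU (cf i) IH)) => x _; rewrite big_cons.
Qed.

Lemma CkM V k (U : set V) (f g : V -> R) : open U ->
  Ck k U f -> Ck k U g -> Ck k U (fun x => f x * g x : R).
Proof.
move=> oU; elim: k f g => [|k IH] f g.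
  by move=> cf cg x Ux; apply: cvgM; [exact: cf|exact: cg].
move=> /[dup] /CkS ckf [df Df] /[dup] /CkS ckg [dg Dg]; split=> [x Ux|v].
  by apply: differentiableM; [exact: df|exact: dg].
apply: (Ck_ext oU _ (CkD oU (IH _ _ ckf (Dg v)) (IH _ _ ckg (Df v)))) => x Ux.
by rewrite deriveM //; apply: diff_derivable; [exact: df|exact: dg].
Qed.

Lemma Ck_prod V k (U : set V) (I : finType) (f : I -> V -> R) : open U ->
  (forall i, Ck k U (f i)) -> Ck k U (fun x => \prod_i f i x : R).
Proof.
move=> oU cf.
elim: (index_enum I) => [|i s IH].
  by apply: (Ck_ext oU _ (Ck_cst k U (1 : R))) => x _; rewrite big_nil.
by apply: (Ck_ext oU _ (CkM oU (cf i) IH)) => x _; rewrite big_cons.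
Qed.

Lemma CkV V k (U : set V) (f : V -> R) : open U -> (forall x, U x -> f x != 0) ->
  Ck k U f -> Ck k U (fun x => (f x)^-1 : R).
Proof.
move=> oU f0; elim: k => [|k IH].
  by move=> cf x Ux; apply: cvgV; [exact: f0|exact: cf].
move=> /[dup] /CkS ckf [df Df]; split=> [x Ux|v].
  by apply: differentiableV; [exact: df|exact: f0].
have c1 := CkM oU (Ck_cst k U (-1 : R)) (CkM oU (IH ckf) (IH ckf)).
apply: (Ck_ext oU _ (CkM oU c1 (Df v))).
move=> x Ux; rewrite deriveV ?f0 //; last exact/diff_derivable/df.
by rewrite /= mulN1r -invfM -expr2.
Qed.

Lemma rV_sum_delta m (v : 'rV[R]_m) : v = \sum_j v 0 j *: delta_mx 0 j.
Proof. exact: row_sum_delta. Qed.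

Lemma continuous_rV V m (f : V -> 'rV[R]_m) x :
  (forall j, {for x, continuous (fun x => f x 0 j : R)}) -> {for x, continuous f}.
Proof.
move=> H.
have -> : f = (fun x => \sum_(j < m) f x 0 j *: (delta_mx 0 j : 'rV[R]_m)).
  by apply/funext => y; exact: rV_sum_delta.
apply: cvg_big => [|j _]; first exact: add_continuous.
by apply: cvgZr_tmp; exact: H.
Qed.

Lemma differentiable_rV V m (f : V -> 'rV[R]_m) x :
  (forall j, differentiable (fun x => f x 0 j : R) x) -> differentiable f x.
Proof.
move=> H.
have -> : f = \sum_(j < m) (fun x => f x 0 j *: (delta_mx 0 j : 'rV[R]_m)).
  by apply/funext => y; rewrite fct_sumE; exact: rV_sum_delta.
by apply: differentiable_sum => j; exact: differentiableZl.
Qed.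

Lemma differentiable_coord_comp V m (f : V -> 'rV[R]_m) x j :
  differentiable f x -> differentiable (fun x => f x 0 j : R) x.
Proof.
move=> df; apply: (differentiable_comp (f := f) (g := fun v : 'rV[R]_m => v 0 j)) => //.
exact: differentiable_coord.
Qed.

Lemma derive_coord V m (f : V -> 'rV[R]_m) x v j : differentiable f x ->
  'D_v (fun x => f x 0 j : R) x = ('D_v f x) 0 j.
Proof. by move=> /(@diff_derivable _ _ _ _ _ v)/derive_mx ->; rewrite mxE. Qed.

Lemma Ck_rV V m k (U : set V) (f : V -> 'rV[R]_m) : open U ->
  (Ck k U f <-> forall j, Ck k U (fun x => f x 0 j : R)).
Proof.
move=> oU; elim: k f => [|k IH] f /=; split.
- move=> cf j x Ux; have c := @coord_continuous R 1 m 0 j (f x).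
  exact: (@continuous_comp _ _ _ f (fun v : 'rV[R]_m => v 0 j) x (cf x Ux) c).
- by move=> cf x Ux; apply: continuous_rV => j; exact: cf.
- move=> [df Df] j; split=> [x Ux|v]; first exact/differentiable_coord_comp/df.
  have /IH/(_ j) := Df v; apply: (Ck_ext oU) => x Ux.
  by rewrite derive_coord //; exact: df.
- move=> cf; have df x : U x -> differentiable f x.
    by move=> Ux; apply: differentiable_rV => j; case: (cf j) => + _; apply.
  split=> // v; apply/IH => j; case: (cf j) => _ /(_ v); apply: (Ck_ext oU) => x Ux.
  by rewrite derive_coord //; exact: df.
Qed.

Lemma derive_comp_rV V W m (f : V -> 'rV[R]_m) (g : 'rV[R]_m -> W) x v :
  differentiable f x -> differentiable g (f x) ->
  'D_v (fun x => g (f x)) x = \sum_j ('D_v f x) 0 j *: 'D_(delta_mx 0 j) g (f x).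
Proof.
move=> df dg; have dgf := differentiable_comp df dg.
rewrite (deriveE v dgf) (diff_comp df dg) /= -(deriveE v df).
rewrite {1}(rV_sum_delta ('D_v f x)) linear_sum; apply: eq_bigr => j _.
by rewrite linearZ (deriveE _ df) (deriveE _ dg).
Qed.

Lemma Ck_comp V m k (U : set V) (U' : set 'rV[R]_m) (f : V -> 'rV[R]_m)
    (g : 'rV[R]_m -> R) : open U -> (forall x, U x -> U' (f x)) ->
  Ck k U f -> Ck k U' g -> Ck k U (fun x => g (f x)).
Proof.
move=> oU sU; elim: k g => [|k IH] g.
  move=> cf cg x Ux; exact: (@continuous_comp _ _ _ f g x (cf x Ux) (cg _ (sU _ Ux))).
move=> /[dup] /CkS ckf [df Df] [dg Dg]; split=> [x Ux|v].
  exact: (differentiable_comp (df x Ux) (dg _ (sU _ Ux))).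
apply: (@Ck_ext _ _ _ U (fun x => \sum_j ('D_v f x) 0 j * 'D_(delta_mx 0 j) g (f x))) => //.
  by move=> x Ux; rewrite (derive_comp_rV _ (df x Ux) (dg _ (sU _ Ux))).
apply: Ck_sum => // j; apply: CkM => //; last exact: (IH (fun y => 'D_(delta_mx 0 j) g y) ckf (Dg _)).
by have /(Ck_rV k _ oU)/(_ j) := Df v.
Qed.

Lemma Ck_comp_rV V m p k (U : set V) (U' : set 'rV[R]_m) (f : V -> 'rV[R]_m)
    (g : 'rV[R]_m -> 'rV[R]_p) : open U -> open U' -> (forall x, U x -> U' (f x)) ->
  Ck k U f -> Ck k U' g -> Ck k U (fun x => g (f x)).
Proof.
move=> oU oU' sU cf /(Ck_rV _ _ oU') cg; apply/(Ck_rV _ _ oU) => j.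
exact: (Ck_comp oU sU cf (cg j)).
Qed.

Lemma Ck_det V k n (U : set V) (A : V -> 'M[R]_n) : open U ->
  (forall i j, Ck k U (fun x => A x i j)) -> Ck k U (fun x => \det (A x)).
Proof.
move=> oU cA; rewrite /determinant; apply: Ck_sum => // s.
apply: CkM => //; first exact: Ck_cst.
by apply: Ck_prod.
Qed.

(** Cramer's rule: the entries of the inverse are polynomials in those of A
    divided by the determinant. *)
Lemma Ck_invmx V k n (U : set V) (A : V -> 'M[R]_n) : open U ->
  (forall x, U x -> A x \in unitmx) ->
  (forall i j, Ck k U (fun x => A x i j)) ->
  forall i j, Ck k U (fun x => invmx (A x) i j).
Proof.
move=> oU uA cA i j.
have cof i' j' : Ck k U (fun x => cofactor (A x) i' j').
  apply: CkM => //; first exact: Ck_cst.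
  apply: Ck_det => // i1 j1.
  by apply: (Ck_ext oU _ (cA (lift i' i1) (lift j' j1))) => x _; rewrite !mxE.
apply: (@Ck_ext _ _ _ U (fun x => (\det (A x))^-1 * cofactor (A x) j i)) => //.
  by move=> x Ux; rewrite /invmx uA // !mxE.
apply: CkM => //; apply: CkV => //; last exact: Ck_det.
by move=> x /uA; rewrite unitmxE unitfE.
Qed.

End CkCalculus.

(** * The inverse function theorem *)

Section LinesAndMatrices.
Context {R : realType}.

(** Directional derivatives are derivatives along lines; this is how the theorems
    on functions of one real variable are used throughout. *)
Lemma is_derive_line (V W : normedModType R) (f : V -> W) (x v : V) (t : R) :
  differentiable f (x + t *: v) ->
  is_derive t (1 : R) (fun s : R => f (x + s *: v)) ('D_v f (x + t *: v)).
Proof.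
move=> df.
have dl : is_diff t (fun s : R => x + s *: v) ( *:%R^~ v).
  have H := is_diffD (is_diff_cst x t) (is_diff_scalel t v).
  by apply: is_diff_eq H _; apply/funext => s; rewrite !fctE add0r.
have dd : differentiable (fun s : R => x + s *: v) t by exact: ex_diff.
have dc := differentiable_comp dd df.
apply: DeriveDef; first exact: diff_derivable.
by rewrite (deriveE _ dc) (diff_comp dd df) /= diff_val scale1r deriveE.
Qed.

Lemma is_diff_linear_comp (V W W' : normedModType R) (l : {linear W -> W'})
    (f : V -> W) (x : V) : continuous l -> differentiable f x ->
  is_diff x (fun z => l (f z)) (fun v => l ('d f x v)).
Proof.
move=> cl df; have dl := linear_differentiable (f x) cl.
apply: DiffDef; first exact: differentiable_comp df dl.
by rewrite (diff_comp df dl) (diff_lin _ cl).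
Qed.

Lemma coord_le_norm n (v : 'rV[R]_n) j : `|v 0 j| <= `|v|.
Proof.
rewrite [leRHS]/Num.Def.normr /= mx_normrE.
exact: (le_bigmax _ (fun ij : 'I_1 * 'I_n => `|v ij.1 ij.2|) (0, j)).
Qed.

Lemma entry_le_norm m n (A : 'M[R]_(m, n)) i j : `|A i j| <= `|A|.
Proof.
rewrite [leRHS]/Num.Def.normr /= mx_normrE.
exact: (le_bigmax _ (fun ij : 'I_m * 'I_n => `|A ij.1 ij.2|) (i, j)).
Qed.

Lemma mx_norm_le m n (A : 'M[R]_(m, n)) (C : R) : 0 <= C ->
  (forall i j, `|A i j| <= C) -> `|A| <= C.
Proof.
move=> C0 H; rewrite [leLHS]/Num.Def.normr /= mx_normrE.
by apply: bigmax_le => // -[i j] _; exact: H.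
Qed.

Lemma norm_mulmx_le m n p (A : 'M[R]_(m, n)) (B : 'M[R]_(n, p)) :
  `|A *m B| <= n%:R * `|A| * `|B|.
Proof.
apply: mx_norm_le => [|i j]; first by rewrite !mulr_ge0.
rewrite mxE (le_trans (ler_norm_sum _ _ _)) //.
have -> : n%:R * `|A| * `|B| = \sum_(k < n) `|A| * `|B|.
  by rewrite sumr_const card_ord -mulrA mulr_natl.
apply: ler_sum => k _; rewrite normrM.
by apply: ler_pM => //; exact: entry_le_norm.
Qed.

Lemma mulmx_continuous n p (B : 'M[R]_(n, p)) :
  continuous (fun v : 'rV[R]_n => v *m B).
Proof.
move=> v; apply: continuous_rV => j /=.
have -> : (fun x : 'rV[R]_n => (x *m B) 0 j) = (fun x => \sum_k x 0 k * B k j).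
  by apply/funext => x; rewrite mxE.
suff H : Ck 0 setT (fun x : 'rV[R]_n => \sum_k x 0 k * B k j : R) by exact: H.
apply: Ck_sum => [|k]; first exact: openT.
apply: CkM; [exact: openT| |exact: Ck_cst].
by move=> x _; exact: coord_continuous.
Qed.

(** Vector-valued functions have no exact mean value theorem; the sup norm lets
    one apply the scalar one to each coordinate. *)
Lemma mean_value_le (V : normedModType R) m (f : V -> 'rV[R]_m) (x y : V) (C : R) :
  0 <= C ->
  (forall t : R, 0 <= t <= 1 -> differentiable f (y + t *: (x - y))) ->
  (forall t : R, 0 <= t <= 1 -> `|'D_(x - y) f (y + t *: (x - y))| <= C) ->
  `|f x - f y| <= C.
Proof.
move=> C0 df Cf; apply: mx_norm_le => // i j; rewrite ord1 !mxE.
pose g (t : R) := f (y + t *: (x - y)) 0 j.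
pose dg (t : R) := ('D_(x - y) f (y + t *: (x - y))) 0 j.
have gder (t : R) : 0 <= t <= 1 -> is_derive t (1 : R) g (dg t).
  move=> t01.
  have dfj := differentiable_coord_comp j (df t t01).
  have := @is_derive_line V R^o (fun z => f z 0 j : R) y (x - y) t dfj.
  by rewrite derive_coord //; exact: df.
have [c c01 E] : exists2 c, c \in `[(0:R), 1]%R & g 1 - g 0 = dg c * (1 - 0).
  apply: MVT_segment => //.
    by move=> t /[!in_itv] /andP[t0 t1]; apply: gder; rewrite !ltW.
  apply: derivable_within_continuous => t /[!in_itv] t01.
  by have [] := gder t t01.
move: E; rewrite /g scale1r scale0r addr0 [y + _]addrC subrK subr0 mulr1 => ->.
rewrite (le_trans (coord_le_norm _ _)) //; apply: Cf.
by move: c01; rewrite in_itv.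
Qed.

End LinesAndMatrices.

HB.instance Definition _ (R : realType) m n := Complete.on 'M[R]_(m, n).

Section InverseFunction.
Context {R : realType} {n : nat}.
Variables (U : set 'rV[R]_n) (F : 'rV[R]_n -> 'rV[R]_n) (x0 : 'rV[R]_n).
Hypotheses (oU : open U) (Ux0 : U x0) (sF : smooth_on U F).
Hypothesis (iF : forall x, U x -> injective ('d F x)).

Let dF x : U x -> differentiable F x.
Proof. by move=> Ux; have [H _] := sF 1; exact: H. Qed.

Let J x := jacobian F x.

Let JE x v : U x -> 'D_v F x = v *m J x.
Proof. by move=> /dF/deriveEjacobian ->. Qed.

Lemma jacobian_entry x i j : U x -> J x i j = ('D_(delta_mx 0 i) F x) 0 j.
Proof. by move=> Ux; rewrite JE // -rowE [RHS]mxE. Qed.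

Lemma jacobian_unit x : U x -> J x \in unitmx.
Proof.
move=> Ux; rewrite -row_free_unit; apply: inj_row_free => v.
rewrite -JE // deriveE; last exact: dF.
by move=> v0; apply: (iF Ux); rewrite v0 linear0.
Qed.

Let L := invmx (J x0).

Lemma jacobian_Ck k i j : Ck k U (fun x => J x i j : R).
Proof.
case: (sF k.+1) => _ /(_ (delta_mx 0 i)) /(Ck_rV _ _ oU)/(_ j).
by apply: Ck_ext => // x Ux; rewrite jacobian_entry.
Qed.

Lemma jacobian_near (e : R) : 0 < e -> \forall x \near x0, `|J x0 - J x| <= e.
Proof.
move=> e0.
have H : \forall x \near x0, forall ij : 'I_n * 'I_n, `|J x0 ij.1 ij.2 - J x ij.1 ij.2| <= e.
  apply: (@filter_forall _ _ (fun (ij : 'I_n * 'I_n) (x : 'rV[R]_n) => `|J x0 ij.1 ij.2 - J x ij.1 ij.2| <= e : Prop) (nbhs x0) (nbhs_filter x0)) => -[i j].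
  have /cvgrPdist_le/(_ e e0) := (jacobian_Ck 0 i j) x0 Ux0.
  by [].
apply: filterS H => x H; apply: mx_norm_le => [|i j]; first exact: ltW.
rewrite [X in `|X|]mxE [X in _ + X]mxE; exact: (H (i, j)).
Qed.

(** Preconditioning by the inverse differential at x0 makes F close to the
    identity. *)
Lemma near_contraction : exists2 r : R, 0 < r & ball x0 r `<=` U /\
  forall x v, ball x0 r x -> `|v - 'D_v F x *m L| <= `|v| / 2.
Proof.
pose e : R := (2 * (n%:R * n%:R * `|L| + 1))^-1.
have D0 : 0 < n%:R * n%:R * `|L| + 1 by rewrite ltr_wpDl // !mulr_ge0.
have e0 : 0 < e by rewrite invr_gt0 mulr_gt0.
have NU : nbhs x0 U by exact: open_nbhs_nbhs.
have NJ : nbhs x0 (U `&` [set x | `|J x0 - J x| <= e]).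
  by apply: filterI NU _; exact: jacobian_near.
move: NJ => /nbhs_ballP [r /= r0 Hr].
exists r => //; split=> [x /Hr[]//|x v /Hr [Ux Jx]].
rewrite JE // -[X in X - _]mulmx1 -(mulmxV (jacobian_unit Ux0)) -/L mulmxA -mulmxBl -mulmxBr.
rewrite (le_trans (norm_mulmx_le _ _)) //.
rewrite (@le_trans _ _ (n%:R * (n%:R * `|v| * e) * `|L|)) //.
  rewrite ler_wpM2r // ler_wpM2l // (le_trans (norm_mulmx_le _ _)) //.
  by rewrite ler_wpM2l // mulr_ge0.
have -> : n%:R * (n%:R * `|v| * e) * `|L| = `|v| * ((n%:R * n%:R * `|L|) * e) by ring.
rewrite ler_wpM2l // /e ler_pdivrMr ?mulr_gt0 //.
by rewrite mulrA mulVf ?pnatr_eq0 // mul1r lerDl.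
Qed.

Lemma almost_isometry r : 0 < r -> ball x0 r `<=` U ->
  (forall x v, ball x0 r x -> `|v - 'D_v F x *m L| <= `|v| / 2) ->
  forall x y, ball x0 r x -> ball x0 r y ->
  `|(x - y) - (F x - F y) *m L| <= `|x - y| / 2.
Proof.
move=> r0 rU H x y xr yr.
pose f z := z - F z *m L.
have -> : x - y - (F x - F y) *m L = f x - f y by rewrite /f mulmxBl !opprB addrACA addrAC [- y + _]addrC !addrA addrAC.
have conv (t : R) : 0 <= t <= 1 -> ball x0 r (y + t *: (x - y)).
  move=> /andP[t0 t1]; move: xr yr; rewrite -ball_normE /ball_ /= => xr yr.
  have -> : x0 - (y + t *: (x - y)) = t *: (x0 - x) + (1 - t) *: (x0 - y).
    by rewrite !scalerBr !scalerBl !scale1r; apply/rowP => k; rewrite !mxE; ring.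
  rewrite (le_lt_trans (ler_normD _ _)) // !normrZ (ger0_norm t0) ger0_norm ?subr_ge0 //.
  have [->|tn0] := eqVneq t 0; first by rewrite mul0r add0r subr0 mul1r.
  rewrite (@lt_le_trans _ _ (t * r + (1 - t) * r)) //; last by rewrite -mulrDl addrC subrK mul1r.
  apply: ltr_leD; first by rewrite ltr_pM2l // lt_def tn0.
  by apply: ler_wpM2l; [rewrite subr_ge0|exact: ltW].
have dL z : U z -> is_diff z (fun z => F z *m L) (fun v => 'd F z v *m L).
  move=> Uz.
  have cL : continuous (mulmxr L : 'rV[R]_n -> 'rV[R]_n) by exact: mulmx_continuous.
  exact: (is_diff_linear_comp cL (dF Uz)).
have df z : U z -> is_diff z f (fun v => v - 'd F z v *m L).
  move=> Uz; have := dL z Uz => dLz.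
  exact: (is_diffB (is_diff_id z) dLz).
apply: mean_value_le => [|t t01|t t01]; first by rewrite divr_ge0.
  by have [] := df _ (rU _ (conv t t01)).
have D := df _ (rU _ (conv t t01)).
have DF := dF (rU _ (conv t t01)).
have Dd : differentiable f (y + t *: (x - y)) by case: D.
by rewrite (deriveE _ Dd) diff_val -(deriveE _ DF); exact/H/conv.
Qed.

(** The Banach fixed point theorem for x |-> x - (F x - w) L gives the local
    inverse G; being Lipschitz, G is differentiable with the inverse differential,
    and then its smoothness follows by bootstrapping: the entries of an inverse
    matrix are smooth in those of the matrix. *)
Theorem inverse_function : exists (G : 'rV[R]_n -> 'rV[R]_n) (U' : set 'rV[R]_n) (d : R),
  [/\ 0 < d, open U' /\ U' x0, U' `<=` U,
      forall x y, U' x -> U' y -> F x = F y -> x = y &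
      (forall w, ball (F x0) d w -> U' (G w) /\ F (G w) = w) /\
      smooth_on (ball (F x0) d) G].
Proof.
have [r r0 [rU contr]] := near_contraction.
have iso := almost_isometry r0 rU contr.
pose K : R := 2 * (n%:R * `|L|).
have K0 : 0 <= K by rewrite !mulr_ge0.
have lip x y : ball x0 r x -> ball x0 r y -> `|x - y| <= K * `|F x - F y|.
  move=> xr yr; have H := iso x y xr yr.
  have H2 := norm_mulmx_le (F x - F y) L.
  have H3 := ler_normD ((x - y) - (F x - F y) *m L) ((F x - F y) *m L).
  rewrite subrK in H3; rewrite /K.
  have -> : 2 * (n%:R * `|L|) * `|F x - F y| = 2 * (n%:R * `|F x - F y| * `|L|) by ring.
  lra.
have inj x y : ball x0 r x -> ball x0 r y -> F x = F y -> x = y.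
  move=> xr yr E; have := lip x y xr yr; rewrite E subrr normr0 mulr0 normr_le0 subr_eq0.
  by move/eqP.
(* For w within d of F x0 the map x |-> x - (F x - w) L preserves the closed ball
   of radius r / 2, as r / 4 + r / 4 = r / 2. *)
pose d : R := r / (4 * (n%:R * `|L| + 1)).
have nL0 : 0 < n%:R * `|L| + 1 by rewrite ltr_wpDl // mulr_ge0.
have d0 : 0 < d by rewrite divr_gt0 // mulr_gt0.
have sur w : ball (F x0) d w -> exists x, ball x0 r x /\ F x = w.
  move=> wd0; have wd : `|F x0 - w| < d by move: wd0; rewrite -ball_normE.
  pose B := [set x : 'rV[R]_n | `|x0 - x| <= r / 2].
  have Br x : B x -> ball x0 r x.
    by rewrite -ball_normE /= /B /= => /le_lt_trans; apply; rewrite ltr_pdivrMr // ltr_pMr // ltr1n.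
  have x0r : ball x0 r x0 by exact: ballxx.
  pose phi x := x - (F x - w) *m L.
  have phiB x y : B x -> B y -> `|phi x - phi y| <= `|x - y| / 2.
    move=> /Br xr /Br yr; have := iso x y xr yr.
    suff -> : x - y - (F x - F y) *m L = phi x - phi y by [].
    by rewrite /phi !mulmxBl; apply/rowP => k; rewrite !mxE; ring.
  have phiBB x : B x -> B (phi x).
    move=> Bx; have Bx0 : B x0 by rewrite /B /= subrr normr0 divr_ge0 // ltW.
    have H1 := phiB x0 x Bx0 Bx.
    have E : x0 - phi x = (phi x0 - phi x) + (F x0 - w) *m L.
      by rewrite /phi; apply/rowP => k; rewrite !mxE; ring.
    rewrite /B /= E (le_trans (ler_normD _ _)) //.
    have H2 : `|(F x0 - w) *m L| <= r / 4.
      rewrite (le_trans (norm_mulmx_le _ _)) //.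
      rewrite (@le_trans _ _ (n%:R * d * `|L|)) //.
        by rewrite ler_wpM2r // ler_wpM2l // ltW.
      have -> : n%:R * d * `|L| = (r / 4) * ((n%:R * `|L|) / (n%:R * `|L| + 1)).
        by rewrite /d; field; rewrite gt_eqF.
      rewrite ler_piMr //; first by rewrite divr_ge0 // ltW.
      by rewrite ler_pdivrMr // mul1r lerDl.
    rewrite /B /= in Bx; lra.
  have [p Bp pE] : exists2 p, B p & p = phi p.
    have Hfun : {homo phi : x / B x >-> B x} by [].
    have ic : is_contraction (mkfun_fun Hfun).
      exists (2^-1)%:nng; split; first by rewrite /= invf_lt1 // ltr1n.
      by move=> -[x y] [/= Bx By]; rewrite mulrC; exact: phiB.
    apply: (banach_fixed_point ic).
      have -> : B = closed_ball x0 (r / 2) by rewrite closed_ballE ?divr_gt0.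
      exact: closed_ball_closed.
    by exists x0; rewrite /B /= subrr normr0 divr_ge0 // ltW.
  exists p; split; first exact: (Br _ Bp).
  have E : (F p - w) *m L = 0.
    have pE2 : p = p - (F p - w) *m L := pE.
    by apply/eqP; rewrite -oppr_eq0 -(inj_eq (addrI p)) addr0 -pE2.
  have : (F p - w) *m L *m J x0 = 0 by rewrite E mul0mx.
  rewrite -mulmxA mulVmx ?jacobian_unit // mulmx1 => /eqP.
  by rewrite subr_eq0 => /eqP.
have surj w : exists x, ball (F x0) d w -> ball x0 r x /\ F x = w.
  have [wd|nwd] := pselect (ball (F x0) d w); last by exists x0.
  by have [x Hx] := sur w wd; exists x.
have [G HG] := choice surj.
pose V := ball (F x0) d.
have oV : open V by exact: ball_open.
have GU w : V w -> U (G w) by move=> /HG [/rU].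
have Glip w w' : V w -> V w' -> `|G w - G w'| <= K * `|w - w'|.
  by move=> /HG [xr E] /HG [yr E']; rewrite -{2}E -{2}E'; exact: lip.
have dG w : V w -> differentiable G w /\ 'd G w = mulmxr (invmx (J (G w))) :> (_ -> _).
  move=> Vw; have cl : continuous (mulmxr (invmx (J (G w))) : 'rV[R]_n -> 'rV[R]_n).
    exact: mulmx_continuous.
  apply: (differentiableI cl) => e e0.
  set A := invmx (J (G w)) in cl *.
  have nA0 : 0 <= n%:R * `|A| by rewrite mulr_ge0.
  pose e' := e / (n%:R * `|A| * K + 1).
  have D0 : 0 < n%:R * `|A| * K + 1 by rewrite ltr_wpDl // mulr_ge0.
  have e'0 : 0 < e' by rewrite divr_gt0.
  have := differentiable_near0 (dF (GU w Vw)) e'0.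
  move=> /nbhs_ballP [s /= s0 Hs].
  have Vn : nbhs (0 : 'rV[R]_n) [set h | V (h + w)].
    have : \forall x \near w, V x by exact: open_nbhs_nbhs.
    by rewrite (near_shift 0) subr0.
  have sn : nbhs (0 : 'rV[R]_n) (ball 0 (s / (K + 1))).
    by apply: nbhsx_ballx; rewrite divr_gt0 // ltr_wpDl.
  apply: filterS2 Vn sn => h /= Vh; rewrite -ball_normE /= sub0r normrN => hs.
  set k := G (h + w) - G w.
  have kK : `|k| <= K * `|h| by rewrite (le_trans (Glip _ _ Vh Vw)) // addrK.
  have ks : `|k| < s.
    rewrite (le_lt_trans kK) //; move: hs; rewrite ltr_pdivlMr ?ltr_wpDl // => hs.
    by rewrite (le_lt_trans _ hs) // mulrC ler_wpM2l // lerDl.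
  have Hk : ball (0 : 'rV[R]_n) s k by rewrite -ball_normE /= sub0r normrN.
  have := Hs k Hk; rewrite /= /k subrK -/k.
  have [_ ->] := HG _ Vh; have [_ ->] := HG _ Vw; rewrite addrK => H.
  have E : k - h *m A = - ((h - 'd F (G w) k) *m A).
    have UGw := GU w Vw.
    have -> : 'd F (G w) k = k *m J (G w) by rewrite -JE // deriveE //; exact: dF.
    by rewrite mulmxBl -mulmxA mulmxV ?jacobian_unit // mulmx1 opprB.
  rewrite E normrN (le_trans (norm_mulmx_le _ _)) //.
  rewrite (@le_trans _ _ (n%:R * (e' * (K * `|h|)) * `|A|)) //.
    rewrite ler_wpM2r // ler_wpM2l // (le_trans H) // ler_wpM2l //; exact: ltW.
  have -> : n%:R * (e' * (K * `|h|)) * `|A| = (e * `|h|) * ((n%:R * `|A| * K) / (n%:R * `|A| * K + 1)).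
    by rewrite /e'; field; rewrite gt_eqF.
  rewrite ler_piMr //; first by rewrite mulr_ge0 // ltW.
  by rewrite ler_pdivrMr // mul1r lerDl.
have DG w v : V w -> 'D_v G w = v *m invmx (J (G w)).
  by move=> /dG [dGw E]; rewrite deriveE // E.
have sG k : Ck k V G.
  elim: k => [|k IH]; first by move=> w /dG [/differentiable_continuous].
  split=> [w /dG []//|v].
  apply/(Ck_rV _ _ oV) => j.
  apply: (@Ck_ext _ _ _ _ V (fun w => \sum_i v 0 i * invmx (J (G w)) i j)) => //.
    by move=> w Vw; rewrite DG // mxE.
  apply: Ck_sum => // i; apply: CkM => //; first exact: Ck_cst.
  apply: Ck_invmx => // [w Vw|i1 j1]; first exact/jacobian_unit/GU.
  exact: (Ck_comp oV GU IH (jacobian_Ck k i1 j1)).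
exists G, (ball x0 r), d; split=> //.
by split; [exact: ball_open|exact: ballxx].
Qed.

End InverseFunction.

(** * Lorentzian linear algebra *)

Section Lorentz.
Context {R : realType} {m : nat}.
Implicit Types (x y z : 'rV[R]_m.+1).

Lemma lorentzC x y : lorentz x y = lorentz y x.
Proof. by rewrite /lorentz mulrC; congr (_ + _); apply: eq_bigr => i _; rewrite mulrC. Qed.

Lemma lorentzDl x y z : lorentz (x + y) z = lorentz x z + lorentz y z.
Proof.
rewrite /lorentz mxE mulrDl opprD addrACA -big_split /=; congr (_ + _).
by apply: eq_bigr => i _; rewrite mxE mulrDl.
Qed.

Lemma lorentzZl c x y : lorentz (c *: x) y = c * lorentz x y.
Proof.
rewrite /lorentz mxE mulrDr mulrN mulrA mulr_sumr; congr (_ + _).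
by apply: eq_bigr => i _; rewrite mxE mulrA.
Qed.

Lemma lorentzNl x y : lorentz (- x) y = - lorentz x y.
Proof. by rewrite -scaleN1r lorentzZl mulN1r. Qed.

Lemma lorentzBl x y z : lorentz (x - y) z = lorentz x z - lorentz y z.
Proof. by rewrite lorentzDl lorentzNl. Qed.

Lemma lorentz0l x : lorentz 0 x = 0.
Proof. by rewrite -(scale0r 0) lorentzZl mul0r. Qed.

Lemma lorentz_suml (I : Type) (r : seq I) (F : I -> 'rV[R]_m.+1) y :
  lorentz (\sum_(i <- r) F i) y = \sum_(i <- r) lorentz (F i) y.
Proof.
elim: r => [|i r IH]; first by rewrite !big_nil lorentz0l.
by rewrite !big_cons lorentzDl IH.
Qed.

Lemma lorentz_e0 x : lorentz x (e0 m) = - x 0 0.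
Proof.
rewrite /lorentz /e0 mxE !eqxx mulr1 big1 ?addr0 // => i _.
by rewrite mxE eqxx /= mulr0.
Qed.

Lemma lorentz_nondegenerate x : (forall y, lorentz x y = 0) -> x = 0.
Proof.
move=> H; apply/rowP => i; rewrite mxE.
have [j ->|->] := unliftP 0 i.
  have := H (delta_mx 0 (lift 0 j)); rewrite /lorentz mxE eqxx /=.
  rewrite mulr0 oppr0 add0r (bigD1 j) //= mxE !eqxx mulr1 big1 ?addr0 // => k kj.
  by rewrite mxE eqxx /= (inj_eq lift_inj) (negPf kj) mulr0.
by have := H (e0 m); rewrite lorentz_e0 => /eqP; rewrite oppr_eq0 => /eqP.
Qed.

End Lorentz.

Section Frame.
Context {R : realType}.

(** Completion of a unit vector nu to an orthonormal basis of R^(n+1), by the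
    Householder reflection that exchanges nu and s e_0; the sign s keeps the
    denominator away from zero. *)
Lemma orthonormal_completion n (nu : 'I_n.+1 -> R) : \sum_i nu i ^+ 2 = 1 ->
  exists f : 'I_n -> 'I_n.+1 -> R, forall x y : 'I_n.+1 -> R,
  \sum_i x i * y i = (\sum_i nu i * x i) * (\sum_i nu i * y i) +
    \sum_j (\sum_i f j i * x i) * (\sum_i f j i * y i).
Proof.
move=> nu1.
(* With this sign the vector w = nu - s e_0 of the reflection has norm at least
   one. *)
have [s s2 snu] : exists2 s : R, s ^+ 2 = 1 & s * nu 0 <= 0.
  have [h|h] := leP 0 (nu 0).
    by exists (-1); [rewrite sqrrN expr1n|rewrite mulN1r oppr_le0].
  by exists 1; [rewrite expr1n|rewrite mul1r ltW].
pose w i := nu i - (if i == 0 then s else 0).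
pose k := (1 - s * nu 0)^-1.
have D0 : 1 - s * nu 0 != 0 by rewrite gt_eqF // subr_gt0 (le_lt_trans snu).
have wx x : \sum_i w i * x i = \sum_i nu i * x i - s * x 0.
  under eq_bigr do rewrite mulrBl.
  rewrite sumrB; congr (_ - _); rewrite (bigD1 0) //= big1 ?addr0 // => i /negPf ->.
  by rewrite mul0r.
have ww : \sum_i w i * w i = 2 * (1 - s * nu 0).
  rewrite wx /w eqxx.
  have -> : \sum_i nu i * (nu i - (if i == 0 then s else 0)) =
      \sum_i w i * nu i by apply: eq_bigr => i _; rewrite mulrC.
  rewrite wx; under eq_bigr do rewrite -expr2; rewrite nu1.
  by have : s * s = 1 by [rewrite -expr2]; lra.
pose f (j : 'I_n) i : R := (if i == lift 0 j then 1 else 0) - k * w (lift 0 j) * w i.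
have fx x j : \sum_i f j i * x i = x (lift 0 j) - k * w (lift 0 j) * \sum_i w i * x i.
  under eq_bigr do rewrite mulrBl.
  rewrite sumrB mulr_sumr; congr (_ - _); last by apply: eq_bigr => i _; rewrite mulrA.
  rewrite (bigD1 (lift 0 j)) //= eqxx mul1r big1 ?addr0 // => i /negPf ->.
  by rewrite mul0r.
exists f => x y.
have E0 x' : x' 0 - k * w 0 * (\sum_i w i * x' i) = s * \sum_i nu i * x' i.
  rewrite wx; have -> : k * w 0 = - s.
    apply: (mulfI D0); rewrite /k mulrA mulfV // mul1r /w eqxx.
    have : s * s = 1 by rewrite -expr2.
    by move=> ss; ring: ss.
  have ss : s * s = 1 by rewrite -expr2.
  by ring: ss.
set X := \sum_i w i * x i in E0 *; set Y := \sum_i w i * y i.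
have refl : \sum_i (x i - k * w i * X) * (y i - k * w i * Y) = \sum_i x i * y i.
  transitivity (\sum_i (x i * y i - k * Y * (w i * x i) - k * X * (w i * y i) + k ^+ 2 * X * Y * (w i * w i))).
    by apply: eq_bigr => i _; ring.
  rewrite big_split /= !sumrB -!mulr_sumr -/X -/Y ww.
  have kk : k * (1 - s * nu 0) = 1 by rewrite /k mulVf.
  set S := \sum_i x i * y i.
  have -> : k ^+ 2 * X * Y * (2 * (1 - s * nu 0)) = 2 * (k * X * Y) * (k * (1 - s * nu 0)) by ring.
  by rewrite kk; ring.
rewrite -refl big_ord_recl /= -/X -/Y.
have EX := E0 x; have EY := E0 y; rewrite -/X -/Y in EX EY.
rewrite EX EY; congr (_ + _).
  have ss : s * s = 1 by rewrite -expr2.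
  by ring: ss.
by apply: eq_bigr => j _; rewrite !fx.
Qed.

(** The null direction a extends to a frame (a, b, E_1, ..., E_n) in which the
    Lorentz product is 2 ab + |E|^2: the coordinates <x, a> and <x, E_i> / <x, a>
    are those of the half-space model of the steady state space. *)
Lemma null_frame n (a : 'rV[R]_n.+2) : null_past_pointing a ->
  exists (b : 'rV[R]_n.+2) (E : 'I_n -> 'rV[R]_n.+2), forall x y,
  lorentz x y = lorentz x a * lorentz y b + lorentz x b * lorentz y a +
    \sum_i lorentz x (E i) * lorentz y (E i).
Proof.
case=> _ aa; rewrite lorentz_e0 oppr_gt0 => a0.
pose al := - a 0 0; have al0 : al != 0 by rewrite oppr_eq0 lt_eqF.
pose nu i := a 0 (lift 0 i) / al.
have nu1 : \sum_i nu i ^+ 2 = 1.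
  have : \sum_i a 0 (lift 0 i) * a 0 (lift 0 i) = al ^+ 2.
    by move: aa; rewrite /lorentz /al; lra.
  move=> S; under eq_bigr do rewrite expr_div_n expr2.
  by rewrite -mulr_suml S mulfV // expf_neq0.
have [f Hf] := orthonormal_completion nu1.
pose ext (t : R) (g : 'I_n.+1 -> R) : 'rV[R]_n.+2 :=
  \row_i (if unlift 0 i is Some j then g j else t).
have lext x t g : lorentz x (ext t g) = - (x 0 0 * t) + \sum_i g i * x 0 (lift 0 i).
  rewrite /lorentz /ext mxE unlift_none; congr (_ + _).
  by apply: eq_bigr => i _; rewrite mxE liftK mulrC.
have aE : a = ext (a 0 0) (fun i => al * nu i).
  apply/rowP => i; rewrite mxE; have [j ->|->] := unliftP 0 i.
    by rewrite /nu mulrC divfK.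
  by [].
have la x : lorentz x a = al * (x 0 0 + \sum_i nu i * x 0 (lift 0 i)).
  rewrite {1}aE lext mulrDr mulr_sumr; congr (_ + _).
    by rewrite /al mulNr mulrC.
  by apply: eq_bigr => i _; rewrite [RHS]mulrA.
exists (ext (2 * al)^-1 (fun i => (2 * al)^-1 * nu i)), (fun j => ext 0 (f j)) => x y.
have fE j z : lorentz z (ext 0 (f j)) = \sum_i f j i * z 0 (lift 0 i).
  by rewrite lext mulr0 oppr0 add0r.
under [X in _ + X]eq_bigr => j _ do rewrite !fE.
rewrite !la !lext.
have sc z : \sum_i (2 * al)^-1 * nu i * z 0 (lift 0 i) = (2 * al)^-1 * \sum_i nu i * z 0 (lift 0 i).
  by rewrite mulr_sumr; apply: eq_bigr => i _; rewrite [RHS]mulrA.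
rewrite !sc {1}/lorentz (Hf (fun i => x 0 (lift 0 i)) (fun i => y 0 (lift 0 i))).
rewrite addrA; congr (_ + _).
by field.
Qed.

End Frame.

(** * The half-space model of the steady state space *)

Section CkLinear.
Context {R : realType}.

Lemma Ck_id (V : normedModType R) k (U : set V) : Ck k U (id : V -> V).
Proof.
case: k => [|k]; first by move=> x _; exact: cvg_id.
split=> [x _|v]; first exact: ex_diff.
suff -> : (fun x : V => 'D_v id x) = cst v by exact: Ck_cst.
by apply/funext => x; rewrite derive_id.
Qed.

Lemma Ck_coord n k (U : set 'rV[R]_n) j : open U -> Ck k U (fun x : 'rV[R]_n => x 0 j : R).
Proof. by move=> oU; have /(Ck_rV _ _ oU)/(_ j) := Ck_id k U. Qed.

Lemma Ck_lorentz (V : normedModType R) m k (U : set V) (f g : V -> 'rV[R]_m.+1) :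
  open U -> Ck k U f -> Ck k U g -> Ck k U (fun x => lorentz (f x) (g x) : R).
Proof.
move=> oU /(Ck_rV _ _ oU) cf /(Ck_rV _ _ oU) cg.
rewrite /lorentz; apply: CkD => //.
  apply: (@Ck_ext _ _ _ _ U (fun x => (-1) * (f x 0 0 * g x 0 0))) => //.
    by move=> x _; rewrite mulN1r.
  by apply: CkM => //; [exact: Ck_cst|exact: CkM].
by apply: Ck_sum => // i; exact: CkM.
Qed.

Lemma derive_lorentz (V : normedModType R) m (f g : V -> 'rV[R]_m.+1) x v :
  differentiable f x -> differentiable g x ->
  differentiable (fun x => lorentz (f x) (g x) : R) x /\
  'D_v (fun x => lorentz (f x) (g x) : R) x =
    lorentz ('D_v f x) (g x) + lorentz (f x) ('D_v g x).
Proof.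
move=> df dg.
have dfj j := differentiable_coord_comp j df.
have dgj j := differentiable_coord_comp j dg.
have E : (fun x => lorentz (f x) (g x)) =
    - ((fun x => f x 0 0) * (fun x => g x 0 0)) +
    \sum_i ((fun x => f x 0 (lift 0 i) : R) * (fun x => g x 0 (lift 0 i))).
  by apply/funext => y; rewrite !fctE fct_sumE.
have dm i : differentiable ((fun x => f x 0 i : R) * (fun x => g x 0 i)) x.
  exact: differentiableM.
have dD : differentiable (- ((fun x => f x 0 0) * (fun x => g x 0 0)) +
    \sum_i ((fun x => f x 0 (lift 0 i) : R) * (fun x => g x 0 (lift 0 i)))) x.
  by apply: differentiableD; [exact: differentiableN|exact: differentiable_sum].
split; first by rewrite E.
have DM i : 'D_v ((fun x => f x 0 i : R) * (fun x => g x 0 i)) x =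
    ('D_v f x) 0 i * g x 0 i + f x 0 i * ('D_v g x) 0 i.
  rewrite deriveM; [|exact: diff_derivable|exact: diff_derivable].
  rewrite (derive_coord v i df) (derive_coord v i dg) addrC.
  by congr (_ + _); exact: mulrC.
rewrite E deriveD; [|exact/derivableN/diff_derivable/dm|]; last first.
  by apply: derivable_sum => i; exact/diff_derivable/dm.
rewrite deriveN; last exact/diff_derivable/dm.
rewrite derive_sum; last by move=> i; exact/diff_derivable/dm.
rewrite DM /lorentz opprD addrACA -big_split /=; congr (_ + _).
by apply: eq_bigr => i _; rewrite DM.
Qed.

End CkLinear.

Section HalfSpace.
Context {R : realType} {n : nat}.
Variables (a b : 'rV[R]_n.+2) (E : 'I_n -> 'rV[R]_n.+2).
Hypothesis frame : forall x y, lorentz x y =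
  lorentz x a * lorentz y b + lorentz x b * lorentz y a +
  \sum_i lorentz x (E i) * lorentz y (E i).

Definition half_space_proj (x : 'rV[R]_n.+2) : 'rV[R]_n :=
  \row_i (lorentz x (E i) / lorentz x a).

(** In the half-space coordinates (y, u) the metric of de Sitter space is
    u^2 |dy|^2 - du^2 / u^2. *)
Lemma de_sitter_metric (x v : 'rV[R]_n.+2) :
  lorentz x x = 1 -> lorentz v x = 0 -> 0 < lorentz x a ->
  lorentz v v = \sum_i (lorentz v (E i) - half_space_proj x 0 i * lorentz v a) ^+ 2 -
    (lorentz v a / lorentz x a) ^+ 2.
Proof.
move=> xx vx u0; have un0 : lorentz x a != 0 by rewrite gt_eqF.
set u := lorentz x a in u0 un0 *; set da := lorentz v a; set db := lorentz v b.
pose be := lorentz x b.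
pose y i := half_space_proj x 0 i.
have yE i : lorentz x (E i) = y i * u by rewrite /y mxE divfK.
pose Y2 := \sum_i y i ^+ 2.
pose YE := \sum_i y i * lorentz v (E i).
have E1 : 1 = 2 * u * be + u ^+ 2 * Y2.
  rewrite -{1}xx frame -/u -/be mulr_sumr.
  under eq_bigr do rewrite !yE.
  have -> : \sum_i y i * u * (y i * u) = \sum_i u ^+ 2 * y i ^+ 2.
    by apply: eq_bigr => i _; ring.
  by ring.
have E2 : 0 = da * be + db * u + u * YE.
  rewrite -{1}vx frame -/u -/be -/da -/db mulr_sumr; congr (_ + _).
  by apply: eq_bigr => i _; rewrite yE; ring.
have -> : \sum_i (lorentz v (E i) - half_space_proj x 0 i * da) ^+ 2 =
    \sum_i lorentz v (E i) * lorentz v (E i) - 2 * da * YE + da ^+ 2 * Y2.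
  rewrite /YE /Y2 !mulr_sumr -sumrB -big_split /=.
  by apply: eq_bigr => i _; rewrite -/(y i); ring.
rewrite frame -/da -/db.
set S := \sum_i _ * _.
have dbE : db = - (da * be) / u - YE.
  by apply: (mulIf un0); rewrite mulrBl divfK //; lra.
have beE : be = (1 - u ^+ 2 * Y2) / (2 * u).
  have D0 : 2 * u != 0 by rewrite mulf_neq0.
  by apply: (mulIf D0); rewrite divfK //; lra.
rewrite dbE beE; field; exact: un0.
Qed.


Lemma Ck_half_space_proj (V : normedModType R) k (U : set V) (f : V -> 'rV[R]_n.+2) :
  open U -> (forall x, U x -> 0 < lorentz (f x) a) -> Ck k U f ->
  Ck k U (fun x => half_space_proj (f x)).
Proof.
move=> oU u0 cf; apply/(Ck_rV _ _ oU) => j.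
apply: (@Ck_ext _ _ _ _ U (fun x => lorentz (f x) (E j) * (lorentz (f x) a)^-1)) => //.
  by move=> x _; rewrite mxE.
apply: CkM => //; first by apply: Ck_lorentz => //; exact: Ck_cst.
apply: CkV => // [x /u0/gt_eqF->//|].
by apply: Ck_lorentz => //; exact: Ck_cst.
Qed.

Lemma derive_half_space_proj (V : normedModType R) (f : V -> 'rV[R]_n.+2) x v i :
  differentiable f x -> 0 < lorentz (f x) a ->
  differentiable (fun x => half_space_proj (f x)) x /\
  ('D_v (fun x => half_space_proj (f x)) x) 0 i =
  (lorentz ('D_v f x) (E i) - half_space_proj (f x) 0 i * lorentz ('D_v f x) a) /
    lorentz (f x) a.
Proof.
move=> df u0; have un0 : lorentz (f x) a != 0 by rewrite gt_eqF.
have dcst (z : 'rV[R]_n.+2) := @differentiable_cst R _ _ z x.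
have lin z : differentiable (fun x => lorentz (f x) z : R) x /\
    'D_v (fun x => lorentz (f x) z : R) x = lorentz ('D_v f x) z.
  have [dl Dl] := derive_lorentz v df (dcst z); split; first exact: dl.
  by rewrite Dl derive_cst (lorentzC (f x)) lorentz0l addr0.
have [da Da] := lin a.
have dV : differentiable (fun x => (lorentz (f x) a)^-1 : R) x by exact: differentiableV.
have dq j : differentiable (fun x => half_space_proj (f x) 0 j : R) x.
  have -> : (fun x => half_space_proj (f x) 0 j) =
      (fun x => lorentz (f x) (E j)) * (fun x => (lorentz (f x) a)^-1).
    by apply/funext => y; rewrite mxE.
  by apply: differentiableM => //; case: (lin (E j)).
have dp : differentiable (fun x => half_space_proj (f x)) x by exact: differentiable_rV.
split=> //; rewrite -derive_coord //.
have -> : (fun x => half_space_proj (f x) 0 i : R) =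
    (fun x => lorentz (f x) (E i)) * (fun x => (lorentz (f x) a)^-1).
  by apply/funext => y; rewrite mxE.
have [dE DE] := lin (E i).
rewrite deriveM; [|exact: diff_derivable|exact: diff_derivable].
rewrite DE deriveV //; last exact: diff_derivable.
rewrite Da mxE /GRing.scale /=.
by field.
Qed.

(** The remaining component <x, b> is determined by <x, x> = 1. *)
Lemma half_space_inj x x' : lorentz x x = 1 -> lorentz x' x' = 1 ->
  0 < lorentz x a -> lorentz x a = lorentz x' a ->
  half_space_proj x = half_space_proj x' -> x = x'.
Proof.
move=> xx xx' u0 uu' yy'.
have un0 : lorentz x a != 0 by rewrite gt_eqF.
have EE i : lorentz x (E i) = lorentz x' (E i).
  have /rowP/(_ i) := yy'; rewrite !mxE -uu'.
  by move/(congr1 (fun t => t * lorentz x a)); rewrite !divfK.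
have bb : lorentz x b = lorentz x' b.
  move: (etrans xx (esym xx')); rewrite !(frame _ x) !(frame _ x') -uu'.
  under eq_bigr do rewrite EE.
  set S := \sum_i _; move=> H.
  by apply: (mulfI un0); lra.
apply/subr0_eq/lorentz_nondegenerate => y.
rewrite lorentzBl (frame x) (frame x') -uu' bb.
under eq_bigr do rewrite EE.
by rewrite subrr.
Qed.

End HalfSpace.

(** * Charts and the half-space coordinates *)

Section RealLemmas.
Context {R : realType}.
Local Notation mu := (@lebesgue_measure R).

Lemma within_continuous_for (A : set R) (f : R -> R) :
  (forall x, A x -> {for x, continuous f}) -> {within A, continuous f}.
Proof.
move=> H; apply/continuous_in_subspaceT => x xA.
by apply: H; rewrite inE in xA.
Qed.

(** The speed s is known to be continuous only at the points of [0, 1], so the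
    comparison is made with its indefinite integral, inside the interval. *)
Lemma increment_le (f df s : R -> R) :
  (forall t : R, 0 <= t <= 1 -> is_derive t (1 : R) f (df t)) ->
  (forall t : R, 0 <= t <= 1 -> df t <= s t) ->
  (forall t : R, 0 <= t <= 1 -> {for t, continuous s}) ->
  f 1 - f 0 <= Rintegral mu `[0, 1] s.
Proof.
move=> Hf Hs cs.
have cws : {within `[0:R, 1], continuous s}.
  by apply: within_continuous_for => t; rewrite /= in_itv; exact: cs.
have is_ : mu.-integrable `[0:R, 1] (EFin \o s).
  apply: continuous_compact_integrable => //; exact: segment_compact.
pose S (x : R) := Rintegral mu [set` Interval (BLeft (0 : R)) (BRight x)] s.
have dS (x : R) : 0 < x < 1 -> derivable S x 1 /\ derive1 S x = s x.
  move=> /andP[x0 x1]; apply: (continuous_FTC1_closed x1 is_ x0).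
  by apply: cs; rewrite !ltW.
have cS : {within `[0:R, 1], continuous S}.
  by apply: parameterized_integral_continuous; [exact: ler01|exact: is_].
have cf : {within `[0:R, 1], continuous f}.
  apply: within_continuous_for => t; rewrite /= in_itv => /Hf [D _].
  by apply/differentiable_continuous/derivable1_diffP.
pose g := S - f.
have g01 : g 0 <= g 1.
  apply: (@ger0_derive1_le_cc R g 0 1) => //.
  - move=> x /[!in_itv] x01; have /andP[x0 x1] := x01; apply: derivableB.
      by case: (dS x x01).
    by case: (Hf x _) => //; rewrite !ltW.
  - move=> x /[!in_itv] x01; have /andP[x0 x1] := x01.
    have x01' : 0 <= x <= 1 by rewrite !ltW.
    have [d1 e1] := dS x x01; have [d2 e2] := Hf x x01'.
    rewrite derive1E (deriveB d1 d2) -derive1E e1 e2 subr_ge0; exact: Hs.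
  - by move=> x; apply: continuousB; [exact: cS|exact: cf].
  - by rewrite in_itv /= lexx ler01.
  - by rewrite in_itv /= lexx ler01.
move: g01; rewrite /g !fctE.
have -> : S 0 = 0 by rewrite /S set_itv1 Rintegral_set1.
by rewrite sub0r lerBrDl.
Qed.

End RealLemmas.

Section Charts.
Context {R : realType} {n : nat}.
Variables (a b : 'rV[R]_n.+2) (E : 'I_n -> 'rV[R]_n.+2).
Hypothesis frame : forall x y, lorentz x y =
  lorentz x a * lorentz y b + lorentz x b * lorentz y a +
  \sum_i lorentz x (E i) * lorentz y (E i).

Lemma de_sitter_tangent (V : normedModType R) (f : V -> 'rV[R]_n.+2) x v :
  differentiable f x -> (\near x, lorentz (f x) (f x) = 1) ->
  lorentz ('D_v f x) (f x) = 0.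
Proof.
move=> df f1; have [_ D] := derive_lorentz v df df.
have : 'D_v (fun x => lorentz (f x) (f x) : R) x = 0.
  rewrite (@near_eq_derive _ _ _ _ (cst (1 : R))) ?derive_cst //.
by rewrite D [lorentz (f x) _]lorentzC; lra.
Qed.

Lemma de_sitter_speed (V : normedModType R) (f : V -> 'rV[R]_n.+2) x v :
  differentiable f x -> (\near x, lorentz (f x) (f x) = 1) ->
  0 < lorentz (f x) a ->
  lorentz ('D_v f x) ('D_v f x) =
    lorentz (f x) a ^+ 2 *
      \sum_i ('D_v (fun x => half_space_proj a E (f x)) x) 0 i ^+ 2 -
    (lorentz ('D_v f x) a / lorentz (f x) a) ^+ 2.
Proof.
move=> df f1 u0; have un0 : lorentz (f x) a != 0 by rewrite gt_eqF.
have f1x : lorentz (f x) (f x) = 1 by exact: nbhs_singleton f1.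
rewrite (de_sitter_metric frame f1x (de_sitter_tangent v df f1) u0); congr (_ - _).
rewrite mulr_sumr; apply: eq_bigr => i _.
have [_ ->] := derive_half_space_proj E v i df u0.
by rewrite expr_div_n [RHS]mulrC divfK // expf_neq0.
Qed.

Context {M : smoothManifold R n}.
Variable psi : M -> 'rV[R]_n.+2.
Hypothesis hpsi : spacelike_hypersurface a psi.
Let pr p := half_space_proj a E (psi p).
Implicit Types (c : chart R n M) (p : M).

Let psi1 p : lorentz (psi p) (psi p) = 1. Proof. by case: (hyp_steady hpsi p). Qed.
Let psi_pos p : 0 < lorentz (psi p) a. Proof. by case: (hyp_steady hpsi p). Qed.

Lemma psi_chart_diff c x : atlas c -> cod c x -> differentiable (psi \o of_coord c) x.
Proof. by move=> ac cx; have [H _] := hyp_smooth hpsi ac 1; exact: H. Qed.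

Lemma psi_chart_spacelike c x v : atlas c -> cod c x -> v != 0 ->
  0 < lorentz ('D_v (psi \o of_coord c) x) ('D_v (psi \o of_coord c) x).
Proof.
move=> ac cx v0; have := hyp_spacelike hpsi ac (of_coord_dom cx) v0.
by rewrite /induced_metric /differential of_coordK // deriveE //; exact: psi_chart_diff.
Qed.

Lemma proj_chart_smooth c : atlas c -> smooth_on (cod c) (pr \o of_coord c).
Proof.
move=> ac k.
exact: (@Ck_half_space_proj R n a E _ k (cod c) (psi \o of_coord c) (@open_cod _ _ _ c)
  (fun x _ => psi_pos (of_coord c x)) (hyp_smooth hpsi ac k)).
Qed.

(** By the form of the metric, a tangent vector that does not move the half-space
    coordinates y is not spacelike. *)
Lemma proj_chart_inj c x : atlas c -> cod c x -> injective ('d (pr \o of_coord c) x).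
Proof.
move=> ac cx v1 v2 Ev; have df := psi_chart_diff ac cx.
have [dp _] : differentiable (pr \o of_coord c) x /\ True.
  by split=> //; have [H _] := proj_chart_smooth ac 1; exact: H.
apply/eqP; rewrite -subr_eq0; apply: contraT => v0.
have := psi_chart_spacelike ac cx v0.
have near1 : \near x, lorentz ((psi \o of_coord c) x) ((psi \o of_coord c) x) = 1.
  by near=> y; exact: psi1.
rewrite (de_sitter_speed _ df near1); last exact: psi_pos.
have -> : (fun x => half_space_proj a E ((psi \o of_coord c) x)) = pr \o of_coord c by [].
rewrite (deriveE _ dp) linearB /= Ev subrr big1 => [|i _]; last by rewrite mxE expr0n.
by rewrite mulr0 sub0r oppr_gt0 ltNge sqr_ge0.
Unshelve. all: by end_near. Qed.

(** The half-space projection is a local diffeomorphism; this gives local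
    sections of it, smooth in any prescribed chart. *)
Lemma local_section c p : atlas c -> dom c p ->
  exists (G : 'rV[R]_n -> 'rV[R]_n) (O : set M) (d : R),
  [/\ 0 < d, open O /\ O p, O `<=` dom c,
      forall q q', O q -> O q' -> pr q = pr q' -> q = q' &
      (forall w, ball (pr p) d w ->
         [/\ cod c (G w), O (of_coord c (G w)) & pr (of_coord c (G w)) = w]) /\
      smooth_on (ball (pr p) d) G].
Proof.
move=> ac cp.
have cx := to_coord_cod cp.
have [G [U' [d [d0 [oU' U'x] sU' inj [HG sG]]]]] :=
  inverse_function (@open_cod _ _ _ c) cx (proj_chart_smooth ac) (fun x Hx => @proj_chart_inj c x ac Hx).
rewrite /= to_coordK // in HG sG.
exists G, (dom c `&` to_coord c @^-1` U'), d; split=> //.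
- split=> //; rewrite openE => q [cq Uq]; apply: filterI.
    by apply: open_nbhs_nbhs; split=> //; exact: open_dom.
  by apply: (to_coord_cont cq); exact: open_nbhs_nbhs.
- move=> q q' [cq Uq] [cq' Uq'] Eq.
  have := inj _ _ Uq Uq'; rewrite /= !to_coordK // => /(_ Eq).
  by move/(congr1 (of_coord c)); rewrite !to_coordK.
- split=> // w /HG [Uw Fw]; have cw := sU' _ Uw.
  split=> //; split; first exact: of_coord_dom.
  by rewrite /= of_coordK.
Qed.

End Charts.

(** * The Riemannian distance *)

Section PosSquare.
Context {R : realType}.

(** A quadratic error term makes it possible to differentiate functions given by
    cases without examining one-sided limits. *)
Lemma is_derive_quadratic (f : R -> R) (t l C : R) :
  (forall h : R, `|f (t + h) - f t - l * h| <= C * h ^+ 2) ->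
  is_derive t (1 : R) f l.
Proof.
move=> H.
have L : h^-1 *: (f (h *: (1 : R) + t) - f t) @[h --> (0 : R)^'] --> l.
  apply/cvgrPdist_le => e e0.
  have C0 : 0 < `|C| + 1 by rewrite ltr_wpDl.
  near=> h.
  have h0 : h != 0 by near: h; exact: nbhs_dnbhs_neq.
  have he : `|h| < e / (`|C| + 1) by near: h; apply: dnbhs0_lt; rewrite divr_gt0.
  rewrite /GRing.scale /= mulr1 [h + t]addrC.
  have -> : l - h^-1 * (f (t + h) - f t) = - (h^-1 * (f (t + h) - f t - l * h)).
    by field.
  rewrite normrN normrM normfV ler_pdivrMl ?normr_gt0 // (le_trans (H h)) //.
  have -> : h ^+ 2 = `|h| * `|h| by rewrite -expr2 real_normK ?num_real.
  rewrite mulrCA ler_wpM2l //.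
  rewrite (@le_trans _ _ ((`|C| + 1) * `|h|)) //.
    by rewrite ler_wpM2r // (le_trans (ler_norm _)) // lerDl.
  by rewrite mulrC -ler_pdivlMr // ltW.
by apply: DeriveDef; [apply/cvg_ex; exists l|exact: cvg_lim].
Unshelve. all: by end_near. Qed.

(** The square of the positive part is C^1, which is all that the cutoffs below
    require. *)
Definition pos_sq (t : R) : R := Num.max t 0 ^+ 2.

Lemma is_derive_pos_sq (t : R) : is_derive t (1 : R) pos_sq (2 * Num.max t 0).
Proof.
apply: (@is_derive_quadratic _ _ _ 1) => h; rewrite /pos_sq mul1r.
case: (lerP t 0) => t0; case: (lerP (t + h) 0) => th; rewrite ler_norml; nra.
Qed.

End PosSquare.

Section Distance.
Context {R : realType} {n : nat}.
Variables (a b : 'rV[R]_n.+2) (E : 'I_n -> 'rV[R]_n.+2).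
Hypothesis frame : forall x y, lorentz x y =
  lorentz x a * lorentz y b + lorentz x b * lorentz y a +
  \sum_i lorentz x (E i) * lorentz y (E i).
Context {M : smoothManifold R n}.
Variable psi : M -> 'rV[R]_n.+2.
Hypothesis hpsi : spacelike_hypersurface a psi.
Implicit Types (c : chart R n M) (p : M) (gamma : R -> M).
Local Notation mu := (@lebesgue_measure R).

Definition speed gamma (t : R) : R :=
  let u := derive1 (psi \o gamma) t in Num.sqrt (lorentz u u).

Lemma arc_psi_smooth gamma (t : R) : smooth_arc gamma -> 0 <= t <= 1 ->
  exists U : set R^o, [/\ open U, U t & smooth_on U (psi \o gamma : R^o -> 'rV[R]_n.+2)].
Proof.
move=> sg t01; have [c ac cg] := atlas_cover (gamma t).
have [U [oU Ut sU sX]] := sg t t01 c ac cg.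
exists U; split=> // k.
have H := @Ck_comp_rV R R^o n n.+2 k U (cod c) (to_coord c \o gamma)
  (psi \o of_coord c) oU (@open_cod _ _ _ c)
  (fun s Us => to_coord_cod (sU s Us)) (sX k) (hyp_smooth hpsi ac k).
apply: (Ck_ext oU _ H) => s /sU cs.
by rewrite /= to_coordK.
Qed.

Lemma arc_speed_continuous gamma (t : R) : smooth_arc gamma -> 0 <= t <= 1 ->
  {for t, continuous (speed gamma)}.
Proof.
move=> sg t01; have [U [oU Ut sU]] := arc_psi_smooth sg t01.
have c1 : Ck 0 U (fun s : R^o => 'D_(1 : R^o) (psi \o gamma : R^o -> 'rV[R]_n.+2) s).
  by have [_ H] := sU 1; exact: H.
have cl := Ck_lorentz oU c1 c1.
have -> : speed gamma = Num.sqrt \o (fun s => lorentz ('D_1 (psi \o gamma : R^o -> _) s) ('D_1 (psi \o gamma : R^o -> _) s)).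
  by apply/funext => s; rewrite /speed /= derive1E.
by apply: continuous_comp; [exact: (cl t Ut)|exact: sqrt_continuous].
Qed.

Lemma arc_chart gamma (t : R) c : smooth_arc gamma -> 0 <= t <= 1 -> atlas c ->
  dom c (gamma t) ->
  let X : R^o -> 'rV[R]_n := to_coord c \o gamma in
  [/\ (\forall s \near t, dom c (gamma s)), differentiable X t &
      derive1 (psi \o gamma) t = 'D_('D_1 X t) (psi \o of_coord c) (X t)].
Proof.
move=> sg t01 ac cg X; have [U [oU Ut sU sX]] := sg t t01 c ac cg.
have nU : nbhs (t : R^o) U by exact: open_nbhs_nbhs.
have dX : differentiable X t by have [H _] := sX 1; exact: H.
have dP := psi_chart_diff hpsi ac (to_coord_cod cg).
split; [exact: filterS sU nU|exact: dX|].
rewrite derive1E.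
have -> : 'D_1 (psi \o gamma) t = 'D_1 ((psi \o of_coord c) \o X : R^o -> _) t.
  apply: (@near_eq_derive R R^o 'rV[R]_n.+2); apply: filterS nU => s /sU cs.
  by rewrite /= /X /= to_coordK.
have dc := differentiable_comp dX dP.
by rewrite (deriveE _ dc) (diff_comp dX dP) /= -(deriveE _ dX) -deriveE.
Qed.

(** Near a point the induced metric dominates the Euclidean one: it does so at
    the point, by compactness of the unit sphere, and its coefficients are
    continuous. *)
Lemma metric_lower_bound c x0 : atlas c -> cod c x0 ->
  exists m r : R, [/\ 0 < m, 0 < r & forall x, `|x - x0| <= r -> cod c x /\
    forall v, m * `|v| ^+ 2 <=
      lorentz ('D_v (psi \o of_coord c) x) ('D_v (psi \o of_coord c) x)].
Proof.
move=> ac cx0; pose f := psi \o of_coord c.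
have df x : cod c x -> differentiable f x.
  by move=> cx; exact: (psi_chart_diff hpsi ac cx).
pose g (i j : 'I_n) x : R := lorentz ('D_(delta_mx 0 i) f x) ('D_(delta_mx 0 j) f x).
have gE x v : cod c x ->
    lorentz ('D_v f x) ('D_v f x) = \sum_i \sum_j v 0 i * v 0 j * g i j x.
  move=> cx; have DE : 'D_v f x = \sum_i v 0 i *: 'D_(delta_mx 0 i) f x.
    rewrite (deriveE v (df x cx)) {1}(rV_sum_delta v) linear_sum; apply: eq_bigr => i _.
    by rewrite linearZ (deriveE _ (df x cx)).
  rewrite DE lorentz_suml; apply: eq_bigr => i _.
  rewrite lorentzZl lorentzC lorentz_suml mulr_sumr; apply: eq_bigr => j _.
  by rewrite lorentzZl mulrA lorentzC.
have gc i j : {for x0, continuous (g i j)}.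
  have D i' : Ck 0 (cod c) (fun x => 'D_(delta_mx 0 i') f x).
    by have [_ H] := hyp_smooth hpsi ac 1; exact: H.
  have H := Ck_lorentz (@open_cod _ _ _ c) (D i) (D j).
  exact: (H x0 cx0).
pose Q (v : 'rV[R]_n) : R := \sum_i \sum_j v 0 i * v 0 j * g i j x0.
have cQ : continuous Q.
  suff H : Ck 0 setT (Q : 'rV[R]_n -> R) by move=> v; exact: H.
  have oT := @openT 'rV[R]_n.
  apply: Ck_sum => // i; apply: Ck_sum => // j; apply: CkM => //; last exact: Ck_cst.
  by apply: CkM => //; exact: Ck_coord.
have QZ (k : R) v : Q (k *: v) = k ^+ 2 * Q v.
  rewrite /Q mulr_sumr; apply: eq_bigr => i _; rewrite mulr_sumr; apply: eq_bigr => j _.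
  by rewrite !mxE; ring.
have Qpos v : v != 0 -> 0 < Q v.
  by move=> v0; rewrite /Q -gE //; exact: (psi_chart_spacelike hpsi ac cx0 v0).
have [m m0 Qm] : exists2 m : R, 0 < m & forall v, m * `|v| ^+ 2 <= Q v.
  pose A := [set v : 'rV[R]_n | `|v| = 1].
  have unit v : v != 0 -> A (`|v|^-1 *: v).
    by move=> v0; rewrite /A /= normrZ normfV normr_id mulVf // normr_eq0.
  have Qn v m : v != 0 -> m <= Q (`|v|^-1 *: v) -> m * `|v| ^+ 2 <= Q v.
    move=> v0; rewrite QZ exprVn mulrC ler_pdivlMr //.
    by rewrite exprn_gt0 // normr_gt0.
  have [[v0 Av0]|nA] := pselect (A !=set0); last first.
    exists 1 => // v; have [->|/unit Av] := eqVneq v 0; last by exfalso; apply: nA; exists (`|v|^-1 *: v).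
    by rewrite normr0 expr0n mulr0 /Q big1 // => i _; rewrite big1 // => j _; rewrite !mxE !mul0r.
  have cA : compact A.
    apply: bounded_closed_compact.
      by exists 1; split=> [|x x1 v /= ->]; [exact: num_real|exact: ltW].
    apply: (@preimage_closed _ _ (fun v : 'rV[R]_n => `|v|) [set x | x = 1]); last exact: closed_eq.
    by move=> v _; exact: norm_continuous.
  have [w Aw Hw] := @EVT_min_rV R n Q A (ex_intro _ v0 Av0) cA (continuous_subspaceT cQ).
  rewrite inE in Aw.
  have w0 : w != 0 by rewrite -normr_eq0 Aw oner_eq0.
  exists (Q w); first exact: Qpos.
  move=> v; have [->|v1] := eqVneq v 0.
    by rewrite normr0 expr0n mulr0 /Q big1 // => i _; rewrite big1 // => j _; rewrite !mxE !mul0r.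
  by apply: Qn => //; apply: Hw; rewrite inE; exact: unit.
(* A perturbation by e of each of the n^2 coefficients changes the form by at most
   half of its lower bound. *)
pose e : R := m / 2 / (n%:R * n%:R + 1).
have D0 : 0 < n%:R * n%:R + 1 :> R by rewrite ltr_wpDl // mulr_ge0.
have e0 : 0 < e by rewrite !divr_gt0.
have N1 : nbhs x0 [set x | forall ij : 'I_n * 'I_n, `|g ij.1 ij.2 x0 - g ij.1 ij.2 x| <= e].
  apply: (@filter_forall _ _ (fun (ij : 'I_n * 'I_n) (x : 'rV[R]_n) =>
    `|g ij.1 ij.2 x0 - g ij.1 ij.2 x| <= e : Prop) (nbhs x0) (nbhs_filter x0)) => -[i j].
  by have /cvgrPdist_le/(_ e e0) := gc i j.
have N2 : nbhs x0 (cod c) by apply: open_nbhs_nbhs; split=> //; exact: open_cod.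
have N12 : nbhs x0 (cod c `&` [set x | forall ij : 'I_n * 'I_n, `|g ij.1 ij.2 x0 - g ij.1 ij.2 x| <= e]).
  exact: filterI.
move: N12 => /nbhs_ballP [r /= r0 Hr].
exists (m / 2), (r / 2); split; [by rewrite divr_gt0|by rewrite divr_gt0|move=> x xr].
have xb : ball x0 r x.
  rewrite -ball_normE /= distrC (le_lt_trans xr) //.
  by rewrite ltr_pdivrMr // ltr_pMr // ltr1n.
have [cx Hg] := Hr x xb; split=> // v; rewrite gE //.
have : `|Q v - \sum_i \sum_j v 0 i * v 0 j * g i j x| <= m / 2 * `|v| ^+ 2.
  rewrite /Q -sumrB (le_trans (ler_norm_sum _ _ _)) //.
  rewrite (@le_trans _ _ (\sum_(i < n) \sum_(j < n) `|v| ^+ 2 * e)) //.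
    apply: ler_sum => i _; rewrite -sumrB (le_trans (ler_norm_sum _ _ _)) //.
    apply: ler_sum => j _; rewrite -mulrBr normrM; apply: ler_pM => //.
      by rewrite normrM expr2; apply: ler_pM => //; exact: coord_le_norm.
    exact: (Hg (i, j)).
  rewrite !sumr_const !card_ord -mulrnA -[X in X <= _]mulr_natl natrM.
  have -> : n%:R * n%:R * (`|v| ^+ 2 * e) = m / 2 * `|v| ^+ 2 * ((n%:R * n%:R) / (n%:R * n%:R + 1)).
    by rewrite /e; field; rewrite gt_eqF.
  rewrite ler_piMr //; first by rewrite mulr_ge0 // ?divr_ge0 // ?ltW // exprn_gt0.
  by rewrite ler_pdivrMr // mul1r lerDl.
have := Qm v; rewrite ler_norml => H /andP[H1 H2].
lra.
Qed.

End Distance.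

(** * Graphs over convex regions *)

Section Convex.
Context {R : realType} {n : nat}.

Definition convex_region (A : set 'rV[R]_n) : Prop :=
  forall x y, A x -> A y -> forall t : R, 0 <= t <= 1 -> A (x + t *: (y - x)).

Lemma convex_region_ball (x : 'rV[R]_n) (r : R) : convex_region (ball x r).
Proof.
move=> y z; rewrite -ball_normE /ball_ /= => xy xz t /andP[t0 t1].
have -> : x - (y + t *: (z - y)) = t *: (x - z) + (1 - t) *: (x - y).
  by apply/rowP => k; rewrite !mxE; ring.
rewrite (le_lt_trans (ler_normD _ _)) // !normrZ (ger0_norm t0) ger0_norm ?subr_ge0 //.
have [->|tn0] := eqVneq t 0; first by rewrite mul0r add0r subr0 mul1r.
rewrite (@lt_le_trans _ _ (t * r + (1 - t) * r)) //; last by rewrite -mulrDl addrC subrK mul1r.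
apply: ltr_leD; first by rewrite ltr_pM2l // lt_def tn0.
by apply: ler_wpM2l; [rewrite subr_ge0|exact: ltW].
Qed.

Lemma convex_regionI (A B : set 'rV[R]_n) :
  convex_region A -> convex_region B -> convex_region (A `&` B).
Proof. by move=> cA cB x y [Ax Bx] [Ay By] t t01; split; [exact: cA|exact: cB]. Qed.

Lemma line_Ck k (U : set R^o) (x v : 'rV[R]_n) : open U ->
  Ck k U (fun t : R^o => x + (t : R) *: v).
Proof.
move=> oU; apply: CkD => //; first exact: Ck_cst.
apply/(Ck_rV _ _ oU) => j.
apply: (@Ck_ext _ _ _ _ U (fun t : R^o => (t : R) * v 0 j)) => //.
  by move=> t _; rewrite mxE.
by apply: CkM => //; [exact: Ck_id|exact: Ck_cst].
Qed.

Lemma line_continuous (x v : 'rV[R]_n) : continuous (fun t : R => x + t *: v).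
Proof. by move=> t; have H := @line_Ck 0 setT x v openT; exact: (H t). Qed.

Lemma derive_line (x v : 'rV[R]_n) (t : R^o) :
  'D_(1 : R^o) (fun t : R^o => x + (t : R) *: v) t = v.
Proof.
have d0 : differentiable (id : 'rV[R]_n -> 'rV[R]_n) (x + (t : R) *: v) by exact: ex_diff.
by have [_ ->] := is_derive_line d0; rewrite derive_id.
Qed.

Lemma convex_region_connected (A : set 'rV[R]_n) : convex_region A -> connected A.
Proof.
move=> cA; have [[x0 Ax0]|nA] := pselect (A !=set0); last first.
  have -> : A = set0 by apply/seteqP; split=> // x Ax; apply: nA; exists x.
  exact: connected0.
have -> : A = \bigcup_(y in A) ((fun t : R => x0 + t *: (y - x0)) @` `[0, 1]).
  apply/seteqP; split=> [y Ay|z [y Ay [t /= t01 <-]]].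
    exists y => //; exists 1; first by rewrite /= in_itv /= ler01 lexx.
    by rewrite scale1r addrC subrK.
  by apply: cA => //; move: t01; rewrite in_itv.
apply: bigcup_connected.
  exists x0 => y Ay; exists 0; first by rewrite /= in_itv /= lexx ler01.
  by rewrite scale0r addr0.
move=> y Ay; apply: connected_continuous_connected; first exact: segment_connected.
exact/continuous_subspaceT/line_continuous.
Qed.

End Convex.

Section Sections.
Context {R : realType} {n : nat}.
Variables (a b : 'rV[R]_n.+2) (E : 'I_n -> 'rV[R]_n.+2).
Hypothesis frame : forall x y, lorentz x y =
  lorentz x a * lorentz y b + lorentz x b * lorentz y a +
  \sum_i lorentz x (E i) * lorentz y (E i).
Context {M : smoothManifold R n}.
Variable psi : M -> 'rV[R]_n.+2.
Hypothesis hpsi : spacelike_hypersurface a psi.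
Implicit Types (c : chart R n M) (p : M) (gamma : R -> M) (s : 'rV[R]_n -> M).

Definition coords p : 'rV[R]_n := half_space_proj a E (psi p).

(** Continuous local inverses of the half-space coordinates on M, i.e. pieces of
    the hypersurface written as graphs. *)
Definition graph_section (A : set 'rV[R]_n) s : Prop :=
  forall w, A w -> coords (s w) = w /\ {for w, continuous s}.

Lemma local_graph_section p : exists (s : 'rV[R]_n -> M) (O : set M) (d : R),
  [/\ 0 < d, open O, O p, (forall q q', O q -> O q' -> coords q = coords q' -> q = q') &
    graph_section (ball (coords p) d) s /\ forall w, ball (coords p) d w -> O (s w)].
Proof.
have [c ac cp] := atlas_cover p.
have [G [ O [d [d0 [oO Op] _ inj [HG sG]]]]] := local_section frame hpsi ac cp.
exists (of_coord c \o G), O, d; split=> //; split=> w Hw; have [cw Ow pw] := HG w Hw; last by [].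
split=> //; have [dG _] := sG 1.
apply: (@continuous_comp _ _ _ G (of_coord c)); last exact: of_coord_cont.
exact/differentiable_continuous/dG.
Qed.

Lemma coords_continuous : continuous coords.
Proof.
move=> p; have [c ac cp] := atlas_cover p.
have [D _] := proj_chart_smooth E hpsi ac 1.
have cx := to_coord_cod cp.
have c1 := differentiable_continuous (D _ cx).
have H : {for p, continuous ((coords \o of_coord c) \o to_coord c)}.
  by apply: continuous_comp; [exact: to_coord_cont|exact: c1].
have nc : nbhs p (dom c) by apply: open_nbhs_nbhs; split=> //; exact: open_dom.
rewrite /prop_for /continuous_at; have -> : coords p = ((coords \o of_coord c) \o to_coord c) p.
  by rewrite /= to_coordK.
apply: cvg_trans H; apply: near_eq_cvg; apply: filterS nc => q cq.
by rewrite /= to_coordK.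
Qed.

(** Uniqueness of lifts: the set of agreement is open because the coordinates are
    locally injective, and closed because M is Hausdorff. *)
Lemma graph_section_uniq (A : set 'rV[R]_n) s s' w0 w1 : open A -> convex_region A ->
  graph_section A s -> graph_section A s' -> A w0 -> s w0 = s' w0 -> A w1 -> s w1 = s' w1.
Proof.
move=> oA cA ss ss' Aw0 E0 Aw1.
pose B := [set w | A w /\ s w = s' w].
suff BA : B = A by have [] : B w1 by rewrite BA.
have oB : open B.
  rewrite openE => w [Aw Ew].
  have [_ [ O [d [d0 oO Oq inj _]]]] := local_graph_section (s w).
  have [_ cs] := ss w Aw; have [_ cs'] := ss' w Aw.
  have n1 : nbhs w (s @^-1` O) by apply: cs; exact: open_nbhs_nbhs.
  have n2 : nbhs w (s' @^-1` O) by apply: cs'; apply: open_nbhs_nbhs; rewrite -Ew.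
  have n3 : nbhs w A by exact: open_nbhs_nbhs.
  apply: filterS (filterI n3 (filterI n1 n2)) => z [Az [ Oz Oz']].
  split=> //; apply: inj => //.
  by have [-> _] := ss z Az; have [-> _] := ss' z Az.
apply: (convex_region_connected cA); first by exists w0.
  by exists B => //; apply/seteqP; split=> [w [Aw Ew]|w []].
exists (closure B); first exact: closed_closure.
apply/seteqP; split=> [w Bw|w [Aw cBw]]; first by split; [case: Bw|exact: subset_closure].
split=> //; apply: contrapT => /eqP ne.
have := @manifold_hausdorff _ _ M; rewrite open_hausdorff => /(_ _ _ ne).
move=> [[ O1 O2] /= [ O1w O2w] [oO1 oO2 /eqP O12]].
rewrite !inE in O1w O2w.
have [_ cs] := ss w Aw; have [_ cs'] := ss' w Aw.
have n1 : nbhs w (s @^-1` O1) by apply: cs; exact: open_nbhs_nbhs.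
have n2 : nbhs w (s' @^-1` O2) by apply: cs'; exact: open_nbhs_nbhs.
have [z [[_ Ez] [ O1z O2z]]] := cBw _ (filterI n1 n2).
have : (O1 `&` O2) (s z) by split=> //; rewrite Ez.
by rewrite O12.
Qed.

(** A continuous section agrees locally with the one that the inverse function
    theorem provides, hence is smooth. *)
Lemma graph_section_smooth (A : set 'rV[R]_n) s w c : open A -> graph_section A s ->
  A w -> atlas c -> dom c (s w) ->
  exists U : set 'rV[R]_n, [/\ open U, U w, U `<=` A,
    (forall w', U w' -> dom c (s w')) & smooth_on U (to_coord c \o s)].
Proof.
move=> oA ss Aw ac cw.
have [G [ O [d [d0 [oO Op] sO inj [HG sG]]]]] := local_section frame hpsi ac cw.
have [Ew cs] := ss w Aw.
rewrite -/(coords (s w)) Ew in HG sG.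
have n1 : nbhs w (s @^-1` O) by apply: cs; exact: open_nbhs_nbhs.
have n2 : nbhs w (A `&` s @^-1` O `&` ball w d).
  by apply: filterI; [apply: filterI => //; exact: open_nbhs_nbhs|exact: nbhsx_ballx].
move: n2; rewrite nbhsE => -[U [oU Uw] sU].
exists U; split=> //.
- by move=> z /sU [[]].
- by move=> z /sU [[_ Oz] _]; exact: sO.
move=> k; apply: (@Ck_ext _ _ _ _ U G) => //; last by apply: Ck_sub (sG k) => z /sU [].
move=> z /sU [[Az Oz] /HG [cz OGz Ez]].
have [Esz _] := ss z Az.
have /= -> : s z = of_coord c (G z) by apply: inj => //; rewrite Ez.
by rewrite of_coordK.
Qed.

Lemma graph_section_arc (A : set 'rV[R]_n) s w0 w1 : open A -> convex_region A ->
  graph_section A s -> A w0 -> A w1 ->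
  smooth_arc (fun t : R => s (w0 + t *: (w1 - w0))).
Proof.
move=> oA cA ss Aw0 Aw1 t t01 c ac ct.
pose l (t : R^o) := w0 + (t : R) *: (w1 - w0).
have At := cA _ _ Aw0 Aw1 t t01.
have [U [oU Ut sU dU smU]] := graph_section_smooth oA ss At ac ct.
have oV : open (l @^-1` U).
  by apply: open_comp => // z _; exact: line_continuous.
exists (l @^-1` U); split=> //; first by move=> z /dU.
move=> k; apply: (@Ck_comp_rV R R^o n n k (l @^-1` U) U l (to_coord c \o s)) => //.
exact: line_Ck.
Qed.

End Sections.

Section Lengths.
Context {R : realType} {n : nat}.
Variables (a b : 'rV[R]_n.+2) (E : 'I_n -> 'rV[R]_n.+2).
Hypothesis frame : forall x y, lorentz x y =
  lorentz x a * lorentz y b + lorentz x b * lorentz y a +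
  \sum_i lorentz x (E i) * lorentz y (E i).
Context {M : smoothManifold R n}.
Variable psi : M -> 'rV[R]_n.+2.
Hypothesis hpsi : spacelike_hypersurface a psi.
Implicit Types (c : chart R n M) (p q : M) (gamma : R -> M) (s : 'rV[R]_n -> M).
Local Notation mu := (@lebesgue_measure R).
Local Notation coords := (coords a E psi).
Local Notation graph_section := (graph_section a E psi).

Lemma arc_length_ge0 gamma : 0 <= arc_length psi gamma.
Proof. by apply: Rintegral_ge0 => t _; exact: sqrtr_ge0. Qed.

Lemma joined_ge0 p q l : joined psi p q l -> 0 <= l.
Proof. by elim=> [//|gamma l' _ IH _]; rewrite addr_ge0 // arc_length_ge0. Qed.

Lemma riem_dist_le p q l : joined psi p q l -> riem_dist psi p q <= l.
Proof.
move=> J; apply: ge_inf => //; exists 0 => l' /=; exact: joined_ge0.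
Qed.

Lemma arc_length_le gamma (C : R) : smooth_arc gamma ->
  (forall t : R, 0 <= t <= 1 -> speed psi gamma t <= C) -> arc_length psi gamma <= C.
Proof.
move=> sg H.
have is_ : mu.-integrable `[0:R, 1] (EFin \o speed psi gamma).
  apply: continuous_compact_integrable; first exact: segment_compact.
  by apply: within_continuous_for => t; rewrite /= in_itv; exact: (arc_speed_continuous hpsi sg).
have ic : mu.-integrable `[0:R, 1] (EFin \o cst C).
  apply: continuous_compact_integrable; first exact: segment_compact.
  by apply: continuous_subspaceT; exact: cst_continuous.
have -> : C = Rintegral mu `[0, 1] (cst C).
  have mI : mu [set` `[0 : R, 1]] = 1%:E.
    by rewrite lebesgue_measure_itv /= lte_fin ltr01 oppr0 adde0.
  rewrite Rintegral_cst; last exact: measurable_itv.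
  have -> : fine (mu `[0 : R, 1]) = 1 by rewrite [X in fine X]mI.
  by rewrite mulr1.
apply: (le_Rintegral _ is_ ic) => // t; rewrite /= in_itv; exact: H.
Qed.

(** The induced metric is u^2 |dy|^2 - du^2 / u^2 <= tau^2 |dy|^2; the factor n
    compares the Euclidean norm with the sup norm. *)
Lemma graph_section_dist (A : set 'rV[R]_n) s w0 w1 (tau : R) : open A -> convex_region A ->
  graph_section A s -> A w0 -> A w1 -> 0 <= tau -> (forall p, lorentz (psi p) a <= tau) ->
  riem_dist psi (s w0) (s w1) <= tau * (n%:R * `|w1 - w0|).
Proof.
move=> oA cA ss Aw0 Aw1 tau0 htau.
pose gamma (t : R) := s (w0 + t *: (w1 - w0)).
have sg : smooth_arc gamma := graph_section_arc frame hpsi oA cA ss Aw0 Aw1.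
have J : joined psi (s w0) (s w1) (0 + arc_length psi gamma).
  have -> : s w1 = gamma 1 by rewrite /gamma scale1r addrC subrK.
  apply: joined_arc => //.
  have -> : gamma 0 = s w0 by rewrite /gamma scale0r addr0.
  exact: joined_refl.
apply: le_trans (riem_dist_le J) _; rewrite add0r.
apply: arc_length_le => // t t01.
have [U [oU Ut sU]] := arc_psi_smooth hpsi sg t01.
have df : differentiable (psi \o gamma : R^o -> 'rV[R]_n.+2) t by have [H _] := sU 1; exact: H.
have n1 : \forall x \near (t : R^o), lorentz ((psi \o gamma) x) ((psi \o gamma) x) = 1.
  by near=> x; case: (hyp_steady hpsi (gamma x)).
have u0 : 0 < lorentz ((psi \o gamma) t) a by case: (hyp_steady hpsi (gamma t)).
rewrite /speed derive1E (de_sitter_speed frame _ df n1 u0).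
pose l (t : R^o) := w0 + (t : R) *: (w1 - w0).
have nl : \forall x \near (t : R^o), half_space_proj a E ((psi \o gamma) x) = l x.
  have nA : nbhs (t : R^o) (l @^-1` A).
    apply: line_continuous; apply: open_nbhs_nbhs; split=> //.
    by apply: cA.
  by apply: filterS nA => x Ax; case: (ss _ Ax).
rewrite (near_eq_derive _ nl) derive_line.
set v := w1 - w0; set u := lorentz _ a in u0 *; set D := _ / u.
have nn : (n%:R : R) <= n%:R ^+ 2.
  rewrite -natrX ler_nat expnS expn1.
  by case: (posnP n) => [->|n0] //; exact: leq_pmulr.
have S : \sum_i v 0 i ^+ 2 <= (n%:R * `|v|) ^+ 2.
  rewrite exprMn (@le_trans _ _ (n%:R * `|v| ^+ 2)) //; last by rewrite ler_wpM2r // sqr_ge0.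
  have -> : n%:R * `|v| ^+ 2 = \sum_(i < n) `|v| ^+ 2 by rewrite sumr_const card_ord mulr_natl.
  apply: ler_sum => i _; rewrite -(real_normK (num_real (v 0 i))).
  by apply: lerXn2r; rewrite ?nnegrE // coord_le_norm.
have K0 : 0 <= tau * (n%:R * `|v|) by rewrite !mulr_ge0.
rewrite -(ger0_norm K0) -sqrtr_sqr; apply: ler_wsqrtr.
rewrite (@le_trans _ _ (u ^+ 2 * \sum_i v 0 i ^+ 2)) //.
  by rewrite gerBl sqr_ge0.
rewrite exprMn.
apply: ler_pM; [exact: sqr_ge0|by apply: sumr_ge0 => i _; exact: sqr_ge0| |exact: S].
by apply: lerXn2r; rewrite ?nnegrE //; [exact: ltW|exact: htau].
Unshelve. all: by end_near. Qed.


Lemma joined_section (A : set 'rV[R]_n) s w0 w1 p l : open A -> convex_region A ->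
  graph_section A s -> A w0 -> A w1 -> joined psi p (s w0) l ->
  exists l', joined psi p (s w1) l'.
Proof.
move=> oA cA ss Aw0 Aw1 J.
pose gamma (t : R) := s (w0 + t *: (w1 - w0)).
have sg : smooth_arc gamma := graph_section_arc frame hpsi oA cA ss Aw0 Aw1.
exists (l + arc_length psi gamma).
have -> : s w1 = gamma 1 by rewrite /gamma scale1r addrC subrK.
apply: joined_arc => //.
by have -> : gamma 0 = s w0 by rewrite /gamma scale0r addr0.
Qed.

(** What makes the set of points joined to p both open and closed. *)
Lemma joined_local p q : exists2 O : set M, open_nbhs q O &
  forall q', O q' -> (exists l, joined psi p q l) <-> (exists l, joined psi p q' l).
Proof.
have [s [ O [d [d0 oO Oq inj [ss Os]]]]] := local_graph_section frame hpsi q.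
pose B := ball (coords q) d.
have oB : open B by exact: ball_open.
exists (O `&` coords @^-1` B).
  split; last by split=> //; exact: ballxx.
  apply: openI => //; apply: open_comp => // z _; exact: (coords_continuous hpsi).
have sE q' : (O `&` coords @^-1` B) q' -> s (coords q') = q'.
  move=> [Oq' Bq']; apply: inj => //; first exact: Os.
  by case: (ss _ Bq').
have Oq0 : (O `&` coords @^-1` B) q by split=> //; exact: ballxx.
move=> q' Oq'; have Bq : B (coords q) by exact: ballxx.
have Bq' : B (coords q') by case: Oq'.
have cB := @convex_region_ball R n (coords q) d.
split=> -[l J].
  by rewrite -(sE q' Oq'); apply: (joined_section (l := l) oB cB ss Bq Bq'); rewrite sE.
by rewrite -(sE q Oq0); apply: (joined_section (l := l) oB cB ss Bq' Bq); rewrite sE.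
Qed.

Lemma joined_any p q : exists l, joined psi p q l.
Proof.
pose B := [set q | exists l, joined psi p q l].
suff BT : B = setT by have : B q by rewrite BT.
apply: (hyp_connected hpsi); first by exists p, 0; exact: joined_refl.
  exists B; last by rewrite setTI.
  rewrite openE => z Bz; have [ O oO HO] := joined_local p z.
  apply: filterS (open_nbhs_nbhs oO) => z' /HO [H _]; exact: H.
exists B; last by rewrite setTI.
move=> z cB; have [ O oO HO] := joined_local p z.
have [z' [Bz' Oz']] := cB _ (open_nbhs_nbhs oO).
by apply/(HO z' Oz').
Qed.

(** The bump is (1 - |x - x0|^2 / r^2)_+^2 in a chart, extended by zero. Its
    support is compact, hence closed in M, so the extension is C^1; and it is
    Lipschitz for the arc length by metric_lower_bound. *)
Lemma bump_function p (O : set M) : nbhs p O -> exists (C : R) (h : M -> R),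
  [/\ 0 < C, h p = 1, (forall q, ~ O q -> h q = 0) &
    forall gamma, smooth_arc gamma -> `|h (gamma 1) - h (gamma 0)| <= C * arc_length psi gamma].
Proof.
move=> nO; have [c ac cp] := atlas_cover p.
pose x0 := to_coord c p.
have cx0 : cod c x0 by exact: to_coord_cod.
have [m [r1 [m0 r10 H1]]] := metric_lower_bound hpsi ac cx0.
have nO' : nbhs x0 (of_coord c @^-1` O).
  by apply: (of_coord_cont cx0); rewrite /x0 to_coordK.
move: nO' => /nbhs_ballP [r2 /= r20 H2].
pose r := Num.min r1 (r2 / 2).
have r0 : 0 < r by rewrite lt_min r10 divr_gt0.
have rr1 : r <= r1 by rewrite ge_min lexx.
have rr2 : r < r2.
  by rewrite (@le_lt_trans _ _ (r2 / 2)) ?ge_min ?lexx ?orbT // ltr_pdivrMr // ltr_pMr // ltr1n.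
pose rho (x : 'rV[R]_n) : R := 1 - r^-2 * \sum_i (x 0 i - x0 0 i) ^+ 2.
have rho_in x : 0 < rho x -> `|x - x0| <= r.
  move=> rx; apply: mx_norm_le => [|i j]; first exact: ltW.
  rewrite ord1 !mxE -(@ler_pXn2r _ 2) ?nnegrE //; last exact: ltW.
  rewrite real_normK ?num_real //.
  rewrite (@le_trans _ _ (\sum_i (x 0 i - x0 0 i) ^+ 2)) //.
    by rewrite (bigD1 j) //= lerDl sumr_ge0 // => k _; exact: sqr_ge0.
  by move: rx; rewrite /rho subr_gt0 mulrC ltr_pdivrMr ?exprn_gt0 // mul1r => /ltW.
pose h q : R := if pselect (dom c q) then pos_sq (rho (to_coord c q)) else 0.
pose K := of_coord c @` [set x | `|x - x0| <= r].
have hK q : ~ K q -> h q = 0.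
  move=> nK; rewrite /h; case: pselect => // cq.
  have [rx|rx] := ltP 0 (rho (to_coord c q)).
    by exfalso; apply: nK; exists (to_coord c q); [exact: rho_in|rewrite to_coordK].
  by rewrite /pos_sq max_r // expr0n.
have KO q : K q -> O q.
  move=> [x xr <-]; apply: H2; rewrite -ball_normE /= distrC.
  exact: le_lt_trans xr rr2.
have cK : closed K.
  apply: compact_closed; first exact: manifold_hausdorff.
  apply: continuous_compact.
    apply/continuous_in_subspaceT => x; rewrite inE /= => xr.
    by apply: of_coord_cont; case: (H1 x (le_trans xr rr1)).
  apply: bounded_closed_compact.
    exists (`|x0| + r); split=> [|t xt v /= vr]; first exact: num_real.
    rewrite (le_trans _ (ltW xt)) // -[v](subrK x0) (le_trans (ler_normD _ _)) //.
    by rewrite addrC lerD2l.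
  apply: (@preimage_closed _ _ (fun v : 'rV[R]_n => `|v - x0|) [set x | x <= r]); last exact: closed_le.
  move=> v _; apply: continuous_comp; last exact: norm_continuous.
  by apply: continuousB; [exact: cvg_id|exact: cst_continuous].
pose C : R := 4 * n%:R / r / Num.sqrt m + 1.
have sm0 : 0 < Num.sqrt m by rewrite sqrtr_gt0.
have C0 : 0 < C by rewrite ltr_wpDl // !divr_ge0 ?mulr_ge0 // ?ltW.
exists C, h; split=> //.
- rewrite /h; case: pselect => //= _; rewrite /rho big1 => [|i _].
    by rewrite mulr0 subr0 /pos_sq max_l // expr1n.
  by rewrite subrr expr0n.
- by move=> q nOq; apply: hK => Kq; apply: nOq; exact: KO.
move=> gamma sg.
have r20' : 0 <= r^-2 by rewrite invr_ge0 exprn_ge0 // ltW.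
have key (t : R) : 0 <= t <= 1 -> exists D : R,
    is_derive t (1 : R) (h \o gamma) D /\ `|D| <= C * speed psi gamma t.
  move=> t01; have sp0 : 0 <= speed psi gamma t by exact: sqrtr_ge0.
  have [cg|ncg] := pselect (dom c (gamma t)); last first.
    exists 0; split; last by rewrite normr0; apply: mulr_ge0 => //; exact: ltW.
    have nK : ~ K (gamma t).
      by move=> [x xr xE]; apply: ncg; rewrite -xE; apply: of_coord_dom; case: (H1 x (le_trans xr rr1)).
    have [c' ac' cg'] := atlas_cover (gamma t).
    have [nc' dX _] := arc_chart hpsi sg t01 ac' cg'.
    have cgam : {for t, continuous gamma}.
      have H : {for t, continuous (of_coord c' \o (to_coord c' \o gamma))}.
        apply: continuous_comp; first exact: (differentiable_continuous dX).
        by apply: of_coord_cont; exact: to_coord_cod.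
      rewrite /prop_for /continuous_at.
      have -> : gamma t = (of_coord c' \o (to_coord c' \o gamma)) t by rewrite /= to_coordK.
      apply: cvg_trans H; apply: near_eq_cvg; apply: filterS nc' => z cz.
      by rewrite /= to_coordK.
    have nKt : \forall z \near t, 0 = (h \o gamma) z.
      have n1 : nbhs (gamma t) (~` K) by apply: open_nbhs_nbhs; split=> //; exact: closed_openC.
      have n2 : nbhs t (gamma @^-1` (~` K)) := cgam _ n1.
      by apply: filterS n2 => z nKz; rewrite /= hK.
    exact: (near_eq_is_derive nKt (is_derive_cst (0 : R) t 1)).
  have [nc dX DX] := arc_chart hpsi sg t01 ac cg.
  set X := to_coord c \o gamma in dX DX.
  set X' := 'D_1 X t in DX.
  have dXi i : is_derive t (1 : R) (fun z : R => X z 0 i : R) (X' 0 i).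
    have d1 := differentiable_coord_comp i dX.
    by apply: DeriveDef; [exact: diff_derivable|exact: derive_coord].
  pose w (z : R) : R := rho (X z).
  pose S : R := \sum_i (X t 0 i - x0 0 i) * X' 0 i.
  have dw : is_derive t (1 : R) w (- (2 * r^-2 * S)).
    have dS : is_derive t (1 : R) (\sum_i ((fun z : R => X z 0 i : R) - cst (x0 0 i)) ^+ 2)
        (\sum_i 2 * (X t 0 i - x0 0 i) * X' 0 i).
      apply: is_derive_sum => i.
      have H := is_deriveX 2 (is_deriveB (dXi i) (is_derive_cst (x0 0 i) t (1 : R))).
      apply: is_derive_eq H _.
      by rewrite /= subr0 expr1 /GRing.scale /= !fctE.
    have dd := is_deriveB (is_derive_cst (1 : R) t (1 : R)) (is_deriveZ (r^-2) dS).
    have -> : w = cst 1 - r^-2 \*: (\sum_i ((fun z : R => X z 0 i : R) - cst (x0 0 i)) ^+ 2).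
      by apply/funext => z; rewrite /w /rho !fctE fct_sumE; congr (_ - _ * _).
    apply: is_derive_eq dd _; rewrite sub0r; congr (- _).
    by rewrite /GRing.scale /= /S !mulr_sumr; apply: eq_bigr => i _; ring.
  have dh := is_derive1_comp (is_derive_pos_sq (w t)) dw.
  exists (2 * Num.max (w t) 0 * (- (2 * r^-2 * S))); split.
    apply: near_eq_is_derive dh; apply: filterS nc => z cz.
    by rewrite /= /h; case: pselect.
  have [wt|wt] := leP (w t) 0; first by rewrite mulr0 mul0r normr0; apply: mulr_ge0 => //; exact: ltW.
  have Xr := rho_in _ wt.
  have [_ Hm] := H1 _ (le_trans Xr rr1).
  have X's : Num.sqrt m * `|X'| <= speed psi gamma t.
    have -> : speed psi gamma t = Num.sqrt (lorentz ('D_X' (psi \o of_coord c) (X t)) ('D_X' (psi \o of_coord c) (X t))).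
      by rewrite /speed DX.
    have -> : Num.sqrt m * `|X'| = Num.sqrt (m * `|X'| ^+ 2).
      by rewrite sqrtrM ?(ltW m0) // sqrtr_sqr normr_id.
    exact: (ler_wsqrtr (Hm X')).
  have w1 : w t <= 1.
    rewrite /w /rho gerBl; apply: mulr_ge0; first exact: r20'.
    by apply: sumr_ge0 => i _; exact: sqr_ge0.
  have S1 : `|S| <= n%:R * (r * `|X'|).
    rewrite (le_trans (ler_norm_sum _ _ _)) //.
    have -> : n%:R * (r * `|X'|) = \sum_(i < n) r * `|X'| by rewrite sumr_const card_ord mulr_natl.
    apply: ler_sum => i _; rewrite normrM; apply: ler_pM => //; last exact: coord_le_norm.
    by apply: le_trans Xr; have := coord_le_norm (X t - x0) i; rewrite !mxE.
  have nX'0 : 0 <= n%:R * (r * `|X'|) by rewrite !mulr_ge0 // ltW.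
  have -> : `|2 * w t * - (2 / r ^+ 2 * S)| = 2 * w t * (2 * r^-2 * `|S|).
    by rewrite !normrM normrN !normrM (ger0_norm (ltW wt)) !(@ger0_norm _ 2) // (ger0_norm r20').
  have E1 : 2 * w t * (2 * r^-2 * `|S|) <= 2 * 1 * (2 * r^-2 * (n%:R * (r * `|X'|))).
    apply: ler_pM.
    - by apply: mulr_ge0 => //; exact: ltW.
    - by do 2?[apply: mulr_ge0 => //].
    - by rewrite ler_wpM2l.
    - by rewrite ler_wpM2l // mulr_ge0.
  apply: (le_trans E1).
  have -> : 2 * 1 * (2 * r^-2 * (n%:R * (r * `|X'|))) = (4 * n%:R / r / Num.sqrt m) * (Num.sqrt m * `|X'|).
    by field; rewrite (gt_eqF r0) (gt_eqF sm0).
  apply: ler_pM => //; last by rewrite lerDl.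
  by rewrite !divr_ge0 ?mulr_ge0 // ltW.
have key' (t : R) : exists D : R, 0 <= t <= 1 ->
    is_derive t (1 : R) (h \o gamma) D /\ `|D| <= C * speed psi gamma t.
  have [t01|nt01] := pselect (0 <= t <= 1); last by exists 0 => /nt01.
  by have [D0 HD0] := key t t01; exists D0.
have [D HD] := choice key'.
have cs (t : R) : 0 <= t <= 1 -> {for t, continuous (speed psi gamma)}.
  exact: (arc_speed_continuous hpsi sg).
(* The signs k = 1 and k = -1 give the two halves of the absolute value. *)
have bnd (k : R) : `|k| = 1 -> k * (h (gamma 1) - h (gamma 0)) <= C * arc_length psi gamma.
  move=> k1; rewrite -ler_pdivrMl // mulrA mulrBr.
  apply: (@increment_le R (fun t => C^-1 * k * h (gamma t)) (fun t => C^-1 * k * D t) (speed psi gamma)) => //.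
    move=> t t01; have [H _] := HD t t01; exact: (is_deriveZ (C^-1 * k) H).
  move=> t t01; have [_ H] := HD t t01.
  rewrite -mulrA ler_pdivrMl // (le_trans _ H) // (le_trans (ler_norm _)) //.
  by rewrite normrM k1 mul1r.
rewrite ler_norml -[X in _ && (X <= _)]mul1r bnd ?normr1 // andbT lerNl -mulN1r.
by rewrite bnd // normrN normr1.
Qed.

(** Convergence for the Riemannian distance is convergence in M: a curve from
    outside O to p climbs the bump function, so it is not short. *)
Lemma riem_dist_nbhs p (O : set M) : nbhs p O ->
  exists2 e : R, 0 < e & forall q, riem_dist psi q p < e -> O q.
Proof.
move=> nO; have [C [h [C0 hp hO lip]]] := bump_function nO.
exists C^-1; first by rewrite invr_gt0.
move=> q dq; apply: contrapT => nOq; have hq := hO q nOq.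
have J q' l : joined psi q q' l -> `|h q' - h q| <= C * l.
  elim=> [|gamma l' _ IH sg]; first by rewrite subrr normr0 mulr0.
  rewrite mulrDr [C * l' + _]addrC (le_trans (ler_distD (h (gamma 0)) _ _)) // lerD //.
  exact: lip.
move: dq; rewrite ltNge => /negP; apply.
apply: lb_le_inf; first exact: joined_any.
move=> l /= /J; rewrite hp hq subr0 normr1 => H.
by rewrite -[_^-1]mulr1 ler_pdivrMl.
Qed.


End Lengths.

(** * A complete hypersurface is an entire graph *)

Section Tubes.
Context {R : realType} {n : nat}.
Implicit Types (y v w : 'rV[R]_n) (r d : R).

Definition tube y v r d : set 'rV[R]_n :=
  [set w | exists2 t : R, 0 <= t <= r & ball (y + t *: v) d w].

Lemma tube_open y v r d : open (tube y v r d).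
Proof.
have -> : tube y v r d = \bigcup_(t in [set t : R | 0 <= t <= r]) ball (y + t *: v) d by [].
by apply: bigcup_open => t _; exact: ball_open.
Qed.

Lemma tube_convex y v r d : convex_region (tube y v r d).
Proof.
move=> w1 w2 [t1 /andP[t10 t1r] b1] [t2 /andP[t20 t2r] b2] s s01.
exists (t1 + s * (t2 - t1)).
  move: s01 => /andP[s0 s1]; apply/andP; split; nra.
have c0 : convex_region (ball (0 : 'rV[R]_n) d) by exact: convex_region_ball.
have B w t : ball (y + t *: v) d w -> ball (0 : 'rV[R]_n) d (w - (y + t *: v)).
  by rewrite -!ball_normE /= sub0r opprB.
have := c0 _ _ (B _ _ b1) (B _ _ b2) s s01.
rewrite -!ball_normE /= sub0r -normrN opprK.
set A := (X in `|X| < d -> _); set A' := (X in _ -> `|X| < d).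
suff -> : A = - A' by rewrite normrN.
by apply/rowP => k; rewrite !mxE; ring.
Qed.

Lemma tube_sub y v r r' d d' : r' <= r -> d' <= d -> tube y v r' d' `<=` tube y v r d.
Proof.
move=> rr dd w [t /andP[t0 tr] tw]; exists t; last exact: le_ball tw.
by rewrite t0 (le_trans tr).
Qed.

Lemma tube_line y v r d t : 0 <= t <= r -> 0 < d -> tube y v r d (y + t *: v).
Proof. by move=> tr d0; exists t => //; exact: ballxx. Qed.

Lemma tube_start y v r d : 0 <= r -> 0 < d -> tube y v r d y.
Proof.
move=> r0 d0; have := @tube_line y v r d 0; rewrite scale0r addr0 lexx; exact.
Qed.

End Tubes.

Section Lifting.
Context {R : realType} {n : nat}.
Variables (a b : 'rV[R]_n.+2) (E : 'I_n -> 'rV[R]_n.+2).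
Hypothesis frame : forall x y, lorentz x y =
  lorentz x a * lorentz y b + lorentz x b * lorentz y a +
  \sum_i lorentz x (E i) * lorentz y (E i).
Context {M : smoothManifold R n}.
Variable psi : M -> 'rV[R]_n.+2.
Hypothesis hpsi : spacelike_hypersurface a psi.
Hypothesis hcomplete : complete_hypersurface psi.
Variable tau : R.
Hypothesis tau0 : 0 <= tau.
Hypothesis htau : forall p, lorentz (psi p) a <= tau.
Implicit Types (p q : M) (s : 'rV[R]_n -> M) (A B : set 'rV[R]_n).
Local Notation coords := (coords a E psi).
Local Notation graph_section := (graph_section a E psi).

Lemma graph_section_sub A B s : B `<=` A -> graph_section A s -> graph_section B s.
Proof. by move=> sBA ss w /sBA; exact: ss. Qed.

Lemma graph_section_eq A s s' : open A -> (forall w, A w -> s' w = s w) ->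
  graph_section A s -> graph_section A s'.
Proof.
move=> oA ss' ss w Aw; have [Ew cs] := ss w Aw; split; first by rewrite ss'.
have nA : nbhs w A by exact: open_nbhs_nbhs.
have nE : \forall z \near w, s z = s' z by apply: filterS nA => z Az; rewrite ss'.
rewrite /prop_for /continuous_at ss' //; apply: cvg_trans cs.
exact: near_eq_cvg nE.
Qed.

Variable p0 : M.
Let y0 := coords p0.

Let liftable (v : 'rV[R]_n) (r : R) : Prop :=
  exists (d : R) s, [/\ 0 < d, graph_section (tube y0 v r d) s & s y0 = p0].

Lemma liftable0 v : liftable v 0.
Proof.
have [s [ O [d [d0 oO Op inj [ss Os]]]]] := local_graph_section frame hpsi p0.
exists d, s; split=> //.
  apply: graph_section_sub ss => w [t /andP[t0 t0' ]].
  by have -> : t = 0 by [apply/eqP; rewrite eq_le t0 t0']; rewrite scale0r addr0.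
have By : ball (coords p0) d y0 by exact: ballxx.
by apply: inj => //; [exact: Os|case: (ss _ By)].
Qed.

Lemma liftable_le v r r' : r' <= r -> liftable v r -> liftable v r'.
Proof.
move=> rr [d [s [d0 ss sy]]]; exists d, s; split=> //.
by apply: graph_section_sub ss; exact: tube_sub.
Qed.

(** The lifts up to parameters r_k increasing to rs have endpoints u_k that form a
    Cauchy sequence, since the lifts do not increase lengths by more than a
    constant factor. Their limit exists by completeness, and a local section
    around the limit continues the lift beyond rs. *)
Lemma liftable_extend v (rs : R) : 0 <= rs <= 1 ->
  (forall r, 0 <= r -> r < rs \/ r = 0 -> liftable v r) ->
  exists2 e : R, 0 < e & liftable v (rs + e).
Proof.
move=> /andP[rs0 rs1] L.
(* For rs = 0 the sequence is constant, and liftability at 0 is used. *)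
pose r (k : nat) : R := rs - rs * k.+1%:R^-1.
have rlt k : 0 <= r k /\ (r k < rs \/ r k = 0).
  rewrite /r; have [->|rsn0] := eqVneq rs 0; first by rewrite mul0r subr0; split=> //; right.
  split; first by rewrite subr_ge0 ler_piMr // invf_le1 // ler1n.
  by left; rewrite ltrBlDl ltrDr mulr_gt0 ?invr_gt0 // lt_def rsn0.
have rle k : r k <= rs by rewrite /r lerBlDl lerDr mulr_ge0 // invr_ge0.
have rge k0 k : (k0 <= k)%N -> rs - k0.+1%:R^-1 <= r k.
  move=> kk; rewrite /r lerD2l lerN2 (@le_trans _ _ k.+1%:R^-1) //.
    by rewrite ler_piMl // invr_ge0.
  by rewrite lef_pV2 ?posrE // ler_nat.
have [D HD] := choice (fun k => let: conj h1 h2 := rlt k in L (r k) h1 h2).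
have [s Hs] := choice HD.
pose u k := s k (y0 + r k *: v).
(* Lifts of nested segments agree on the shorter one, by uniqueness. *)
have agree j k : r j <= r k -> u j = s k (y0 + r j *: v).
  move=> jk; have [dj ssj sj0] := Hs j; have [dk ssk sk0] := Hs k.
  have [rj0 _] := rlt j.
  pose d := Num.min (D j) (D k).
  have d0 : 0 < d by rewrite lt_min dj dk.
  have s1 : graph_section (tube y0 v (r j) d) (s j).
    by apply: graph_section_sub ssj; apply: tube_sub => //; rewrite ge_min lexx.
  have s2 : graph_section (tube y0 v (r j) d) (s k).
    by apply: graph_section_sub ssk; apply: tube_sub => //; rewrite ge_min lexx orbT.
  apply: (graph_section_uniq frame hpsi (@tube_open _ _ _ _ _ _) (@tube_convex _ _ _ _ _ _) s1 s2 (w0 := y0)).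
  - exact: tube_start.
  - by rewrite sj0 sk0.
  - by apply: tube_line => //; rewrite rj0 lexx.
pose K := tau * (n%:R * `|v|).
have K0 : 0 <= K by rewrite !mulr_ge0.
have line j k : (y0 + r j *: v) - (y0 + r k *: v) = (r j - r k) *: v.
  by rewrite opprD addrACA subrr add0r -scalerBl.
have dist1 j k : r j <= r k -> riem_dist psi (u j) (u k) <= K * `|r j - r k| /\
    riem_dist psi (u k) (u j) <= K * `|r j - r k|.
  move=> jk; have [dk ssk _] := Hs k; have [rj0 _] := rlt j; have [rk0 _] := rlt k.
  have Tj : tube y0 v (r k) (D k) (y0 + r j *: v) by apply: tube_line; rewrite ?rj0.
  have Tk : tube y0 v (r k) (D k) (y0 + r k *: v) by apply: tube_line; rewrite ?rk0 ?lexx.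
  rewrite (agree j k jk) /u.
  have H1 := graph_section_dist frame hpsi (@tube_open _ _ _ _ _ _) (@tube_convex _ _ _ _ _ _) ssk Tj Tk tau0 htau.
  have H2 := graph_section_dist frame hpsi (@tube_open _ _ _ _ _ _) (@tube_convex _ _ _ _ _ _) ssk Tk Tj tau0 htau.
  have KE (x : R) : tau * (n%:R * (x * `|v|)) = K * x by rewrite /K; ring.
  by rewrite line normrZ KE distrC in H1; rewrite line normrZ KE in H2; split.
have dist j k : riem_dist psi (u j) (u k) <= K * `|r j - r k|.
  have [jk|/ltW jk] := leP (r j) (r k); first by case: (dist1 j k jk).
  by rewrite distrC; case: (dist1 k j jk).
have arch (e : R) : 0 < e -> exists k0 : nat, k0.+1%:R^-1 < e.
  move=> e0; have [k0 _ Hk] := near_infty_natSinv_lt (PosNum e0).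
  by exists k0; apply: (Hk k0 (leqnn k0)).
have [p Hp] : exists p, (fun k => riem_dist psi (u k) p) @ \oo --> (0 : R).
  apply: hcomplete => e e0.
  have [k0 Hk0] := arch (e / (K + 1)) (divr_gt0 e0 (ltr_wpDl K0 ltr01)).
  exists k0 => j k jk kk; apply: (le_lt_trans (dist j k)).
  have H : `|r j - r k| <= k0.+1%:R^-1.
    have := rle j; have := rle k; have := rge _ _ jk; have := rge _ _ kk.
    move: (r j) (r k) (k0.+1%:R^-1) => x y z h1 h2 h3 h4.
    by rewrite ler_norml; apply/andP; split; lra.
  rewrite (@le_lt_trans _ _ (K * k0.+1%:R^-1)) // ?ler_wpM2l //.
  move: Hk0; rewrite ltr_pdivlMr ?ltr_wpDl // => Hk0.
  by rewrite (le_lt_trans _ Hk0) // mulrC ler_wpM2l ?invr_ge0 // lerDl.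
have evO (O : set M) : nbhs p O -> \forall k \near \oo, O (u k).
  move=> nO; have [e e0 He] := riem_dist_nbhs frame hpsi nO.
  move/cvgrPdist_lt : Hp => /(_ e e0); apply: filterS => k Hk; apply: He.
  by rewrite (le_lt_trans (ler_norm _)) // -normrN -sub0r.
have evr (e : R) : 0 < e -> \forall k \near \oo, `|(rs - r k) *: v| < e.
  move=> e0; have [k0 Hk0] := arch (e / (`|v| + 1)) (divr_gt0 e0 (ltr_wpDl (normr_ge0 v) ltr01)).
  exists k0 => // k /= kk; rewrite normrZ.
  have h1 := rle k; have h2 : rs - r k <= k0.+1%:R^-1.
    by have := rge _ _ kk; move: (r k) (k0.+1%:R^-1) => x z; lra.
  rewrite ger0_norm ?subr_ge0 //.
  move: Hk0; rewrite ltr_pdivlMr ?ltr_wpDl // => Hk0.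
  rewrite (le_lt_trans _ Hk0) //; apply: ler_pM => //; first by rewrite subr_ge0.
  by rewrite lerDl.
pose zs := y0 + rs *: v.
have zsE k : zs - (y0 + r k *: v) = (rs - r k) *: v.
  by rewrite /zs opprD addrACA subrr add0r -scalerBl.
have cu k : coords (u k) = y0 + r k *: v.
  have [dk ssk _] := Hs k; have [rk0 _] := rlt k.
  have Tk : tube y0 v (r k) (D k) (y0 + r k *: v) by apply: tube_line; rewrite ?rk0 ?lexx.
  by case: (ssk _ Tk).
have cp : coords p = zs.
  apply/eqP; rewrite -subr_eq0 -normr_le0 leNgt; apply/negP => e0.
  set e := `|coords p - zs| in e0.
  have e20 : 0 < e / 2 by rewrite divr_gt0.
  have n1 : nbhs p (coords @^-1` ball (coords p) (e / 2)).
    by apply: (coords_continuous hpsi); exact: nbhsx_ballx.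
  have [k [k1 k2]] : exists k, (coords @^-1` ball (coords p) (e / 2)) (u k) /\ `|(rs - r k) *: v| < e / 2.
    apply: (@filter_ex nat \oo); apply: filterI; first exact: evO.
    exact: evr.
  move: k1; rewrite /= -ball_normE /= cu => k1.
  have : e <= `|coords p - (y0 + r k *: v)| + `|(y0 + r k *: v) - zs|.
    by rewrite /e -[coords p - zs](subrKA (y0 + r k *: v)) ler_normD.
  rewrite [X in _ + X]distrC zsE => H.
  by have := splitr e; lra.
have [sp [ O [d [d0 oO Op inj [ssp Osp]]]]] := local_graph_section frame hpsi p.
rewrite cp in ssp Osp.
have d20 : 0 < d / 2 by rewrite divr_gt0.
have nOp : nbhs p O by exact: open_nbhs_nbhs.
have [k [Ok kd]] : exists k, O (u k) /\ `|(rs - r k) *: v| < d / 2.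
  apply: (@filter_ex nat \oo); apply: filterI; first exact: evO.
  exact: evr.
have [dk ssk sk0] := Hs k; have [rk0 _] := rlt k.
pose T := tube y0 v (r k) (D k).
have oT : open T by exact: tube_open.
have Tk : T (y0 + r k *: v) by apply: tube_line; rewrite ?rk0 ?lexx.
have Bk : ball zs d (y0 + r k *: v).
  by rewrite -ball_normE /= zsE (lt_trans kd) // ltr_pdivrMr // ltr_pMr // ltr1n.
have Ek : s k (y0 + r k *: v) = sp (y0 + r k *: v).
  apply: inj => //; first exact: Osp.
  by rewrite cu; case: (ssp _ Bk).
have eqI w : T w -> ball zs d w -> s k w = sp w.
  move=> Tw Bw.
  apply: (graph_section_uniq frame hpsi (A := T `&` ball zs d) (w0 := y0 + r k *: v)) => //.
  - by apply: openI => //; exact: ball_open.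
  - by apply: convex_regionI; [exact: tube_convex|exact: convex_region_ball].
  - by apply: graph_section_sub ssk => z [].
  - by apply: graph_section_sub ssp => z [].
(* The lift over the tube T and the local section around the limit agree on the
   overlap, which is convex. *)
pose sg w := if pselect (T w) then s k w else sp w.
have sg1 : graph_section T sg.
  by apply: graph_section_eq ssk => // w Tw; rewrite /sg; case: pselect.
have sg2 : graph_section (ball zs d) sg.
  apply: graph_section_eq ssp => [|w Bw]; first exact: ball_open.
  by rewrite /sg; case: pselect => // Tw; exact: eqI.
pose eta := d / 2 / (`|v| + 1).
have v10 : 0 < `|v| + 1 by rewrite ltr_wpDl.
have eta0 : 0 < eta by rewrite divr_gt0.
exists eta => //.
exists (Num.min (D k) (d / 2)), sg; split; first by rewrite lt_min dk d20.
- move=> w [t /andP[t0 tr] tw].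
  have [tk|tk] := leP t (r k).
    apply: sg1; exists t; first by rewrite t0.
    by apply: le_ball tw; rewrite ge_min lexx.
  apply: sg2; rewrite -ball_normE /=.
  have tw2 : `|(y0 + t *: v) - w| < d / 2.
    have : ball (y0 + t *: v) (d / 2) w by apply: le_ball tw; rewrite ge_min lexx orbT.
    by rewrite -ball_normE.
  have H1 : `|zs - (y0 + t *: v)| <= d / 2.
    rewrite /zs opprD addrACA subrr add0r -scalerBl normrZ.
    have [trs|trs] := leP t rs.
      rewrite ger0_norm ?subr_ge0 //.
      move: kd; rewrite normrZ ger0_norm ?subr_ge0 // => kd.
      by apply: le_trans (ltW kd); rewrite ler_wpM2r // lerD2l lerN2 ltW.
    rewrite ltr0_norm ?subr_lt0 // opprB.
    have : (t - rs) * `|v| <= eta * (`|v| + 1).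
      apply: ler_pM => //; last by rewrite lerDl.
        by rewrite subr_ge0 ltW.
      by rewrite lerBlDl.
    by rewrite /eta divfK // gt_eqF.
  rewrite -(subrKA (y0 + t *: v)) (le_lt_trans (ler_normD _ _)) //.
  by have := splitr d; lra.
- by rewrite /sg; case: pselect => // nT; exfalso; apply: nT; exact: tube_start.
Qed.


Lemma liftable1 v : liftable v 1.
Proof.
pose A := [set r : R | 0 <= r <= 1 /\ liftable v r].
have A0 : A 0 by split; [rewrite lexx ler01|exact: liftable0].
have sA : has_sup A by split; [exists 0|exists 1 => r [/andP[]]].
have rs0 : 0 <= sup A by apply: sup_upper_bound.
have rs1 : sup A <= 1 by apply: sup_le_ub => [|r [/andP[]//]]; exists 0.
have L r : 0 <= r -> r < sup A \/ r = 0 -> liftable v r.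
  move=> r0 [rs|->]; last exact: liftable0.
  have e0 : 0 < sup A - r by rewrite subr_gt0.
  have [r' [_ Lr'] rr'] := sup_adherent e0 sA.
  by apply: liftable_le Lr'; apply: ltW; rewrite subKr in rr'.
have rs01 : 0 <= sup A <= 1 by rewrite rs0.
have [e e0 Le] := liftable_extend rs01 L.
have [le1|gt1] := leP (sup A + e) 1; last by apply: liftable_le Le; exact: ltW.
exfalso; have : sup A + e <= sup A.
  by apply: sup_upper_bound => //; split=> //; rewrite le1 addr_ge0 // ltW.
by rewrite gerDl leNgt e0.
Qed.

(** Completeness makes M a graph over the whole of R^n: straight segments lift,
    and the lifts from a base point fit together because R^n is simply
    connected (here: because tubes around segments are convex). *)
Theorem entire_graph : exists g : 'rV[R]_n -> M,
  graph_section setT g /\ forall p, g (coords p) = p.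
Proof.
have H z : exists d : R, exists s,
    [/\ 0 < d, graph_section (tube y0 (z - y0) 1 d) s & s y0 = p0] by exact: liftable1.
have [d Hd] := choice H; have [s Hs] := choice Hd.
(* The lift along the segment from y0 to z, evaluated at its end. *)
pose g z := s z z.
have ball_tube z : ball z (d z) `<=` tube y0 (z - y0) 1 (d z).
  by move=> w; exists 1; [rewrite ler01 lexx|rewrite scale1r addrC subrK].
have gE z w : ball z (d z) w -> g w = s z w.
  move=> Bw; have [dz ssz sz0] := Hs z; have [dw ssw sw0] := Hs w.
  apply: (graph_section_uniq frame hpsi
    (A := tube y0 (w - y0) 1 (d w) `&` tube y0 (z - y0) 1 (d z))
    (s := s w) (s' := s z) (w0 := y0) (w1 := w)).
  - by apply: openI; exact: tube_open.
  - by apply: convex_regionI; exact: tube_convex.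
  - by apply: graph_section_sub ssw => x [].
  - by apply: graph_section_sub ssz => x [].
  - by split; exact: tube_start.
  - by rewrite sw0 sz0.
  - by split; apply: ball_tube => //; exact: ballxx.
have sg : graph_section setT g.
  move=> z _; have [dz ssz _] := Hs z.
  have H1 : graph_section (ball z (d z)) g.
    apply: (@graph_section_eq _ (s z)); [exact: ball_open|exact: gE|].
    exact: graph_section_sub (ball_tube z) ssz.
  by apply: H1; exact: ballxx.
exists g; split=> //.
pose B := [set p | g (coords p) = p].
suff BT : B = setT by move=> p; have : B p by rewrite BT.
have loc p : exists2 O : set M, open_nbhs p O & forall q, O q -> (B q <-> B p).
  have [s' [ O [e [e0 oO Op inj [ss Os]]]]] := local_graph_section frame hpsi p.
  pose b' := ball (coords p) e.
  have ob : open b' by exact: ball_open.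
  have bp : b' (coords p) by exact: ballxx.
  exists (O `&` coords @^-1` b').
    split; last by split.
    apply: openI => //; apply: open_comp => // z _; exact: (coords_continuous hpsi).
  have sE q : O q -> b' (coords q) -> s' (coords q) = q.
    by move=> Oq bq; apply: inj => //; [exact: Os|case: (ss _ bq)].
  move=> q [Oq bq].
  have sgb : graph_section b' g by exact: graph_section_sub sg.
  have U x y : b' x -> b' y -> g x = s' x -> g y = s' y.
    move=> bx by_ Ex; apply: (graph_section_uniq frame hpsi ob _ sgb ss bx Ex by_).
    exact: convex_region_ball.
  rewrite /B /=; split=> Eq.
    by rewrite (U _ _ bq bp) ?sE.
  by rewrite (U _ _ bp bq) ?sE.
apply: (hyp_connected hpsi).
- exists p0; rewrite /B /=; have [d0 ss0 s0] := Hs y0.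
  by rewrite -/y0 /g.
- exists B; last by rewrite setTI.
  rewrite openE => p Bp; have [ O nO HO] := loc p.
  by apply: filterS (open_nbhs_nbhs nO) => q /HO ->.
- exists B; last by rewrite setTI.
  move=> p cB; have [ O nO HO] := loc p.
  by have [q [Bq Oq]] := cB _ (open_nbhs_nbhs nO); apply/(HO q Oq).
Qed.

End Lifting.

(** * The mean curvature equation of a graph *)

Section GraphFields.
Context {R : realType} {n : nat}.
Variables (a b : 'rV[R]_n.+2) (E : 'I_n -> 'rV[R]_n.+2).
Hypothesis frame : forall x y, lorentz x y =
  lorentz x a * lorentz y b + lorentz x b * lorentz y a +
  \sum_i lorentz x (E i) * lorentz y (E i).
Context {M : smoothManifold R n}.
Variables (psi N : M -> 'rV[R]_n.+2) (H : R).
Hypothesis hpsi : spacelike_hypersurface a psi.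
Hypothesis hN : future_gauss_map psi N.
Hypothesis hH : forall p : M, mean_curvature_at psi N p H.
Variable g : 'rV[R]_n -> M.
Hypothesis hg : graph_section a E psi setT g.

Lemma Ck_local (V W : normedModType R) k (A : set V) (f : V -> W) :
  (forall z, A z -> exists U : set V, U z /\ Ck k U f) -> Ck k A f.
Proof.
elim: k f => [|k IH] f HU.
  by move=> z Az; have [U [Uz cU]] := HU z Az; exact: cU.
split=> [z Az|v]; first by have [U [Uz [dU _]]] := HU z Az; exact: dU.
by apply: IH => z Az; have [U [Uz [_ DU]]] := HU z Az; exists U; split=> //; exact: DU.
Qed.

Lemma graph_chart c z : atlas c -> dom c (g z) ->
  exists U : set 'rV[R]_n, [/\ open U, U z, (forall w, U w -> dom c (g w)) &
    smooth_on U (to_coord c \o g)].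
Proof.
move=> ac cg.
have [U [oU Uz _ dU sU]] := graph_section_smooth frame hpsi openT hg (I : setT z) ac cg.
by exists U.
Qed.

Lemma graph_smooth m (f : M -> 'rV[R]_m) : smooth_map f -> smooth_on setT (f \o g).
Proof.
move=> sf k; apply: Ck_local => z _.
have [c ac cg] := atlas_cover (g z).
have [U [oU Uz dU sU]] := graph_chart ac cg.
exists U; split=> //.
have H1 := Ck_comp_rV oU (@open_cod _ _ _ c) (fun w Uw => to_coord_cod (dU w Uw)) (sU k) (sf c ac k).
by apply: (Ck_ext oU _ H1) => w /dU cw; rewrite /= to_coordK.
Qed.

Lemma graph_derive m (f : M -> 'rV[R]_m) c z v : smooth_map f -> atlas c -> dom c (g z) ->
  'D_v (f \o g) z = differential f c (g z) ('D_v (to_coord c \o g) z).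
Proof.
move=> sf ac cg; have [U [oU Uz dU sU]] := graph_chart ac cg.
have nU : nbhs z U by exact: open_nbhs_nbhs.
have dX : differentiable (to_coord c \o g) z by have [h _] := sU 1; exact: h.
have dF : differentiable (f \o of_coord c) ((to_coord c \o g) z).
  by have [h _] := sf c ac 1; apply: h; exact: to_coord_cod.
have nE : \forall w \near z, (f \o g) w = ((f \o of_coord c) \o (to_coord c \o g)) w.
  by apply: filterS nU => w /dU cw; rewrite /= to_coordK.
have dc := differentiable_comp dX dF.
by rewrite (near_eq_derive v nE) (deriveE _ dc) (diff_comp dX dF) /= -(deriveE _ dX).
Qed.

Let psi_smooth := graph_smooth (hyp_smooth hpsi).
Let N_smooth := graph_smooth (gauss_smooth hN).

Lemma graph_psi_diff z : differentiable (psi \o g) z.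
Proof. by have [h _] := psi_smooth 1; exact: h. Qed.

Lemma graph_N_diff z : differentiable (N \o g) z.
Proof. by have [h _] := N_smooth 1; exact: h. Qed.

Lemma graph_coords z : half_space_proj a E (psi (g z)) = z.
Proof. by case: (hg (I : setT z)). Qed.

Lemma graph_normal z v : lorentz (N (g z)) ('D_v (psi \o g) z) = 0.
Proof.
have [c ac cg] := atlas_cover (g z).
rewrite (graph_derive v (hyp_smooth hpsi) ac cg); exact: (gauss_normal hN).
Qed.

(** The shape operator read in the coordinates of the graph: the change of
    coordinates conjugates its matrix, which preserves the trace. *)
Lemma graph_shape z : exists2 A : 'M[R]_n,
  (forall v, 'D_v (N \o g) z = - 'D_(v *m A) (psi \o g) z) & H = - (n%:R^-1 * \tr A).
Proof.
have [c ac cg] := atlas_cover (g z).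
have [U [oU Uz dU sU]] := graph_chart ac cg.
have dX : differentiable (to_coord c \o g) z by have [h _] := sU 1; exact: h.
have [A0 shA0 HA0] := hH ac cg.
pose J := jacobian (to_coord c \o g) z.
have JE v : 'D_v (to_coord c \o g) z = v *m J by exact: deriveEjacobian.
have u0 : 0 < lorentz ((psi \o g) z) a by case: (hyp_steady hpsi (g z)).
have uJ : J \in unitmx.
  rewrite -row_free_unit; apply: inj_row_free => v v0.
  have D0 : 'D_v (psi \o g) z = 0.
    by rewrite (graph_derive v (hyp_smooth hpsi) ac cg) JE v0 /differential linear0.
  have Did : 'D_v (fun w => half_space_proj a E ((psi \o g) w)) z = v.
    have -> : (fun w => half_space_proj a E ((psi \o g) w)) = id.
      by apply/funext => w; exact: graph_coords.
    by rewrite derive_id.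
  apply/rowP => i; rewrite -{1}Did.
  have [_ ->] := derive_half_space_proj E v i (graph_psi_diff z) u0.
  by rewrite D0 !lorentz0l mulr0 subr0 mul0r mxE.
exists (J *m A0 *m invmx J); last first.
  by rewrite HA0 mxtrace_mulC mulmxA mulVmx // mul1mx.
move=> v; rewrite (graph_derive _ (hyp_smooth hpsi) ac cg) JE.
rewrite !mulmxA -(mulmxA (v *m J *m A0)) mulVmx // mulmx1 shA0 opprK.
rewrite /ds_connection.
have -> : lorentz (differential N c (g z) (v *m J)) (psi (g z)) = 0.
  rewrite -JE -(graph_derive v (gauss_smooth hN) ac cg).
  have [_] := derive_lorentz v (graph_N_diff z) (graph_psi_diff z).
  have -> : (fun x => lorentz ((N \o g) x) ((psi \o g) x)) = cst 0.
    by apply/funext => w; exact: (gauss_tangent hN).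
  by rewrite derive_cst /= graph_normal addr0.
by rewrite scale0r subr0 (graph_derive v (gauss_smooth hN) ac cg) JE.
Qed.

End GraphFields.

Section FramePoint.
Context {R : realType} {n : nat}.
Variables (a b : 'rV[R]_n.+2) (E : 'I_n -> 'rV[R]_n.+2).
Hypothesis frame : forall x y, lorentz x y =
  lorentz x a * lorentz y b + lorentz x b * lorentz y a +
  \sum_i lorentz x (E i) * lorentz y (E i).

(** The unit normal of a graph in half-space coordinates: its components om
    along the translations E_i - z_i a are those of the Minkowski normal of the
    graph of 1/u, up to the conformal factor. *)
Lemma graph_normal_components (P N : 'rV[R]_n.+2) (D : 'I_n -> 'rV[R]_n.+2)
    (z : 'rV[R]_n) (om : 'I_n -> R) :
  let u := lorentz P a in let th := lorentz N a in
  0 < u -> lorentz P P = 1 -> lorentz N N = -1 -> lorentz N P = 0 ->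
  (forall j, lorentz N (D j) = 0) -> (forall j, lorentz (D j) P = 0) ->
  (forall i, lorentz P (E i) = z 0 i * u) ->
  (forall i j, lorentz (D j) (E i) = (i == j)%:R * u + z 0 i * lorentz (D j) a) ->
  (forall i, lorentz N (E i) = om i + z 0 i * th) ->
  (forall j, om j = th * lorentz (D j) a / u ^+ 3) /\
  th ^+ 2 = u ^+ 2 * (1 + \sum_i om i ^+ 2).
Proof.
move=> u th u0 PP NN NP ND DP PE DE NE; have un0 : u != 0 by rewrite gt_eqF.
set be := lorentz P b; set et := lorentz N b.
pose Z2 := \sum_i z 0 i ^+ 2; pose OZ := \sum_i om i * z 0 i; pose O2 := \sum_i om i ^+ 2.
have E1 : 2 * u * be + u ^+ 2 * Z2 = 1.
  rewrite -[RHS]PP [RHS]frame -/u -/be /Z2 mulr_sumr.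
  have -> : \sum_i lorentz P (E i) * lorentz P (E i) = \sum_i u ^+ 2 * z 0 i ^+ 2.
    by apply: eq_bigr => i _; rewrite PE; ring.
  by ring.
have E2 : th * be + et * u + u * (OZ + th * Z2) = 0.
  rewrite -[RHS]NP [RHS]frame -/u -/be -/et -/th; congr (_ + _).
  rewrite /OZ /Z2 mulr_sumr -big_split mulr_sumr; apply: eq_bigr => i _.
  by rewrite NE PE /=; ring.
have E3 : 2 * th * et + O2 + 2 * th * OZ + th ^+ 2 * Z2 = -1.
  rewrite -[RHS]NN [RHS]frame -/th -/et.
  have -> : \sum_i lorentz N (E i) * lorentz N (E i) = O2 + 2 * th * OZ + th ^+ 2 * Z2.
    rewrite /O2 /OZ /Z2 !mulr_sumr -!big_split; apply: eq_bigr => i _.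
    by rewrite NE /=; ring.
  by ring.
have kron j (F : 'I_n -> R) : \sum_i (i == j)%:R * F i = F j.
  rewrite (bigD1 j) //= eqxx mul1r big1 ?addr0 // => i /negPf ->.
  by rewrite mul0r.
have E4 j : lorentz (D j) a * be + lorentz (D j) b * u +
    (u ^+ 2 * z 0 j + u * lorentz (D j) a * Z2) = 0.
  rewrite -[RHS](DP j) [RHS]frame -/u -/be; congr (_ + _).
  have -> : \sum_i lorentz (D j) (E i) * lorentz P (E i) =
      \sum_i (i == j)%:R * (u ^+ 2 * z 0 i) + u * lorentz (D j) a * Z2.
    rewrite /Z2 mulr_sumr -big_split; apply: eq_bigr => i _.
    by rewrite DE PE /=; ring.
  by rewrite kron.
have E5 j : th * lorentz (D j) b + et * lorentz (D j) a +
    (u * (om j + z 0 j * th) + lorentz (D j) a * (OZ + th * Z2)) = 0.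
  rewrite -[RHS](ND j) [RHS]frame -/th -/et; congr (_ + _).
  have -> : \sum_i lorentz N (E i) * lorentz (D j) (E i) =
      \sum_i (i == j)%:R * (u * (om i + z 0 i * th)) + lorentz (D j) a * (OZ + th * Z2).
    rewrite /OZ /Z2 mulr_sumr -big_split mulr_sumr -big_split; apply: eq_bigr => i _.
    by rewrite DE NE /=; ring.
  by rewrite kron.
have beE : be = (1 - u ^+ 2 * Z2) / (2 * u).
  have D0 : 2 * u != 0 by rewrite mulf_neq0.
  by apply: (mulIf D0); rewrite divfK //; lra.
have etE : et = - (th * be) / u - OZ - th * Z2.
  apply: (mulIf un0); rewrite !mulrBl divfK //; lra.
split=> [j|].
  have dbE : lorentz (D j) b = - (lorentz (D j) a * be) / u - u * z 0 j - lorentz (D j) a * Z2.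
    apply: (mulIf un0); rewrite !mulrBl divfK //; have := E4 j; lra.
  have := E5 j; rewrite dbE etE beE => H5.
  apply: (mulfI un0).
  have -> : u * (th * lorentz (D j) a / u ^+ 3) = th * lorentz (D j) a / u ^+ 2 by field.
  apply/eqP; rewrite -subr_eq0; apply/eqP; rewrite -H5.
  by field.
move: E3; rewrite etE beE -/O2 => H3.
have : - (th ^+ 2 / u ^+ 2) + O2 = -1.
  by rewrite -H3; field.
move=> H4; apply: (mulIf (invr_neq0 (expf_neq0 2 un0))).
rewrite [RHS]mulrAC mulfV ?expf_neq0 // mul1r; lra.
Qed.

(** If the product were nonpositive, the spatial part of A N + k a would have a
    negative squared norm, where A and k are the absolute time components. *)
Lemma future_past_pos (N : 'rV[R]_n.+2) : null_past_pointing a ->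
  lorentz N N = -1 -> lorentz N (e0 n.+1) < 0 -> 0 < lorentz N a.
Proof.
case=> _ aa; rewrite !lorentz_e0 !oppr_lt0 oppr_gt0 => a0 NN N0.
rewrite ltNge; apply/negP => Na.
set A := - a 0 0; set k := N 0 0 in N0.
have A0 : 0 < A by rewrite oppr_gt0.
pose S := \sum_(i < n.+1) (A * N 0 (lift 0 i) + k * a 0 (lift 0 i)) ^+ 2.
have S0 : 0 <= S by apply: sumr_ge0 => i _; exact: sqr_ge0.
have SE : S = A ^+ 2 * (\sum_(i < n.+1) N 0 (lift 0 i) * N 0 (lift 0 i)) +
    2 * A * k * (\sum_(i < n.+1) N 0 (lift 0 i) * a 0 (lift 0 i)) +
    k ^+ 2 * (\sum_(i < n.+1) a 0 (lift 0 i) * a 0 (lift 0 i)).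
  by rewrite !mulr_sumr -!big_split; apply: eq_bigr => i _; rewrite /=; ring.
move: aa NN Na; rewrite /lorentz -/k.
set Saa := \sum_i _; set SNN := \sum_i _; set SNa := \sum_i _ => aa NN Na.
rewrite -/Saa -/SNN -/SNa in SE.
have a0E : a 0 0 = - A by rewrite opprK.
rewrite a0E in aa Na.
have Ak : 0 < A * k by rewrite mulr_gt0.
have A2 : 0 < A ^+ 2 by rewrite exprn_gt0.
have h1 : Saa = A ^+ 2 by lra.
have h2 : SNN = k ^+ 2 - 1 by lra.
have h3 : SNa <= - (A * k) by lra.
rewrite h1 h2 in SE.
have h4 : 2 * A * k * SNa <= - 2 * (A * k) ^+ 2.
  have -> : - 2 * (A * k) ^+ 2 = (2 * A * k) * (- (A * k)) by ring.
  by rewrite ler_wpM2l // -mulrA mulr_ge0 // ltW.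
have : S <= - A ^+ 2.
  rewrite SE; apply: (@le_trans _ _ (A ^+ 2 * (k ^+ 2 - 1) + - 2 * (A * k) ^+ 2 + k ^+ 2 * A ^+ 2)).
    by rewrite lerD2r lerD2l.
  by have -> : A ^+ 2 * (k ^+ 2 - 1) + - 2 * (A * k) ^+ 2 + k ^+ 2 * A ^+ 2 = - A ^+ 2 by ring.
lra.
Qed.

End FramePoint.

Section GraphEquation.
Context {R : realType} {n : nat}.
Variables (a b : 'rV[R]_n.+2) (E : 'I_n -> 'rV[R]_n.+2).
Hypothesis ha : null_past_pointing a.
Hypothesis frame : forall x y, lorentz x y =
  lorentz x a * lorentz y b + lorentz x b * lorentz y a +
  \sum_i lorentz x (E i) * lorentz y (E i).
Context {M : smoothManifold R n}.
Variables (psi N : M -> 'rV[R]_n.+2) (H : R).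
Hypothesis hpsi : spacelike_hypersurface a psi.
Hypothesis hN : future_gauss_map psi N.
Hypothesis hH : forall p : M, mean_curvature_at psi N p H.
Variable g : 'rV[R]_n -> M.
Hypothesis hg : graph_section a E psi setT g.

(** The height in the half-space model, whose metric is (|dy|^2 - df^2) / f^2. *)
Definition graph_height (z : 'rV[R]_n) : R := (lorentz (psi (g z)) a)^-1.
(** The Lorentz factor (1 - |Df|^2)^(-1/2) of the graph of the height f. *)
Definition graph_tilt (z : 'rV[R]_n) : R := lorentz (N (g z)) a * graph_height z.

Let u z := lorentz (psi (g z)) a.
Let th z := lorentz (N (g z)) a.
Local Notation e i := (delta_mx 0 i : 'rV[R]_n).

Let u_gt0 z : 0 < u z. Proof. by case: (hyp_steady hpsi (g z)). Qed.
Let u_neq0 z : u z != 0. Proof. by rewrite gt_eqF. Qed.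

Let psi_diff := graph_psi_diff frame hpsi hg.
Let N_diff := graph_N_diff frame hpsi hN hg.

Lemma derive_lorentz_cst (f : 'rV[R]_n -> 'rV[R]_n.+2) x v c : differentiable f x ->
  differentiable (fun x => lorentz (f x) c : R) x /\
  'D_v (fun x => lorentz (f x) c : R) x = lorentz ('D_v f x) c.
Proof.
move=> df; have [dl Dl] := derive_lorentz v df (@differentiable_cst R _ _ c x).
split; first exact: dl.
by rewrite Dl derive_cst (lorentzC (f x)) lorentz0l addr0.
Qed.

Lemma graph_height_smooth : smooth_on setT graph_height.
Proof.
move=> k; apply: CkV; [exact: openT|by move=> z _; exact: u_neq0|].
exact: (Ck_lorentz openT (graph_smooth frame hpsi hg (hyp_smooth hpsi) k) (Ck_cst k setT a)).
Qed.

Lemma graph_tilt_smooth : smooth_on setT graph_tilt.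
Proof.
move=> k; apply: CkM; [exact: openT| |exact: graph_height_smooth].
exact: (Ck_lorentz openT (graph_smooth frame hpsi hg (gauss_smooth hN) k) (Ck_cst k setT a)).
Qed.

Let om i z := lorentz (N (g z)) (E i) - z 0 i * th z.

Lemma derive_coordinate (z v : 'rV[R]_n) i :
  differentiable (fun x : 'rV[R]_n => x 0 i : R) z /\
  'D_v (fun x : 'rV[R]_n => x 0 i : R) z = v 0 i.
Proof.
have di := @ex_diff _ _ _ _ _ _ _ (is_diff_id z).
split; first exact: (differentiable_coord_comp i di).
by rewrite (derive_coord v i di) derive_id.
Qed.

Let PE z i : lorentz (psi (g z)) (E i) = z 0 i * u z.
Proof.
have zE : z 0 i = lorentz (psi (g z)) (E i) / u z.
  by have /rowP/(_ i) := graph_coords hg z; rewrite mxE.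
by rewrite zE divfK.
Qed.

Let DE z i v : lorentz ('D_v (psi \o g) z) (E i) =
  v 0 i * u z + z 0 i * lorentz ('D_v (psi \o g) z) a.
Proof.
have [_ <-] := derive_lorentz_cst v (E i) (psi_diff z).
have [du Du] := derive_lorentz_cst v a (psi_diff z).
have [dc Dc] := derive_coordinate z v i.
have -> : (fun x => lorentz ((psi \o g) x) (E i) : R) =
    (fun x : 'rV[R]_n => x 0 i : R) * (fun x => lorentz ((psi \o g) x) a).
  by apply/funext => x; exact: PE.
rewrite deriveM; [|exact: diff_derivable|exact: diff_derivable].
by rewrite Dc Du addrC; congr (_ + _); exact: mulrC.
Qed.

Lemma derive_graph_height z v :
  'D_v graph_height z = - lorentz ('D_v (psi \o g) z) a / u z ^+ 2.
Proof.
have [du Du] := derive_lorentz_cst v a (psi_diff z).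
have dd : derivable (fun x => lorentz ((psi \o g) x) a : R) z v by exact: diff_derivable.
have D := deriveV (u_neq0 z) dd.
by rewrite D Du /GRing.scale /= mulNr mulrC mulNr.
Qed.

Let comps z :
  (forall j, om j z = th z * lorentz ('D_(e j) (psi \o g) z) a / u z ^+ 3) /\
  th z ^+ 2 = u z ^+ 2 * (1 + \sum_i om i z ^+ 2).
Proof.
have psi1 p : lorentz (psi p) (psi p) = 1 by case: (hyp_steady hpsi p).
apply: (graph_normal_components (D := fun j => 'D_(e j) (psi \o g) z) frame (u_gt0 z)) => //.
- exact: (gauss_unit hN).
- exact: (gauss_tangent hN).
- by move=> j; exact: (graph_normal frame hpsi hN hg).
- move=> j; apply: (de_sitter_tangent _ (psi_diff z)).
  by near=> x; exact: psi1.
- exact: PE.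
- by move=> i j; rewrite DE mxE eqxx.
- by move=> i; rewrite /om subrK.
Unshelve. all: by end_near. Qed.

Lemma graph_tilt_gt0 z : 0 < graph_tilt z.
Proof.
rewrite mulr_gt0 ?invr_gt0 //; last exact: u_gt0.
by apply: future_past_pos => //; [exact: (gauss_unit hN)|exact: (gauss_future hN)].
Qed.

Let omE i z : om i z = - (graph_tilt z * 'D_(e i) graph_height z).
Proof.
rewrite derive_graph_height (proj1 (comps z)) /graph_tilt /graph_height -/(u z) -/(th z).
by field; exact: u_neq0.
Qed.

Lemma graph_tilt_sqr z :
  graph_tilt z ^+ 2 = 1 + graph_tilt z ^+ 2 * \sum_i ('D_(e i) graph_height z) ^+ 2.
Proof.
have E1 : graph_tilt z ^+ 2 = 1 + \sum_i om i z ^+ 2.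
  rewrite /graph_tilt exprMn (proj2 (comps z)) /graph_height -/(u z) exprVn mulrAC.
  by rewrite mulfV ?mul1r // expf_neq0.
rewrite [LHS]E1; congr (1 + _).
by rewrite mulr_sumr; apply: eq_bigr => i _; rewrite omE sqrrN exprMn.
Qed.

(** The mean curvature equation, in divergence form. Pairing the Weingarten
    equation with E_i - z_i a, which is dual to the coordinate frame of the
    graph, gives the trace of the shape operator. *)
Lemma graph_equation z : (0 < n)%N ->
  \sum_i 'D_(e i) (fun z => graph_tilt z * 'D_(e i) graph_height z : R) z =
  n%:R / graph_height z * (graph_tilt z - H).
Proof.
move=> n0; have [A DN HA] := graph_shape frame hpsi hN hH hg z.
have [dth Dth] : differentiable (fun z => th z : R) z /\
    forall v, 'D_v (fun z => th z : R) z = lorentz ('D_v (N \o g) z) a.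
  have [d0 _] := derive_lorentz_cst 0 a (N_diff z); split; first exact: d0.
  by move=> v; have [_ D] := derive_lorentz_cst v a (N_diff z); exact: D.
have DE' i : 'D_(e i) (fun z => graph_tilt z * 'D_(e i) graph_height z : R) z =
    th z - (lorentz ('D_(e i) (N \o g) z) (E i) - z 0 i * lorentz ('D_(e i) (N \o g) z) a).
  have -> : (fun z => graph_tilt z * 'D_(e i) graph_height z : R) =
      (fun z : 'rV[R]_n => z 0 i : R) * (fun z => th z) - (fun z => lorentz ((N \o g) z) (E i) : R).
    by apply/funext => x; rewrite !fctE -[LHS]opprK -omE /om opprB.
  have [dc Dc] := derive_coordinate z (e i) i.
  have [dE DE0] := derive_lorentz_cst (e i) (E i) (N_diff z).
  have dM : derivable ((fun z : 'rV[R]_n => z 0 i : R) * (fun z => th z)) z (e i).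
    by apply: derivableM; exact: diff_derivable.
  have dEd : derivable (fun z => lorentz ((N \o g) z) (E i) : R) z (e i) by exact: diff_derivable.
  rewrite (deriveB dM dEd) DE0.
  rewrite deriveM; [|exact: diff_derivable|exact: diff_derivable].
  rewrite Dc Dth mxE !eqxx /GRing.scale /=; ring.
have PD i v : lorentz ('D_v (psi \o g) z) (E i) - z 0 i * lorentz ('D_v (psi \o g) z) a = v 0 i * u z.
  by rewrite DE addrK.
have term i : 'D_(e i) (fun z => graph_tilt z * 'D_(e i) graph_height z : R) z = th z + A i i * u z.
  have -> : A i i * u z = (e i *m A) 0 i * u z by rewrite -rowE mxE.
  by rewrite -PD DE' DN !lorentzNl; ring.
rewrite (eq_bigr (fun i => th z + A i i * u z)); last by move=> i _; exact: term.
rewrite big_split /= sumr_const card_ord -mulr_suml -/(mxtrace A).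
have -> : \tr A = - (n%:R * H) by rewrite HA mulrN opprK mulrA mulfV ?mul1r // pnatr_eq0 -lt0n.
rewrite /graph_tilt /graph_height -/(u z) -/(th z) -[th z *+ n]mulr_natl invrK.
by field; exact: u_neq0.
Qed.

End GraphEquation.

(** * The mean curvature is one *)

Section MaximumPrinciple.
Context {R : realType}.

Lemma second_derivative_test (f df : R -> R) (c : R) :
  (forall t : R, is_derive t (1 : R) f (df t)) -> is_derive (0 : R) (1 : R) df c ->
  (forall t : R, f t <= f 0) -> df 0 = 0 /\ c <= 0.
Proof.
move=> Hf Hdf fmax.
have df0 : df 0 = 0.
  have H : is_derive (0 : R) (1 : R) f 0.
    apply: (@derive1_at_max R f (-1) 1) => [|t _||t _]; [lra|by case: (Hf t)| |exact: fmax].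
    by rewrite in_itv /= ltrN10 ltr01.
  by have [_ h1] := H; have [_ h2] := Hf 0; rewrite -[LHS]h2.
split=> //; rewrite leNgt; apply/negP => c0.
have [D Dc] := Hdf.
have L : h^-1 *: (df (h *: (1 : R) + 0) - df 0) @[h --> (0 : R)^'] --> c.
  by rewrite -Dc; exact: D.
move/cvgrPdist_lt : L => /(_ c c0) [d /= d0 Hd].
pose t := d / 2.
have t0 : 0 < t by rewrite divr_gt0.
have pos x : 0 < x < d -> 0 < df x.
  move=> /andP[x0 xd].
  have := Hd x; rewrite /= sub0r normrN gtr0_norm // => /(_ xd (lt0r_neq0 x0)).
  rewrite df0 subr0 addr0 /GRing.scale /= mulr1 ltr_norml => /andP[_].
  by rewrite ltrBlDr ltrDl pmulr_rgt0 // invr_gt0.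
have [x xt E] : exists2 x, x \in `]0, t[%R & f t - f 0 = df x * (t - 0).
  apply: MVT => //.
  apply: derivable_within_continuous => x _; by case: (Hf x).
have : 0 < f t - f 0.
  rewrite E subr0 mulr_gt0 //; apply: pos; move: xt; rewrite in_itv /= => /andP[x0 xt].
  by rewrite x0 (lt_trans xt) // ltr_pdivrMr // ltr_pMr // ltr1n.
by rewrite subr_gt0 ltNge fmax.
Qed.

Context {n : nat}.
Local Notation e i := (delta_mx 0 i : 'rV[R]_n).

Lemma derive_sum_coord (W : normedModType R) (f : 'rV[R]_n -> W) z (v : 'rV[R]_n) :
  differentiable f z -> 'D_v f z = \sum_i v 0 i *: 'D_(e i) f z.
Proof.
move=> df; rewrite (deriveE v df) {1}(rV_sum_delta v) linear_sum; apply: eq_bigr => i _.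
by rewrite linearZ (deriveE _ df).
Qed.

(** A bounded function almost attains its supremum at a critical point of
    f - eps |z|^2. *)
Lemma almost_maximum (f : 'rV[R]_n -> R) (m D eps : R) : smooth_on setT f ->
  (forall z, m <= f z <= m + D) -> 0 < eps ->
  exists z, \sum_i ('D_(e i) f z) ^+ 2 <= 4 * eps * D /\
    forall v, 'D_v (fun z => 'D_v f z : R) z <= 2 * eps * \sum_i v 0 i ^+ 2.
Proof.
move=> sf fb eps0.
pose q (z : 'rV[R]_n) : R := \sum_i z 0 i ^+ 2.
have q0 z : 0 <= q z by apply: sumr_ge0 => i _; exact: sqr_ge0.
have qn z : `|z| ^+ 2 <= q z.
  have h : `|z| <= Num.sqrt (q z).
    apply: mx_norm_le => [|i j]; first exact: sqrtr_ge0.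
    rewrite ord1 -sqrtr_sqr; apply: ler_wsqrtr.
    by rewrite /q (bigD1 j) //= lerDl sumr_ge0 // => k _; exact: sqr_ge0.
  have := lerXn2r 2 _ _ h; rewrite !nnegrE => /(_ (normr_ge0 _) (sqrtr_ge0 _)).
  by rewrite sqr_sqrtr.
have D0 : 0 <= D by have /andP[h1 h2] := fb 0; lra.
pose F z := f z - eps * q z.
(* Outside the ball of radius r the penalty exceeds the oscillation D of f. *)
pose r := (D + 1) / eps + 1.
have De0 : 0 <= (D + 1) / eps by rewrite divr_ge0 // ?addr_ge0 // ltW.
have r1 : 1 <= r by rewrite lerDr.
have cq : smooth_on setT q.
  move=> k; apply: Ck_sum => [|i]; first exact: openT.
  apply: (@Ck_ext _ _ _ _ setT (fun z : 'rV[R]_n => z 0 i * z 0 i)); [exact: openT|by move=> z _; rewrite expr2|].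
  by apply: CkM; [exact: openT|exact: Ck_coord openT|exact: Ck_coord openT].
have cF : continuous F.
  have cF0 : Ck 0 setT (fun z => f z + (- eps) * q z : R).
    apply: CkD; [exact: openT|exact: (sf 0)|].
    by apply: CkM; [exact: openT|exact: Ck_cst|exact: (cq 0)].
  have -> : F = (fun z => f z + (- eps) * q z : R).
    by apply/funext => z; rewrite mulNr.
  by move=> z; exact: cF0.
pose B := [set z : 'rV[R]_n | `|z| <= r].
have B0 : B 0 by rewrite /B /= normr0 (le_trans ler01).
have cB : compact B.
  apply: bounded_closed_compact.
    exists r; split=> [|x rx z /= zr]; first exact: num_real.
    exact: le_trans zr (ltW rx).
  apply: (@preimage_closed _ _ (fun v : 'rV[R]_n => `|v|) [set x | x <= r]); last exact: closed_le.
  by move=> v _; exact: norm_continuous.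
have [z0 Bz0 Hz0] := @EVT_max_rV R n F B (ex_intro _ 0 B0) cB (continuous_subspaceT cF).
have F00 : F 0 = f 0.
  by rewrite /F /q big1 ?mulr0 ?subr0 // => i _; rewrite mxE expr0n.
have Fmax z : F z <= F z0.
  have [zr|zr] := leP `|z| r; first by apply: Hz0; rewrite inE.
  apply: (@le_trans _ _ (F 0)); last by apply: Hz0; rewrite inE.
  rewrite F00 /F; have /andP[h1 h2] := fb 0; have /andP[h3 h4] := fb z.
  have : D + 1 <= eps * q z.
    have rq : r <= q z.
      apply: le_trans (qn z); rewrite expr2; apply: (le_trans (ltW zr)).
      by rewrite ler_peMl // (le_trans r1) // ltW.
    have : eps * r <= eps * q z by rewrite ler_pM2l.
    have -> : eps * r = (D + 1) + eps by rewrite /r mulrDr mulr1 mulrC divfK // gt_eqF.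
    lra.
  lra.
have crit v : 'D_v f z0 = 2 * eps * \sum_i z0 0 i * v 0 i /\
    'D_v (fun z => 'D_v f z : R) z0 <= 2 * eps * \sum_i v 0 i ^+ 2.
  have [df Df] := sf 2.
  have [ddf _] := Df v.
  pose l (t : R) := z0 + t *: v.
  pose phi (t : R) := f (l t) - eps * q (l t).
  pose dphi (t : R) := 'D_v f (l t) - 2 * eps * (\sum_i z0 0 i * v 0 i + t * \sum_i v 0 i ^+ 2).
  have qE t : q (l t) = q z0 + 2 * t * (\sum_i z0 0 i * v 0 i) + t ^+ 2 * \sum_i v 0 i ^+ 2.
    rewrite /q !mulr_sumr -!big_split; apply: eq_bigr => i _.
    by rewrite !mxE /=; ring.
  set zv := \sum_i z0 0 i * v 0 i in dphi qE *.
  set v2 := \sum_i v 0 i ^+ 2 in dphi qE *.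
  have v20 : 0 <= v2 by apply: sumr_ge0 => i _; exact: sqr_ge0.
  have Hphi (t : R) : is_derive t (1 : R) phi (dphi t).
    have d1 := is_derive_line (df (l t) I).
    have d2 : is_derive t (1 : R) (fun t : R => eps * q (l t)) (2 * eps * (zv + t * v2)).
      apply: (@is_derive_quadratic _ _ _ _ (eps * v2)) => h.
      rewrite !qE; set X := (X in `|X|).
      have -> : X = eps * v2 * h ^+ 2 by rewrite /X; ring.
      by rewrite ger0_norm // mulr_ge0 ?sqr_ge0 // mulr_ge0 // ltW.
    exact: (is_deriveB d1 d2).
  have Hdphi : is_derive (0 : R) (1 : R) dphi ('D_v (fun z => 'D_v f z : R) z0 - 2 * eps * v2).
    have d1 := is_derive_line (ddf (l 0) I).
    have d2 : is_derive (0 : R) (1 : R) (fun t : R => 2 * eps * (zv + t * v2)) (2 * eps * v2).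
      apply: (@is_derive_quadratic _ _ _ _ 0) => h.
      set X := (X in `|X|); have -> : X = 0 by rewrite /X; ring.
      by rewrite normr0 mul0r.
    have := is_deriveB d1 d2; rewrite /l scale0r addr0; exact.
  have phimax (t : R) : phi t <= phi 0.
    by have := Fmax (l t); rewrite /phi /F /l scale0r addr0.
  have [E1 E2] := second_derivative_test Hphi Hdphi phimax.
  move: E1; rewrite /dphi /l scale0r addr0 mul0r addr0 => /subr0_eq E1.
  by split; [exact: E1|lra].
exists z0; split; last by move=> v; case: (crit v).
have De i : 'D_(e i) f z0 = 2 * eps * z0 0 i.
  have [-> _] := crit (e i); congr (_ * _).
  rewrite (bigD1 i) //= mxE !eqxx mulr1 big1 ?addr0 // => j ji.
  by rewrite mxE eqxx (negPf ji) mulr0.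
have -> : \sum_i ('D_(e i) f z0) ^+ 2 = 4 * eps * (eps * q z0).
  by rewrite /q !mulr_sumr; apply: eq_bigr => i _; rewrite De; ring.
have := Fmax 0; rewrite F00 /F => h; have /andP[h1 h2] := fb 0; have /andP[h3 h4] := fb z0.
by apply: ler_wpM2l; [rewrite mulr_ge0 // ltW|lra].
Qed.

End MaximumPrinciple.

Section MeanCurvatureEquation.
Context {R : realType} {n : nat}.
Local Notation e i := (delta_mx 0 i : 'rV[R]_n).
Variables (f w : 'rV[R]_n -> R) (H t1 t2 : R).
Hypotheses (n0 : (0 < n)%N) (sf : smooth_on setT f) (sw : smooth_on setT w).
Hypotheses (t10 : 0 < t1) (fb : forall z, t1 <= f z <= t2) (w0 : forall z, 0 < w z).
Hypothesis wE : forall z, w z ^+ 2 = 1 + w z ^+ 2 * \sum_i ('D_(e i) f z) ^+ 2.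
Hypothesis eqn : forall z, \sum_i 'D_(e i) (fun z => w z * 'D_(e i) f z : R) z =
  n%:R / f z * (w z - H).

Lemma tilt_ge1 z : 1 <= w z.
Proof.
rewrite -(@ler_pXn2r _ 2) ?nnegrE ?(ltW (w0 z)) // expr1n wE lerDl.
by rewrite mulr_ge0 ?sqr_ge0 // sumr_ge0 // => i _; exact: sqr_ge0.
Qed.

Lemma equation_expanded z (v := (\row_i 'D_(e i) f z : 'rV[R]_n)) :
  w z * (\sum_i 'D_(e i) (fun z => 'D_(e i) f z : R) z) +
  w z ^+ 3 * 'D_v (fun z => 'D_v f z : R) z = n%:R / f z * (w z - H).
Proof.
rewrite -eqn.
have [df Df] := sf 2; have [dw _] := sw 1.
have ddf u : differentiable (fun z => 'D_u f z : R) z by have [h _] := Df u; exact: h.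
pose p i := 'D_(e i) f z.
have DM i : 'D_(e i) (fun z => w z * 'D_(e i) f z : R) z =
    w z * 'D_(e i) (fun z => 'D_(e i) f z : R) z + p i * 'D_(e i) w z.
  by rewrite deriveM //; apply: diff_derivable => //; exact: dw.
rewrite (eq_bigr _ (fun i _ => DM i)) big_split /= -mulr_sumr; congr (_ + _).
pose S x := \sum_k ('D_(e k) f x) ^+ 2.
have dS u : derivable (fun x => S x : R) z u /\
    'D_u (fun x => S x : R) z = \sum_k 2 * p k * 'D_u (fun z => 'D_(e k) f z : R) z.
  have -> : (fun x => S x : R) = \sum_k (fun x => 'D_(e k) f x : R) ^+ 2.
    by apply/funext => x; rewrite fct_sumE /S.
  have dk k : derivable ((fun x => 'D_(e k) f x : R) ^+ 2) z u.
    by apply: derivableX; exact: diff_derivable.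
  split; first exact: derivable_sum.
  rewrite derive_sum; last exact: dk.
  apply: eq_bigr => k _; rewrite deriveX; last exact: diff_derivable.
  by rewrite /= expr1.
have dwz u : derivable w z u by exact/diff_derivable/dw.
have Dw u : 'D_u w z = w z ^+ 3 * \sum_k p k * 'D_u (fun z => 'D_(e k) f z : R) z.
  have [dSu DSu] := dS u.
  pose ww : 'rV[R]_n -> R := w * w.
  have dwzu := dwz u.
  have dww : derivable ww z u by exact: (derivableM dwzu dwzu).
  have Dww : 'D_u ww z = 2 * w z * 'D_u w z.
    by rewrite /ww (deriveM dwzu dwzu) /GRing.scale /=; ring.
  have E1 : 'D_u ww z = ww z * 'D_u (fun x => S x : R) z + S z * 'D_u ww z.
    have E0 : ww = cst (1 : R) + ww * (fun x => S x : R).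
      by apply/funext => x; rewrite /ww !fctE -expr2; exact: wE.
    rewrite [in LHS]E0 (deriveD (derivable_cst (1 : R) z u) (derivableM dww dSu)).
    by rewrite derive_cst add0r (deriveM dww dSu).
  rewrite Dww DSu in E1.
  set Q := \sum_k p k * _.
  have SQ : \sum_k 2 * p k * 'D_u (fun z => 'D_(e k) f z : R) z = 2 * Q.
    by rewrite /Q mulr_sumr; apply: eq_bigr => k _; rewrite mulrA.
  have wwE : ww z = w z ^+ 2 by rewrite expr2.
  rewrite SQ wwE in E1.
  have E2 : w z ^+ 2 * (1 - S z) = 1.
    by rewrite mulrBr mulr1 [X in X - _]wE -/(S z) addrK.
  have wn0 : w z != 0 by rewrite gt_eqF.
  have E3 : 2 * w z * (1 - S z) * 'D_u w z = 2 * w z ^+ 2 * Q by move: E1; lra.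
  apply: (mulfI (_ : 2 != 0)) => //.
  have -> : 2 * 'D_u w z = w z * (2 * w z * (1 - S z) * 'D_u w z).
    transitivity (2 * (w z ^+ 2 * (1 - S z)) * 'D_u w z); last by ring.
    by rewrite E2; ring.
  by rewrite E3; ring.
rewrite (eq_bigr _ (fun i _ => congr1 (fun t => p i * t) (Dw (e i)))).
have vE i : v 0 i = p i by rewrite mxE.
have DDv (x : 'rV[R]_n) : 'D_x (fun z => 'D_x f z : R) z =
    \sum_i x 0 i * \sum_k x 0 k * 'D_(e i) (fun z => 'D_(e k) f z : R) z.
  rewrite (derive_sum_coord x (ddf x)); apply: eq_bigr => i _; congr (_ * _).
  have -> : (fun z => 'D_x f z : R) = \sum_k (x 0 k \*: (fun z => 'D_(e k) f z : R)).
    by apply/funext => y; rewrite fct_sumE (derive_sum_coord x (df y I)).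
  have dk k : derivable (fun z => 'D_(e k) f z : R) z (e i) by exact: diff_derivable.
  rewrite derive_sum => [|k]; last exact: (derivableZ (dk k)).
  by apply: eq_bigr => k _; exact: (deriveZ (x 0 k) (dk k)).
rewrite DDv mulr_sumr; apply: eq_bigr => i _; rewrite vE [LHS]mulrCA; congr (_ * (_ * _)).
by apply: eq_bigr => k _; rewrite vE.
Qed.

(** The sign s = 1 treats an almost maximum of f and s = -1 an almost minimum; at
    both w is almost one. *)
Lemma near_critical_point (eps : R) (s : R) : s ^+ 2 = 1 -> 0 < eps -> 16 * eps * (t2 - t1) <= 1 ->
  exists z, w z - 1 <= 16 * eps * (t2 - t1) /\
    s * (n%:R / f z * (w z - H)) <= eps * (4 * n%:R + 16).
Proof.
move=> s2 eps0 epsD.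
pose fs z := s * f z.
have s1 : s = 1 \/ s = -1 by move/eqP: s2; rewrite sqrf_eq1 => /orP[]/eqP; [left|right].
have sfs : smooth_on setT fs.
  by move=> k; apply: CkM; [exact: openT|exact: Ck_cst|exact: (sf k)].
have Ds v z : 'D_v fs z = s * 'D_v f z.
  have [df _] := sf 1; have dfz : derivable f z v by exact/diff_derivable/df.
  exact: (deriveZ s dfz).
have DDs v z : 'D_v (fun z => 'D_v fs z : R) z = s * 'D_v (fun z => 'D_v f z : R) z.
  have -> : (fun z => 'D_v fs z : R) = s *: (fun z => 'D_v f z : R).
    by apply/funext => x; rewrite Ds.
  have [_ Df] := sf 2; have [ddf _] := Df v.
  have dfz : derivable (fun z => 'D_v f z : R) z v by exact/diff_derivable/ddf.
  exact: (deriveZ s dfz).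
have fsb : exists m, forall z, m <= fs z <= m + (t2 - t1).
  case: s1 => E; [exists t1|exists (- t2)] => z; rewrite /fs E; have /andP[h1 h2] := fb z;
    by apply/andP; split; lra.
have [m Hm] := fsb; have [z [Hz1 Hz2]] := almost_maximum sfs Hm eps0.
have Sz : \sum_i ('D_(e i) f z) ^+ 2 <= 4 * eps * (t2 - t1).
  apply: le_trans Hz1; apply: ler_sum => i _.
  by rewrite Ds exprMn s2 mul1r.
have w1 := tilt_ge1 z.
set S := \sum_i _ in Sz.
have S0 : 0 <= S by apply: sumr_ge0 => i _; exact: sqr_ge0.
have wS : w z ^+ 2 * (1 - S) = 1 by rewrite mulrBr mulr1 [X in X - _]wE addrK.
have w2 : w z ^+ 2 <= 1 + 4 * S.
  have S4 : S <= 1 / 4 by lra.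
  have w20 : 0 <= w z ^+ 2 by exact: sqr_ge0.
  have : w z ^+ 2 * (1 - 1 / 4) <= w z ^+ 2 * (1 - S) by rewrite ler_wpM2l //; lra.
  rewrite wS => h.
  have : w z ^+ 2 * S <= 4 / 3 * S by rewrite ler_wpM2r //; lra.
  have : w z ^+ 2 = 1 + w z ^+ 2 * S by move: wS; lra.
  lra.
exists z; split.
  have : w z <= w z ^+ 2 by rewrite expr2 ler_peMl // (le_trans _ w1).
  lra.
rewrite -equation_expanded mulrDr.
set v := \row_i _.
have v2 : \sum_i v 0 i ^+ 2 = S by apply: eq_bigr => i _; rewrite mxE.
have wz2 : w z <= 2.
  rewrite -(@ler_pXn2r _ 2) ?nnegrE ?(ltW (w0 z)) //.
  apply: (le_trans w2); have -> : 2 ^+ 2 = 4 :> R by ring.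
  lra.
have T1 : s * (w z * \sum_i 'D_(e i) (fun z => 'D_(e i) f z : R) z) <= eps * (4 * n%:R).
  rewrite mulrCA mulr_sumr.
  have : \sum_i s * 'D_(e i) (fun z => 'D_(e i) f z : R) z <= \sum_(i < n) 2 * eps.
    apply: ler_sum => i _; rewrite -DDs; apply: (le_trans (Hz2 (e i))).
    rewrite (bigD1 i) //= mxE !eqxx expr1n big1 ?addr0 ?mulr1 // => j ji.
    by rewrite mxE eqxx (negPf ji) expr0n.
  have -> : \sum_(i < n) 2 * eps = n%:R * (2 * eps) by rewrite sumr_const card_ord [RHS]mulr_natl.
  move=> h; apply: (@le_trans _ _ (w z * (n%:R * (2 * eps)))).
    by apply: ler_wpM2l => //; exact: ltW.
  have -> : eps * (4 * n%:R) = 2 * (n%:R * (2 * eps)) by ring.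
  by rewrite ler_wpM2r // !mulr_ge0 // ltW.
have T2 : s * (w z ^+ 3 * 'D_v (fun z => 'D_v f z : R) z) <= eps * 16.
  rewrite mulrCA -DDs.
  have w3 : w z ^+ 3 <= 8.
    have -> : 8 = 2 ^+ 3 :> R by ring.
    by apply: lerXn2r => //; rewrite nnegrE ltW.
  have w30 : 0 <= w z ^+ 3 by rewrite exprn_ge0 // ltW.
  have := Hz2 v; rewrite v2 => h.
  apply: (@le_trans _ _ (w z ^+ 3 * (2 * eps * S))); first by rewrite ler_wpM2l.
  apply: (@le_trans _ _ (8 * (2 * eps * 1))); last by have -> : 8 * (2 * eps * 1) = eps * 16 by ring.
  apply: ler_pM => //; first by rewrite !mulr_ge0 // ltW.
  by rewrite ler_wpM2l ?mulr_ge0 ?(ltW eps0) //; lra.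
by rewrite mulrDr; exact: lerD.
Qed.

(** At an almost maximum (minimum) of the height the graph is almost a slice and
    the elliptic part of the equation has a sign; the slices have mean curvature
    one, which pinches H. *)
Theorem mean_curvature_eq1 : H = 1.
Proof.
have D0 : 0 <= t2 - t1 by have /andP[h1 h2] := fb 0; lra.
have t20 : 0 < t2 by have /andP[h1 h2] := fb 0; exact: lt_le_trans t10 (le_trans h1 h2).
have nR0 : (0 : R) < n%:R by rewrite ltr0n.
pose K := (4 * n%:R + 16) * t2 / n%:R.
have K0 : 0 < K.
  by rewrite divr_gt0 // mulr_gt0 // ltr_wpDl // mulr_ge0.
have small (d : R) : 0 < d -> exists eps : R,
    [/\ 0 < eps, 16 * eps * (t2 - t1) <= 1 & eps * K + 16 * eps * (t2 - t1) <= d / 2].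
  move=> d0; have A0 : 0 < K + 16 * (t2 - t1) + 1 by rewrite ltr_wpDl // addr_ge0 ?(ltW K0) // mulr_ge0.
  pose eps := Num.min 1 (d / 2) / (K + 16 * (t2 - t1) + 1).
  have m0 : 0 < Num.min 1 (d / 2) by rewrite lt_min ltr01 divr_gt0.
  have e0 : 0 < eps by rewrite divr_gt0.
  have E : eps * (K + 16 * (t2 - t1) + 1) = Num.min 1 (d / 2) by rewrite divfK // gt_eqF.
  have h1 : eps * (K + 16 * (t2 - t1) + 1) <= 1 by rewrite E ge_min lexx.
  have h2 : eps * (K + 16 * (t2 - t1) + 1) <= d / 2 by rewrite E ge_min lexx orbT.
  have eK : 0 < eps * K by rewrite mulr_gt0.
  have eD : 0 <= eps * (t2 - t1) by rewrite mulr_ge0 // ltW.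
  exists eps; split=> //; move: h1 h2; rewrite !mulrDr; lra.
have bound (eps y : R) z : 0 <= eps -> n%:R / f z * y <= eps * (4 * n%:R + 16) -> y <= eps * K.
  move=> e0; have /andP[h1 h2] := fb z; have fz0 : 0 < f z by exact: lt_le_trans h1.
  rewrite mulrAC ler_pdivrMr // mulrC -ler_pdivlMr // => h; apply: (le_trans h).
  have -> : eps * K = eps * (4 * n%:R + 16) * t2 / n%:R by rewrite /K !mulrA.
  rewrite ler_wpM2r ?invr_ge0 // ler_wpM2l // mulr_ge0 // addr_ge0 // mulr_ge0 //.
apply/eqP; rewrite eq_le; apply/andP; split; rewrite leNgt; apply/negP => HH.
  have d0 : 0 < H - 1 by rewrite subr_gt0.
  have [eps [e0 h1 h2]] := small _ d0.
  have m1 : (-1) ^+ 2 = 1 :> R by ring.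
  have [z [hw hz]] := near_critical_point m1 e0 h1.
  have hz' : n%:R / f z * (H - w z) <= eps * (4 * n%:R + 16) by move: hz; lra.
  by have := bound _ _ _ (ltW e0) hz'; lra.
have d0 : 0 < 1 - H by rewrite subr_gt0.
have [eps [e0 h1 h2]] := small _ d0.
have [z [_ hz]] := near_critical_point (expr1n R 2) e0 h1.
rewrite mul1r in hz.
have := bound _ _ _ (ltW e0) hz; have := tilt_ge1 z.
have : 0 <= 16 * eps * (t2 - t1) by rewrite !mulr_ge0 // ltW.
lra.
Qed.


End MeanCurvatureEquation.

(** * Integrals depending on a parameter *)

Section ParametricIntegrals.
Context {R : realType}.
Local Notation mu := (@lebesgue_measure R).

Definition mk2 (x y : R) : 'rV[R]_2 := \row_i (if i == 0 then x else y).

Lemma mk2_0 x y : mk2 x y 0 0 = x. Proof. by rewrite mxE. Qed.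
Lemma mk2_1 x y : mk2 x y 0 1 = y. Proof. by rewrite mxE. Qed.

Lemma mk2K (z : 'rV[R]_2) : mk2 (z 0 0) (z 0 1) = z.
Proof.
apply/rowP => i; rewrite mxE; case: (i =P 0) => [->//|/eqP ni].
by congr (z 0 _); apply/val_inj; move: ni; rewrite -val_eqE /=; case: i => -[|[|]].
Qed.

Lemma mk2_line_x (x y t : R) : mk2 (x + t) y = mk2 x y + t *: delta_mx 0 0.
Proof.
by apply/rowP => i; rewrite !mxE eqxx /=; case: (i == 0); rewrite ?mulr1 ?mulr0 ?addr0.
Qed.

Lemma mk2_line_y (x y t : R) : mk2 x (y + t) = mk2 x y + t *: delta_mx 0 1.
Proof.
apply/rowP => i; rewrite !mxE eqxx /=; case: (i =P 0) => [->|/eqP ni].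
  by rewrite mulr0 addr0.
have -> : i = 1 by apply/val_inj; move: ni; rewrite -val_eqE /=; case: i => -[|[|]].
by rewrite eqxx mulr1.
Qed.

Lemma mk2_continuous_x y : continuous (mk2^~ y).
Proof.
have -> : mk2^~ y = (fun t => mk2 0 y + t *: delta_mx 0 0).
  by apply/funext => t; rewrite -mk2_line_x add0r.
exact: line_continuous.
Qed.

Lemma mk2_continuous_y x : continuous (mk2 x).
Proof.
have -> : mk2 x = (fun t => mk2 x 0 + t *: delta_mx 0 1).
  by apply/funext => t; rewrite -mk2_line_y add0r.
exact: line_continuous.
Qed.

Definition jointly_continuous (f : R -> R -> R) : Prop :=
  continuous (fun w : 'rV[R]_2 => f (w 0 0) (w 0 1)).

Lemma jointly_continuous_y f x : jointly_continuous f -> continuous (f x).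
Proof.
move=> cf y; have -> : f x = (fun w : 'rV[R]_2 => f (w 0 0) (w 0 1)) \o mk2 x.
  by apply/funext => t /=; rewrite mk2_0 mk2_1.
by apply: continuous_comp; [exact: mk2_continuous_y|exact: cf].
Qed.

Lemma jointly_continuous_x f y : jointly_continuous f -> continuous (f^~ y).
Proof.
move=> cf x; have -> : f^~ y = (fun w : 'rV[R]_2 => f (w 0 0) (w 0 1)) \o mk2^~ y.
  by apply/funext => t /=; rewrite mk2_0 mk2_1.
by apply: continuous_comp; [exact: mk2_continuous_x|exact: cf].
Qed.

Lemma bounded_on_ball m (F : 'rV[R]_m -> R) (r : R) : continuous F ->
  exists2 C : R, 0 <= C & forall w, `|w| <= r -> `|F w| <= C.
Proof.
move=> cF; pose B := [set w : 'rV[R]_m | `|w| <= r].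
have cB : compact B.
  apply: bounded_closed_compact.
    exists r; split=> [|x rx z /= zr]; first exact: num_real.
    exact: le_trans zr (ltW rx).
  apply: (@preimage_closed _ _ (fun v : 'rV[R]_m => `|v|) [set x | x <= r]); last exact: closed_le.
  by move=> v _; exact: norm_continuous.
have [[w0 Bw0]|nB] := pselect (B !=set0); last first.
  by exists 0 => // w wr; exfalso; apply: nB; exists w.
have [w1 _ H1] := EVT_max_rV (ex_intro _ w0 Bw0) cB (continuous_subspaceT cF).
have [w2 _ H2] := EVT_min_rV (ex_intro _ w0 Bw0) cB (continuous_subspaceT cF).
exists (`|F w1| + `|F w2|); first by rewrite addr_ge0.
move=> w wr; have Bw : w \in B by rewrite inE.
have h1 := H1 w Bw; have h2 := H2 w Bw.
have h3 := ler_norm (F w1); have h4 : - `|F w2| <= F w2 by rewrite lerNl -normrN ler_norm.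
have n1 := normr_ge0 (F w1); have n2 := normr_ge0 (F w2).
by rewrite ler_norml; apply/andP; split; lra.
Qed.

Lemma jointly_continuous_bounded f (a c d : R) : jointly_continuous f ->
  exists2 C : R, 0 <= C & forall x y, a - 1 < x < a + 1 -> c <= y <= d -> `|f x y| <= C.
Proof.
move=> /(bounded_on_ball (`|a| + 1 + `|c| + `|d|))[C C0 HC]; exists C => // x y xI yI.
have := HC (mk2 x y); rewrite mk2_0 mk2_1; apply.
have na := normr_ge0 a; have nc := normr_ge0 c; have nd := normr_ge0 d.
apply: mx_norm_le => [|i j]; first by rewrite !addr_ge0.
rewrite mxE; case: ifP => _.
  move: xI => /andP[x1 x2]; have h := ler_norm a; have h' := ler_norm (- a).
  rewrite normrN in h'; rewrite ler_norml; apply/andP; split; lra.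
move: yI => /andP[y1 y2]; have h := ler_norm d; have h' := ler_norm (- c).
rewrite normrN in h'; rewrite ler_norml; apply/andP; split; lra.
Qed.

Lemma continuous_integrable (f : R -> R) (c d : R) : continuous f ->
  mu.-integrable `[c, d] (EFin \o f).
Proof.
move=> cf; apply: continuous_compact_integrable; first exact: segment_compact.
exact: continuous_subspaceT.
Qed.

Lemma param_continuous f (c d : R) : jointly_continuous f ->
  continuous (fun x => Rintegral mu `[c, d] (f x)).
Proof.
move=> cf a; have [C C0 HC] := jointly_continuous_bounded a c d cf.
have aI : a \in `](a - 1), (a + 1)[%classic.
  by rewrite inE /= in_itv /= ltrBlDr ltrDl ltr01.
apply: (@continuity_under_integral R _ _ mu f `[c, d] _ (a - 1) (a + 1) _ _ (cst C) _ _ a aI).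
- exact: measurable_itv.
- by move=> x _; apply: continuous_integrable; exact: jointly_continuous_y.
- by apply/aeW => y _ x _; exact: jointly_continuous_x.
- by apply: continuous_integrable; exact: cst_continuous.
- move=> x xI; apply/aeW => y yB; apply: HC.
    by move: xI; rewrite /= in_itv.
  by move: yB; rewrite /= in_itv.
Qed.

(** Differentiation under the integral sign; joint continuity of the derivative
    on a compact rectangle supplies the dominating constant. *)
Lemma param_derive f df (c d : R) (a : R) :
  (forall x y, is_derive x (1 : R) (f^~ y) (df x y)) ->
  jointly_continuous f -> jointly_continuous df ->
  is_derive a (1 : R) (fun x => Rintegral mu `[c, d] (f x)) (Rintegral mu `[c, d] (df a)).
Proof.
move=> Hf cf cdf; have [C C0 HC] := jointly_continuous_bounded a c d cdf.
have aI : `](a - 1), (a + 1)[%classic a.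
  by rewrite /= in_itv /= ltrBlDr ltrDl ltr01.
have pE x y : partial1of2 f x y = df x y.
  by rewrite partial1of2E; case: (Hf x y).
have h1 x : `](a - 1), (a + 1)[%classic x -> mu.-integrable `[c, d] (EFin \o f x).
  by move=> _; apply: continuous_integrable; exact: jointly_continuous_y.
have h2 (x y : R) : `](a - 1), (a + 1)[%classic x -> `[c, d]%classic y -> derivable (f^~ y) x 1.
  by move=> _ _; case: (Hf x y).
have h3 : mu.-integrable `[c, d] (EFin \o cst C).
  by apply: continuous_integrable; exact: cst_continuous.
have h4 (x y : R) : `](a - 1), (a + 1)[%classic x -> `[c, d]%classic y -> `|partial1of2 f x y| <= cst C y.
  by move=> xI yI; rewrite pE; apply: HC; [move: xI|move: yI]; rewrite /= in_itv.
have mB : measurable (`[c, d]%classic : set (measurableTypeR R)) by exact: measurable_itv.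
apply: DeriveDef.
  exact: (@derivable_under_integral R _ _ mu f `[c, d] mB a (a - 1) (a + 1) aI h1 h2 (cst C) (fun _ => C0) h3 h4).
rewrite -derive1E (@differentiation_under_integral R _ _ mu f `[c, d] mB a (a - 1) (a + 1) aI h1 h2 (cst C) (fun _ => C0) h3 h4).
by congr (Rintegral mu _ _); apply/funext => y; exact: pE.
Qed.

Lemma FTC (F f : R -> R) (c d : R) : c < d ->
  (forall x : R, is_derive x (1 : R) F (f x)) -> continuous f ->
  Rintegral mu `[c, d] f = F d - F c.
Proof.
move=> cd HF cf; rewrite /Rintegral (@continuous_FTC2 _ f F) //.
- exact: continuous_subspaceT.
- have cF : continuous F.
    by move=> x; apply/differentiable_continuous/derivable1_diffP; case: (HF x).
  split=> [x _||]; first by case: (HF x).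
    by apply: cvg_at_right_filter; exact: cF.
  by apply: cvg_at_left_filter; exact: cF.
- by move=> x _; rewrite derive1E; case: (HF x).
Qed.

Lemma integral_le_cont (f g : R -> R) (c d : R) : continuous f -> continuous g ->
  (forall x, c <= x <= d -> f x <= g x) ->
  Rintegral mu `[c, d] f <= Rintegral mu `[c, d] g.
Proof.
move=> cf cg H; have := @le_Rintegral _ _ R mu `[c, d] f g (measurable_itv _)
  (continuous_integrable c d cf) (continuous_integrable c d cg).
by apply=> x; rewrite /= in_itv; exact: H.
Qed.

Lemma integralD_cont (f g : R -> R) (c d : R) : continuous f -> continuous g ->
  Rintegral mu `[c, d] (fun x => f x + g x) = Rintegral mu `[c, d] f + Rintegral mu `[c, d] g.
Proof. by move=> cf cg; rewrite RintegralD //; exact: continuous_integrable. Qed.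

Lemma integralZ_cont (f : R -> R) (k c d : R) : continuous f ->
  Rintegral mu `[c, d] (fun x => k * f x) = k * Rintegral mu `[c, d] f.
Proof. by move=> cf; rewrite RintegralZl //; exact: continuous_integrable. Qed.

Lemma segment_integral_cst (k c d : R) : c <= d -> Rintegral mu `[c, d] (cst k) = k * (d - c).
Proof.
move=> cd; rewrite Rintegral_cst; last exact: measurable_itv.
have mI : mu [set` `[c, d]] = (d - c)%:E.
  rewrite lebesgue_measure_itv /= lte_fin; case: ltP => [//|dc].
  have -> : c = d by apply/eqP; rewrite eq_le cd dc.
  by rewrite subrr.
by have -> : fine (mu `[c, d]) = d - c by rewrite [X in fine X]mI.
Qed.

Lemma integral_support (f : R -> R) (c d c' d' : R) : c' <= c -> d <= d' ->
  (forall x, c' <= x <= d' -> ~~ (c <= x <= d) -> f x = 0) ->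
  Rintegral mu `[c', d'] f = Rintegral mu `[c, d] f.
Proof.
move=> cc dd H; rewrite Rintegral_mkcond [RHS]Rintegral_mkcond.
congr (Rintegral mu _ _); apply/funext => x; rewrite !patchE.
have mE (u v : R) : (x \in `[u, v]%classic) = (u <= x <= v).
  by apply/idP/idP; rewrite inE /= in_itv.
rewrite !mE; case: ifPn => [h|h]; case: ifPn => [h'|h'] //; first exact: H.
move: h' => /andP[h1 h2]; exfalso; move/negP: h; apply.
by rewrite (le_trans cc) // (le_trans h2).
Qed.

Lemma integral_sub_le (f : R -> R) (c d c' d' : R) : continuous f -> c' <= c -> d <= d' ->
  (forall x, 0 <= f x) ->
  Rintegral mu `[c, d] f <= Rintegral mu `[c', d'] f.
Proof.
move=> cf cc dd f0.
have fin c0 d0 : (\int[mu]_(x in `[c0, d0]) (f x)%:E)%E \is a fin_num.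
  by apply: integrable_fin_num => //; exact: continuous_integrable.
rewrite /Rintegral; apply: fine_le => //.
apply: ge0_subset_integral => //.
- have /integrableP[] := continuous_integrable c' d' cf; exact.
- by move=> x _; rewrite lee_fin.
- by move=> x /=; rewrite !in_itv /= => /andP[h1 h2]; rewrite (le_trans cc) // (le_trans h2).
Qed.

End ParametricIntegrals.

(** * Closed one-forms and their primitives *)

Section DerivationRules.
Context {R : realType} {V : normedModType R}.
Implicit Types (F G : V -> R) (z v : V).

Lemma derive_inv F z v : F z != 0 -> differentiable F z ->
  'D_v (fun x => (F x)^-1 : R) z = - 'D_v F z / F z ^+ 2.
Proof.
move=> Fz dF; have hF : derivable F z v by exact: diff_derivable.
by rewrite (deriveV Fz hF) /GRing.scale /= mulNr mulrC mulNr.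
Qed.

Lemma derive_scalar_comp (phi : R -> R) c F z v : differentiable F z ->
  is_derive (F z) (1 : R) phi c ->
  differentiable (fun x => phi (F x) : R) z /\ 'D_v (fun x => phi (F x) : R) z = c * 'D_v F z.
Proof.
move=> dF [dphi Dphi]; have dp : differentiable phi (F z) by exact/derivable1_diffP.
have dc := differentiable_comp dF dp; split; first exact: dc.
rewrite (deriveE v dc) (diff_comp dF dp) /= (deriveE v dF).
have E1 : 'd phi (F z) 1 = c by rewrite -(deriveE _ dp) Dphi.
transitivity ('d phi (F z) ('d F z v *: 1)); first by rewrite /GRing.scale /= mulr1.
by rewrite linearZ E1 /GRing.scale /= mulrC.
Qed.

Lemma Ck1_comp (phi dphi : R -> R) F : Ck 1 setT F ->
  (forall x, is_derive (F x) (1 : R) phi (dphi (F x))) ->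
  Ck 0 setT (fun x => dphi (F x) : R) -> Ck 1 setT (fun x => phi (F x) : R).
Proof.
move=> [dF DF] Hphi c1; split=> [x _|v].
  by case: (derive_scalar_comp 0 (dF x I) (Hphi x)).
apply: (Ck_ext openT _ (CkM openT c1 (DF v))) => x _.
by case: (derive_scalar_comp v (dF x I) (Hphi x)) => _ ->.
Qed.

End DerivationRules.

Section Schwarz.
Context {R : realType} {V : normedModType R}.

(** The mean value theorem applied twice to the mixed second difference, which is
    symmetric in u and v. *)
Lemma second_difference (f : V -> R) (u v z : V) (h : R) : smooth_on setT f -> 0 < h ->
  exists s t : R, [/\ 0 < s < h, 0 < t < h &
    f (z + h *: u + h *: v) - f (z + h *: u) - f (z + h *: v) + f z =
      h ^+ 2 * 'D_u (fun x => 'D_v f x : R) (z + s *: v + t *: u)].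
Proof.
move=> sf h0; have [df Df] := sf 2; have [ddf _] := Df v.
pose g (s : R) := f (z + h *: u + s *: v) - f (z + s *: v).
pose dg (s : R) := 'D_v f (z + h *: u + s *: v) - 'D_v f (z + s *: v).
have Hg (s : R) : is_derive s (1 : R) g (dg s).
  exact: (is_deriveB (is_derive_line (df _ I)) (is_derive_line (df _ I))).
have [s sI Es] : exists2 s, s \in `]0, h[%R & g h - g 0 = dg s * (h - 0).
  by apply: MVT => //; apply: derivable_within_continuous => x _; case: (Hg x).
pose k (t : R) := 'D_v f (z + s *: v + t *: u).
have Hk (t : R) : is_derive t (1 : R) k ('D_u (fun x => 'D_v f x : R) (z + s *: v + t *: u)).
  exact: (is_derive_line (ddf _ I)).
have [t tI Et] : exists2 t, t \in `]0, h[%R &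
    k h - k 0 = 'D_u (fun x => 'D_v f x : R) (z + s *: v + t *: u) * (h - 0).
  by apply: MVT => //; apply: derivable_within_continuous => x _; case: (Hk x).
exists s, t; split; [by move: sI; rewrite in_itv|by move: tI; rewrite in_itv|].
move: Es Et; rewrite /g /dg /k !scale0r !addr0 !subr0 [z + s *: v + h *: u]addrAC => Es Et.
rewrite Et in Es.
transitivity (f (z + h *: u + h *: v) - f (z + h *: v) - (f (z + h *: u) - f z)); first by ring.
by rewrite Es; ring.
Qed.

(** Schwarz's theorem: both mixed derivatives are limits of the same second
    difference quotient. *)
Lemma derive_sym (f : V -> R) (u v z : V) : smooth_on setT f ->
  'D_u (fun x => 'D_v f x : R) z = 'D_v (fun x => 'D_u f x : R) z.
Proof.
move=> sf; pose A x := 'D_u (fun x => 'D_v f x : R) x.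
pose B x := 'D_v (fun x => 'D_u f x : R) x.
have cA : {for z, continuous A} by have [_ D] := sf 2; have [_ /(_ u) H] := D v; exact: (H z I).
have cB : {for z, continuous B} by have [_ D] := sf 2; have [_ /(_ v) H] := D u; exact: (H z I).
apply/eqP; rewrite -subr_eq0 -normr_le0 leNgt; apply/negP => e0.
rewrite -/(A z) -/(B z) in e0; set e := `|A z - B z| in e0.
have EA x : A x = 'D_u (fun x => 'D_v f x : R) x := erefl.
have EB x : B x = 'D_v (fun x => 'D_u f x : R) x := erefl.
clearbody A B.
have e20 : 0 < e / 2 by rewrite divr_gt0.
have nA : nbhs z [set x | `|A z - A x| < e / 2] by move: cA => /cvgrPdist_lt/(_ _ e20) H; exact: H.
have nB : nbhs z [set x | `|B z - B x| < e / 2] by move: cB => /cvgrPdist_lt/(_ _ e20) H; exact: H.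
have nAB : nbhs z ([set x | `|A z - A x| < e / 2] `&` [set x | `|B z - B x| < e / 2]) by exact: filterI.
move: nAB => /nbhs_ballP [r /= r0 Hr].
(* So small that the whole parallelogram spanned by h u and h v lies in the ball. *)
pose h := r / (`|u| + `|v| + 1).
have D0 : 0 < `|u| + `|v| + 1 by rewrite ltr_wpDl // addr_ge0.
have h0 : 0 < h by rewrite divr_gt0.
have inb (s t : R) x y : `|x| + `|y| < `|u| + `|v| + 1 -> 0 < s < h -> 0 < t < h ->
    ball z r (z + s *: x + t *: y).
  move=> xy /andP[s0 sh] /andP[t0 th]; rewrite -ball_normE /=.
  rewrite -addrA opprD addrA subrr sub0r normrN (le_lt_trans (ler_normD _ _)) //.
  rewrite !normrZ !gtr0_norm //.
  apply: (@le_lt_trans _ _ (h * (`|x| + `|y|))).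
    by rewrite mulrDr; apply: lerD; rewrite ler_wpM2r // ltW.
  have -> : r = h * (`|u| + `|v| + 1) by rewrite /h divfK // gt_eqF.
  by rewrite ltr_pM2l.
have [s [t [sI tI E1]]] := second_difference u v z sf h0.
have [s' [t' [sI' tI' E2]]] := second_difference v u z sf h0.
have vu : `|v| + `|u| < `|u| + `|v| + 1 by rewrite [X in X < _]addrC ltrDl.
have uv : `|u| + `|v| < `|u| + `|v| + 1 by rewrite ltrDl.
have Ha := Hr _ (inb s t v u vu sI tI); have Hb := Hr _ (inb s' t' u v uv sI' tI').
have AB : A (z + s *: v + t *: u) = B (z + s' *: u + t' *: v).
  have h2 : h ^+ 2 != 0 by rewrite expf_neq0 // gt_eqF.
  apply: (mulfI h2); rewrite EA EB; apply: (etrans (esym E1)); apply: (etrans _ E2).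
  by rewrite [z + h *: v + h *: u]addrAC; ring.
move: Ha Hb => [/= Ha _] [_ /= Hb].
have : e <= `|A z - A (z + s *: v + t *: u)| + `|A (z + s *: v + t *: u) - B z|.
  by rewrite /e -[A z - B z](subrKA (A (z + s *: v + t *: u))) ler_normD.
rewrite {2}AB [X in _ + X]distrC; move: Ha Hb (splitr e); clear; lra.
Qed.

End Schwarz.

Section Poincare.
Context {R : realType} {n : nat}.
Local Notation e i := (delta_mx 0 i : 'rV[R]_n).
Local Notation mu := (@lebesgue_measure R).

(** Differentiability follows from the continuity of the candidate gradient P by
    the mean value theorem on segments. *)
Lemma gradient_differentiable (F : 'rV[R]_n -> R) (P : 'I_n -> 'rV[R]_n -> R) :
  (forall i, Ck 0 setT (P i)) -> (forall z v, is_derive z v F (\sum_i v 0 i * P i z)) ->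
  forall z, differentiable F z.
Proof.
move=> cP HF z.
pose L (h : 'rV[R]_n) : R := \sum_i h 0 i * P i z.
have Llin : linear L.
  move=> k x y; rewrite /L /GRing.scale /= mulr_sumr -big_split; apply: eq_bigr => i _.
  by rewrite !mxE /=; ring.
pose Lm := GRing.isLinear.Build _ _ _ _ L Llin.
pose LL : {linear 'rV[R]_n -> R} := HB.pack L Lm.
have cL : continuous LL.
  have H : Ck 0 setT (L : 'rV[R]_n -> R).
    apply: Ck_sum => [|i]; first exact: openT.
    by apply: CkM; [exact: openT|exact: Ck_coord openT|exact: Ck_cst].
  by move=> x; exact: (H x I).
suff H : forall ep : R, 0 < ep -> \forall h \near (0 : 'rV[R]_n), `|F (h + z) - F z - LL h| <= ep * `|h|.
  by case: (differentiableI cL H).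
move=> ep ep0.
pose d := ep / (n%:R + 1).
have n10 : 0 < n%:R + 1 :> R by rewrite ltr_wpDl.
have d0 : 0 < d by rewrite divr_gt0.
have N1 : nbhs z [set x | forall i, `|P i z - P i x| <= d].
  apply: (@filter_forall _ _ (fun (i : 'I_n) (x : 'rV[R]_n) => `|P i z - P i x| <= d : Prop) (nbhs z) (nbhs_filter z)) => i.
  by have /cvgrPdist_le/(_ d d0) := cP i z I.
move: N1 => /nbhs_ballP [r /= r0 Hr].
have N0 : nbhs (0 : 'rV[R]_n) (ball 0 r) by exact: nbhsx_ballx.
apply: filterS N0 => h; rewrite -ball_normE /= sub0r normrN => hr.
pose g (t : R) := F (z + t *: h).
have Hg (t : R) : is_derive t (1 : R) g (\sum_i h 0 i * P i (z + t *: h)).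
  have [D1 D2] := HF (z + t *: h) h.
  have E : (fun s : R => s^-1 *: (g (s *: (1 : R) + t) - g t)) = (fun s : R => s^-1 *: (F (s *: h + (z + t *: h)) - F (z + t *: h))).
    apply/funext => s; rewrite /g; congr (_ *: (F _ - _)).
    by rewrite scalerDl /GRing.scale /= mulr1 addrCA.
  by apply: DeriveDef; [rewrite /derivable; rewrite E; exact: D1|rewrite -D2 /derive E].
have [t tI E] : exists2 t, t \in `]0, 1[%R & g 1 - g 0 = (\sum_i h 0 i * P i (z + t *: h)) * (1 - 0).
  by apply: MVT => //; apply: derivable_within_continuous => x _; case: (Hg x).
move: E; rewrite /g scale1r scale0r addr0 subr0 mulr1 [z + h]addrC => ->.
move: tI; rewrite in_itv /= => /andP[t0 t1].
have Bt : ball z r (z + t *: h).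
  rewrite -ball_normE /= opprD addrA subrr sub0r normrN normrZ gtr0_norm //.
  by apply: le_lt_trans hr; rewrite ler_piMl // ltW.
have HP := Hr _ Bt.
rewrite /LL /= /L -sumrB (le_trans (ler_norm_sum _ _ _)) //.
apply: (@le_trans _ _ (\sum_(i < n) `|h| * d)).
  apply: ler_sum => i _; rewrite -mulrBr normrM; apply: ler_pM => //; first exact: coord_le_norm.
  by rewrite distrC; exact: HP.
rewrite sumr_const card_ord -mulr_natl.
have -> : n%:R * (`|h| * d) = (ep * `|h|) * (n%:R / (n%:R + 1)) by rewrite /d; field; rewrite gt_eqF.
rewrite ler_piMr //; first by rewrite mulr_ge0 // ltW.
by rewrite ler_pdivrMr // mul1r lerDl.
Qed.

Lemma gradient_smooth (F : 'rV[R]_n -> R) (P : 'I_n -> 'rV[R]_n -> R) :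
  (forall i, smooth_on setT (P i)) -> (forall z v, is_derive z v F (\sum_i v 0 i * P i z)) ->
  smooth_on setT F.
Proof.
move=> sP HF; have dF := gradient_differentiable (fun i => sP i 0) HF.
case=> [|k]; first by move=> z _; exact: differentiable_continuous.
split=> [z _|v]; first exact: dF.
apply: (@Ck_ext _ _ _ _ setT (fun z => \sum_i v 0 i * P i z)); [exact: openT|by move=> z _; case: (HF z v)|].
apply: Ck_sum => [|i]; first exact: openT.
by apply: CkM; [exact: openT|exact: Ck_cst|exact: sP].
Qed.

Definition radial_primitive (P : 'I_n -> 'rV[R]_n -> R) (z : 'rV[R]_n) : R :=
  Rintegral mu `[0, 1] (fun t => \sum_i z 0 i * P i (t *: z)).

(** The Poincare lemma: after differentiation under the integral sign, closedness
    turns the integrand into the t-derivative of t P(t z). *)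
Lemma radial_primitive_derive (P : 'I_n -> 'rV[R]_n -> R) : (forall i, smooth_on setT (P i)) ->
  (forall i j z, 'D_(e i) (P j) z = 'D_(e j) (P i) z) ->
  forall z v, is_derive z v (radial_primitive P) (\sum_i v 0 i * P i z).
Proof.
move=> sP symP z v.
have dP i x : differentiable (P i) x by have [h _] := sP i 1; exact: h.
have cc (Q : 'rV[R]_n -> R) : Ck 0 setT Q ->
    Ck 0 setT (fun w : 'rV[R]_2 => Q (w 0 1 *: (z + w 0 0 *: v)) : R).
  move=> cQ; apply: (@Ck_comp R _ n 0 setT setT (fun w : 'rV[R]_2 => w 0 1 *: (z + w 0 0 *: v)) Q openT (fun _ _ => I) _ cQ).
  apply/(Ck_rV _ _ openT) => j.
  apply: (@Ck_ext _ _ _ _ setT (fun w : 'rV[R]_2 => w 0 1 * (z 0 j + w 0 0 * v 0 j))).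
  - exact: openT.
  - by move=> w _; rewrite !mxE.
  - apply: CkM; [exact: openT|exact: Ck_coord openT|].
    apply: CkD; [exact: openT|exact: Ck_cst|].
    by apply: CkM; [exact: openT|exact: Ck_coord openT|exact: Ck_cst].
have coordC j : Ck 0 setT (fun w : 'rV[R]_2 => (z + w 0 0 *: v) 0 j : R).
  apply: (@Ck_ext _ _ _ _ setT (fun w : 'rV[R]_2 => z 0 j + w 0 0 * v 0 j)).
  - exact: openT.
  - by move=> w _; rewrite !mxE.
  - apply: CkD; [exact: openT|exact: Ck_cst|].
    by apply: CkM; [exact: openT|exact: Ck_coord openT|exact: Ck_cst].
pose f (x t : R) : R := \sum_i (z + x *: v) 0 i * P i (t *: (z + x *: v)).
pose df (x t : R) : R := \sum_i (v 0 i * P i (t *: (z + x *: v)) +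
   (z + x *: v) 0 i * (t * 'D_v (P i) (t *: (z + x *: v)))).
have jf : jointly_continuous f.
  suff H : Ck 0 setT (fun w : 'rV[R]_2 => f (w 0 0) (w 0 1)) by move=> w; exact: (H w I).
  apply: Ck_sum => [|i]; first exact: openT.
  by apply: CkM; [exact: openT|exact: coordC|exact/cc/(sP i 0)].
have jdf : jointly_continuous df.
  suff H : Ck 0 setT (fun w : 'rV[R]_2 => df (w 0 0) (w 0 1)) by move=> w; exact: (H w I).
  apply: Ck_sum => [|i]; first exact: openT.
  apply: CkD; first exact: openT.
    by apply: CkM; [exact: openT|exact: Ck_cst|exact/cc/(sP i 0)].
  apply: CkM; [exact: openT|exact: coordC|].
  apply: CkM; [exact: openT|exact: Ck_coord openT|].
  by apply: (cc (fun x => 'D_v (P i) x)); have [_ H] := sP i 1; exact: H.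
have Hf (x t : R) : is_derive x (1 : R) (f^~ t) (df x t).
  have Hi i : is_derive x (1 : R) (fun x : R => (z + x *: v) 0 i * P i (t *: (z + x *: v)))
     (v 0 i * P i (t *: (z + x *: v)) + (z + x *: v) 0 i * (t * 'D_v (P i) (t *: (z + x *: v)))).
    have d1 : is_derive x (1 : R) (fun x : R => (z + x *: v) 0 i : R) (v 0 i).
      apply: (@is_derive_quadratic _ _ _ _ 0) => h.
      set X := (X in `|X|); have -> : X = 0 by rewrite /X !mxE; ring.
      by rewrite normr0 mul0r.
    have d2 : is_derive x (1 : R) (fun x : R => P i (t *: (z + x *: v))) (t * 'D_v (P i) (t *: (z + x *: v))).
      have tE y : t *: (z + y *: v) = t *: z + y *: (t *: v).
        by rewrite scalerDr !scalerA [t * y]mulrC.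
      have dl : differentiable (P i) (t *: z + x *: (t *: v)) by exact: dP.
      have := is_derive_line dl.
      rewrite (deriveE _ dl) [X in is_derive _ _ _ X](linearZ _ _) /= -(deriveE _ dl) -tE.
      have -> // : (fun s : R => P i (t *: z + s *: (t *: v))) = (fun y : R => P i (t *: (z + y *: v))).
      by apply/funext => y; rewrite tE.
    have := is_deriveM d1 d2.
    by move=> H; apply: is_derive_eq H _; rewrite /GRing.scale /= addrC [X in X + _]mulrC.
  have -> : f^~ t = \sum_i (fun x : R => (z + x *: v) 0 i * P i (t *: (z + x *: v))).
    by apply/funext => y; rewrite fct_sumE.
  exact: is_derive_sum.
have key := param_derive 0 1 0 Hf jf jdf.
(* The integrand is the derivative of t |-> t P(t z) by closedness. *)
have E0 : Rintegral mu `[0, 1] (df 0) = \sum_i v 0 i * P i z.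
  pose G (t : R) : R := t * \sum_i v 0 i * P i (t *: z).
  have HG (t : R) : is_derive t (1 : R) G (df 0 t).
    have d1 : is_derive t (1 : R) (fun t : R => \sum_i v 0 i * P i (t *: z)) (\sum_i v 0 i * 'D_z (P i) (t *: z)).
      have -> : (fun t : R => \sum_i v 0 i * P i (t *: z)) = \sum_i (v 0 i \*: (fun t : R => P i (t *: z))).
        by apply/funext => y; rewrite fct_sumE.
      apply: is_derive_sum => i; apply: is_deriveZ.
      have dl : differentiable (P i) (0 + t *: z) by exact: dP.
      have := is_derive_line dl; rewrite add0r.
      by have -> // : (fun s : R => P i (0 + s *: z)) = (fun s : R => P i (s *: z)) by apply/funext => s; rewrite add0r.
    have H := is_deriveM (is_derive_id t (1 : R)) d1.
    apply: is_derive_eq H _.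
    rewrite /df scale0r addr0 /GRing.scale /= mulr1 big_split /= addrC; congr (_ + _).
    have -> : \sum_i z 0 i * (t * 'D_v (P i) (t *: z)) = t * \sum_i z 0 i * 'D_v (P i) (t *: z).
      by rewrite mulr_sumr; apply: eq_bigr => i _; rewrite mulrCA.
    congr (t * _).
    have DS u i : 'D_u (P i) (t *: z) = \sum_k u 0 k * 'D_(e k) (P i) (t *: z).
      have d := dP i (t *: z).
      rewrite (deriveE u d) {1}(rV_sum_delta u) linear_sum; apply: eq_bigr => k _.
      by rewrite linearZ (deriveE _ d).
    under eq_bigr do rewrite DS mulr_sumr.
    under [RHS]eq_bigr do rewrite DS mulr_sumr.
    rewrite exchange_big /=; apply: eq_bigr => i _; apply: eq_bigr => k _.
    by rewrite symP mulrCA.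
  have cdf : continuous (df 0) by exact: jointly_continuous_y.
  rewrite (FTC ltr01 HG cdf) /G mul0r subr0 mul1r.
  by apply: eq_bigr => i _; rewrite scale1r.
rewrite E0 in key.
have [K1 K2] := key.
have E : (fun s : R => s^-1 *: (radial_primitive P (s *: v + z) - radial_primitive P z)) =
    (fun s : R => s^-1 *: (Rintegral mu `[0, 1] (f (s *: (1 : R) + 0)) - Rintegral mu `[0, 1] (f 0))).
  apply/funext => s; congr (_ *: (_ - _)); rewrite /radial_primitive /f.
    by rewrite addr0 /GRing.scale /= mulr1 [z + _]addrC.
  by rewrite scale0r addr0.
by apply: DeriveDef; [rewrite /derivable /= E; exact: K1|rewrite -K2 /derive /= E].
Qed.

End Poincare.

(** * Integration over squares *)

Section BoxIntegral.
Context {R : realType}.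
Local Notation mu := (@lebesgue_measure R).
Implicit Types (h : 'rV[R]_2 -> R) (L : R).

Definition box_integral L h : R :=
  Rintegral mu `[- L, L] (fun x => Rintegral mu `[- L, L] (fun y => h (mk2 x y))).

Lemma Ck0_continuous (V : normedModType R) (h : V -> R) : Ck 0 setT h -> continuous h.
Proof. by move=> ch x; exact: (ch x I). Qed.

Lemma Ck0_jointly h : Ck 0 setT h -> jointly_continuous (fun x y => h (mk2 x y)).
Proof.
move=> ch; rewrite /jointly_continuous.
have -> : (fun w : 'rV[R]_2 => h (mk2 (w 0 0) (w 0 1))) = h.
  by apply/funext => w; rewrite mk2K.
exact: Ck0_continuous.
Qed.

Lemma continuous_slice h x : Ck 0 setT h -> continuous (fun y => h (mk2 x y)).
Proof. by move=> /Ck0_jointly/(@jointly_continuous_y _ _ x). Qed.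

Lemma continuous_slice_integral h c d : Ck 0 setT h ->
  continuous (fun x => Rintegral mu `[c, d] (fun y => h (mk2 x y))).
Proof. by move=> /Ck0_jointly H; exact: (param_continuous (f := fun x y => h (mk2 x y))). Qed.

Lemma box_integral_le L h k : Ck 0 setT h -> Ck 0 setT k ->
  (forall z : 'rV[R]_2, `|z 0 0| <= L -> `|z 0 1| <= L -> h z <= k z) ->
  box_integral L h <= box_integral L k.
Proof.
move=> ch ck hk; apply: integral_le_cont => [||x]; try exact: continuous_slice_integral.
rewrite -ler_norml => hx.
apply: integral_le_cont => [||y]; [exact: continuous_slice|exact: continuous_slice|].
by rewrite -ler_norml => hy; apply: hk; rewrite ?mk2_0 ?mk2_1.
Qed.

Lemma box_integralD L h k : Ck 0 setT h -> Ck 0 setT k ->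
  box_integral L (fun z => h z + k z) = box_integral L h + box_integral L k.
Proof.
move=> ch ck; rewrite -integralD_cont; try exact: continuous_slice_integral.
congr (Rintegral mu _ _); apply/funext => x.
by rewrite -integralD_cont //; exact: continuous_slice.
Qed.

Lemma box_integralZ L k h : Ck 0 setT h ->
  box_integral L (fun z => k * h z) = k * box_integral L h.
Proof.
move=> ch; rewrite -integralZ_cont; last exact: continuous_slice_integral.
congr (Rintegral mu _ _); apply/funext => x.
by rewrite -integralZ_cont //; exact: continuous_slice.
Qed.

Lemma box_integral_support L L' h : 0 <= L -> L <= L' ->
  (forall z : 'rV[R]_2, L <= `|z 0 0| \/ L <= `|z 0 1| -> h z = 0) ->
  box_integral L' h = box_integral L h.
Proof.
move=> L0 LL hz.
have LN : - L' <= - L by rewrite lerN2.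
have out x : ~~ (- L <= x <= L) -> L <= `|x| by rewrite -ler_norml -ltNge => /ltW.
have zero (c d : R) : c <= d -> Rintegral mu `[c, d] (cst (0 : R)) = 0.
  by move=> cd; exact: etrans (segment_integral_cst 0 cd) (mul0r _).
have L'0 : 0 <= L' by exact: le_trans LL.
apply: (etrans (integral_support LN LL _)) => [x _ nx|].
  rewrite -[RHS](zero (- L') L'); last by rewrite (le_trans _ L'0) // oppr_le0.
  congr (Rintegral mu _ _); apply/funext => y; apply: hz; left; rewrite mk2_0; exact: out.
congr (Rintegral mu _ _); apply/funext => x.
by apply: (integral_support LN LL) => y _ ny; apply: hz; right; rewrite mk2_1; exact: out.
Qed.

Lemma box_integral_ge0 L h : 0 <= L -> Ck 0 setT h -> (forall z, 0 <= h z) ->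
  0 <= box_integral L h.
Proof.
move=> L0 ch h0; have LL : - L <= L by rewrite (le_trans _ L0) // oppr_le0.
have E : box_integral L (cst 0) = 0.
  apply: (etrans _ (etrans (segment_integral_cst 0 LL) (mul0r _))).
  congr (Rintegral mu _ _); apply/funext => x.
  exact: (etrans (segment_integral_cst 0 LL) (mul0r _)).
by rewrite -E; apply: box_integral_le => //; exact: Ck_cst.
Qed.

Lemma box_integral_mono L L' h : 0 <= L -> L <= L' -> Ck 0 setT h -> (forall z, 0 <= h z) ->
  box_integral L h <= box_integral L' h.
Proof.
move=> L0 LL ch h0; have LN : - L' <= - L by rewrite lerN2.
have L'0 : 0 <= L' by exact: le_trans LL.
have NL : - L' <= L' by rewrite (le_trans _ L'0) // oppr_le0.
have inner0 x : 0 <= Rintegral mu `[- L', L'] (fun y => h (mk2 x y)).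
  rewrite -[X in X <= _](etrans (segment_integral_cst 0 NL) (mul0r _)).
  by apply: integral_le_cont => [||y _]; [exact: cst_continuous|exact: continuous_slice|exact: h0].
apply: le_trans (integral_sub_le (continuous_slice_integral ch) LN LL inner0).
apply: integral_le_cont => [||x _]; try exact: continuous_slice_integral.
exact: (integral_sub_le (continuous_slice (x := x) ch) LN LL (fun y => h0 _)).
Qed.

Lemma is_derive_slice_x h (x y : R) : differentiable h (mk2 x y) ->
  is_derive x (1 : R) (fun t => h (mk2 t y)) ('D_(delta_mx 0 0) h (mk2 x y)).
Proof.
have E t : mk2 t y = mk2 0 y + t *: delta_mx 0 0 by rewrite -mk2_line_x add0r.
rewrite E => dh; have -> : (fun t => h (mk2 t y)) = (fun t => h (mk2 0 y + t *: delta_mx 0 0)).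
  by apply/funext => t; rewrite E.
exact: (is_derive_line dh).
Qed.

Lemma is_derive_slice_y h (x y : R) : differentiable h (mk2 x y) ->
  is_derive y (1 : R) (fun t => h (mk2 x t)) ('D_(delta_mx 0 1) h (mk2 x y)).
Proof.
have E t : mk2 x t = mk2 x 0 + t *: delta_mx 0 1 by rewrite -mk2_line_y add0r.
rewrite E => dh; have -> : (fun t => h (mk2 x t)) = (fun t => h (mk2 x 0 + t *: delta_mx 0 1)).
  by apply/funext => t; rewrite E.
exact: (is_derive_line dh).
Qed.

(** The divergence theorem for fields vanishing on the boundary of the box. *)
Lemma box_divergence L (F G : 'rV[R]_2 -> R) : 0 < L -> Ck 1 setT F -> Ck 1 setT G ->
  (forall z : 'rV[R]_2, L <= `|z 0 0| \/ L <= `|z 0 1| -> F z = 0 /\ G z = 0) ->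
  box_integral L (fun z => 'D_(delta_mx 0 0) F z + 'D_(delta_mx 0 1) G z) = 0.
Proof.
move=> L0 sF sG Z; have [dF DF] := sF; have [dG DG] := sG.
have LL : - L < L by rewrite gtrN.
have zero : Rintegral mu `[- L, L] (cst (0 : R)) = 0.
  by exact: etrans (segment_integral_cst 0 (ltW LL)) (mul0r _).
have aL : L <= `|L| by rewrite ler_norm.
have aNL : L <= `|- L| by rewrite normrN ler_norm.
rewrite box_integralD; [|exact: DF|exact: DG].
have -> : box_integral L (fun z => 'D_(delta_mx 0 1) G z) = 0.
  rewrite -[RHS]zero; congr (Rintegral mu _ _); apply/funext => x.
  have HG (y : R) : is_derive y (1 : R) (fun y => G (mk2 x y)) ('D_(delta_mx 0 1) G (mk2 x y)).
    by apply: is_derive_slice_y; exact: dG.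
  apply: (etrans (FTC LL HG (continuous_slice (x := x) (DG _)))).
  have GZ (y : R) : L <= `|y| -> G (mk2 x y) = 0.
    by move=> hy; apply: (proj2 (Z _ _)); right; rewrite mk2_1.
  by rewrite !GZ ?subrr.
rewrite addr0.
have HF (x : R) : is_derive x (1 : R) (fun x => Rintegral mu `[- L, L] (fun y => F (mk2 x y)))
    (Rintegral mu `[- L, L] (fun y => 'D_(delta_mx 0 0) F (mk2 x y))).
  apply: (param_derive (f := fun x y => F (mk2 x y)) (df := fun x y => 'D_(delta_mx 0 0) F (mk2 x y))).
  + by move=> a b; apply: is_derive_slice_x; exact: dF.
  + by apply: Ck0_jointly; exact: (CkS sF).
  + exact: (Ck0_jointly (DF _)).
apply: (etrans (FTC LL HF (continuous_slice_integral (DF _)))).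
have side x : L <= `|x| -> Rintegral mu `[- L, L] (fun y => F (mk2 x y)) = 0.
  move=> hx; rewrite -[RHS]zero; congr (Rintegral mu _ _); apply/funext => y.
  by apply: (proj1 (Z _ _)); left; rewrite mk2_0.
by rewrite !side ?subrr.
Qed.

Lemma box_integral_gt0 h z0 : Ck 0 setT h -> (forall z, 0 <= h z) -> 0 < h z0 ->
  exists2 L, 0 < L & 0 < box_integral L h.
Proof.
move=> ch h0 hz0.
have half : 0 < h z0 / 2 by rewrite divr_gt0.
have N : nbhs z0 [set z | `|h z0 - h z| < h z0 / 2].
  by have /cvgrPdist_lt/(_ _ half) := ch z0 I.
move: N => /nbhs_ballP [r /= r0 Hr].
pose d := r / 2; have d0 : 0 < d by rewrite divr_gt0.
have dr : d < r by rewrite ltr_pdivrMr // ltr_pMr // ltr1n.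
have Hd x y : `|x - z0 0 0| <= d -> `|y - z0 0 1| <= d -> h z0 / 2 <= h (mk2 x y).
  move=> hx hy; have : `|h z0 - h (mk2 x y)| < h z0 / 2.
    apply: Hr; rewrite -ball_normE /=; apply: le_lt_trans dr.
    apply: mx_norm_le => [|i j]; first exact: ltW.
    rewrite ord1 -{1}(mk2K z0) !mxE; case: ifP => _; by rewrite distrC.
  by rewrite ltr_norml => /andP[_]; have := splitr (h z0); lra.
pose L := `|z0 0 0| + `|z0 0 1| + d.
have n0 := normr_ge0 (z0 0 0); have n1 := normr_ge0 (z0 0 1).
have L0 : 0 < L by rewrite ltr_wpDl // addr_ge0.
have sub (a : R) : `|a| <= `|z0 0 0| + `|z0 0 1| -> - L <= a - d /\ a + d <= L.
  by rewrite ler_norml => /andP[h1 h2]; rewrite /L; split; lra.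
have /sub[s0 s1] : `|z0 0 0| <= `|z0 0 0| + `|z0 0 1| by rewrite lerDl.
have /sub[s2 s3] : `|z0 0 1| <= `|z0 0 0| + `|z0 0 1| by rewrite lerDr.
exists L => //.
have inner0 x : 0 <= Rintegral mu `[- L, L] (fun y => h (mk2 x y)).
  rewrite -[X in X <= _](_ : Rintegral mu `[- L, L] (cst (0 : R)) = 0); last first.
    have LL : - L <= L by rewrite ltW // gtrN.
    by exact: etrans (segment_integral_cst 0 LL) (mul0r _).
  by apply: integral_le_cont => [||y _]; [exact: cst_continuous|exact: continuous_slice|exact: h0].
pose m := h z0 / 2 * (2 * d).
have m0 : 0 < m by rewrite !mulr_gt0.
have inner x : `|x - z0 0 0| <= d -> m <= Rintegral mu `[- L, L] (fun y => h (mk2 x y)).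
  move=> hx; apply: le_trans (integral_sub_le (continuous_slice (x := x) ch) s2 s3 (fun y => h0 _)).
  have -> : m = Rintegral mu `[z0 0 1 - d, z0 0 1 + d] (cst (h z0 / 2)).
    by apply: esym; apply: (etrans (segment_integral_cst _ _)); [lra|rewrite /m; ring].
  apply: integral_le_cont => [||y hy]; [exact: cst_continuous|exact: continuous_slice|].
  by apply: Hd => //; rewrite ler_norml; apply/andP; move: hy => /andP[]; split; lra.
apply: (@lt_le_trans _ _ (m * (2 * d))); first by rewrite !mulr_gt0.
apply: le_trans (integral_sub_le (continuous_slice_integral ch) s0 s1 inner0).
have -> : m * (2 * d) = Rintegral mu `[z0 0 0 - d, z0 0 0 + d] (cst m).
  by apply: esym; apply: (etrans (segment_integral_cst _ _)); [lra|rewrite /m; ring].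
apply: integral_le_cont => [||x hx]; [exact: cst_continuous|exact: continuous_slice_integral|].
by apply: inner; rewrite ler_norml; apply/andP; move: hx => /andP[]; split; lra.
Qed.

End BoxIntegral.

(** * Pointwise inequalities *)

Section EnergyAlgebra.
Context {R : realType}.
Implicit Types (p q u w W b k x y : R).

(** Here (y0, y1) = B (x, y) where B has eigenvalue b along Df = (p, q) and a
    across it, while the energy W |.|^2 + w <Df, .>^2 has eigenvalues w and W in
    these directions. The claim is the pair of inequalities w b^2 <= C a b and
    W a^2 <= C a b; it is proved without dividing by S = |Df|^2, which may vanish. *)
Lemma cofactor_energy p q w W b k x y C (S := p * p + q * q) (a := b + k * S)
    (y0 := (b + k * (q * q)) * x + (- (k * (p * q))) * y)
    (y1 := (- (k * (p * q))) * x + (b + k * (p * p)) * y) :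
  0 <= W -> W + w * S = w -> 0 <= b -> 0 <= a -> a * W <= C * b -> b * w <= C * a ->
  W * (y0 * y0 + y1 * y1) + w * (p * y0 + q * y1) ^+ 2 <= C * (b * a) * (x * x + y * y).
Proof.
move=> W0 wS b0 a0 h1 h2.
pose B := w * (b * b) - W * (k * (a + b)); pose d := p * x + q * y.
pose X := x * x + y * y.
have X0 : 0 <= X by rewrite addr_ge0 // -expr2 sqr_ge0.
have -> : W * (y0 * y0 + y1 * y1) + w * (p * y0 + q * y1) ^+ 2 = W * (a * a) * X + B * d ^+ 2.
  by rewrite /B /d /X /y0 /y1 /a /S; ring.
have dS : d ^+ 2 <= S * X.
  rewrite -subr_ge0; have -> : S * X - d ^+ 2 = (q * x - p * y) ^+ 2 by rewrite /S /X /d; ring.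
  exact: sqr_ge0.
have E1 : W * (a * a) <= C * (b * a).
  have -> : W * (a * a) = (a * W) * a by ring.
  have -> : C * (b * a) = (C * b) * a by ring.
  by rewrite ler_wpM2r.
have E2 : W * (a * a) + B * S <= C * (b * a).
  have -> : W * (a * a) + B * S = (b * w) * b.
    transitivity (b * b * (W + w * S)); first by rewrite /B /a; ring.
    by rewrite wS; ring.
  have -> : C * (b * a) = (C * a) * b by ring.
  by rewrite ler_wpM2r.
have [B0|B0] := leP B 0.
  apply: (@le_trans _ _ (W * (a * a) * X)).
    by rewrite gerDl mulr_le0_ge0 // sqr_ge0.
  by rewrite ler_wpM2r.
apply: (@le_trans _ _ ((W * (a * a) + B * S) * X)); last by rewrite ler_wpM2r.
have -> : (W * (a * a) + B * S) * X = W * (a * a) * X + B * (S * X) by ring.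
by rewrite lerD2l ler_wpM2l // ltW.
Qed.

(** Cauchy-Schwarz for the quadratic form W |.|^2 + w <Df, .>^2, because Df pairs
    with any vector to w <Df, .> and has energy w |Df|^2. *)
Lemma tilt_cauchy_schwarz p q w W y0 y1 (S := p * p + q * q) (d := p * y0 + q * y1) :
  w * W = 1 -> W + w * S = w ->
  (w * d) ^+ 2 <= w * S * (W * (y0 * y0 + y1 * y1) + w * d ^+ 2).
Proof.
move=> wW wS; rewrite -subr_ge0.
have -> : w * S * (W * (y0 * y0 + y1 * y1) + w * d ^+ 2) - (w * d) ^+ 2 = (q * y0 - p * y1) ^+ 2.
  transitivity (w * W * (S * (y0 * y0 + y1 * y1)) + w * d ^+ 2 * (W + w * S - W) - w * w * d ^+ 2); first by ring.
  rewrite wS wW mul1r.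
  transitivity (S * (y0 * y0 + y1 * y1) - w * W * d ^+ 2); first by ring.
  by rewrite wW /S /d; ring.
exact: sqr_ge0.
Qed.

Lemma absorb_cross_term (t X E Q D : R) : 0 < t -> 0 <= X -> 0 <= E -> 0 <= Q -> D ^+ 2 <= E * Q ->
  - (4 * X ^+ 3 * D) <= X ^+ 4 * E / (2 * t) + 8 * t * X ^+ 2 * Q.
Proof.
move=> t0 X0 E0 Q0 DEQ.
set a := X ^+ 4 * E / (2 * t); set b := 8 * t * X ^+ 2 * Q.
have a0 : 0 <= a by rewrite divr_ge0 // ?mulr_ge0 // ?exprn_ge0 // ltW.
have b0 : 0 <= b by rewrite !mulr_ge0 // ?exprn_ge0 // ltW.
have g2 : (4 * X ^+ 3 * D) ^+ 2 <= (a + b) ^+ 2.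
  apply: (@le_trans _ _ (4 * a * b)).
    have -> : 4 * a * b = 16 * X ^+ 6 * (E * Q) by rewrite /a /b; field; rewrite gt_eqF.
    have -> : (4 * X ^+ 3 * D) ^+ 2 = 16 * X ^+ 6 * D ^+ 2 by ring.
    by rewrite ler_wpM2l // mulr_ge0 // exprn_ge0.
  rewrite -subr_ge0; have -> : (a + b) ^+ 2 - 4 * a * b = (a - b) ^+ 2 by ring.
  exact: sqr_ge0.
have ab0 : 0 <= a + b by rewrite addr_ge0.
apply: (le_trans (ler_norm _)); rewrite normrN -(ger0_norm ab0) -ler_sqr ?nnegrE //.
by rewrite !real_normK ?num_real.
Qed.

(** In the application X is the cutoff, E the energy density w |Df|^2, Q the
    energy of the differential of the cutoff and d the Jacobian determinant of
    xi. The cross term is absorbed in half of the energy and Q in the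
    part of the divergence that the field T m(s) xi contributes. *)
Lemma cutoff_inequality (t X E Q D K C ep s r m m' pos d vV dZ : R) :
  0 < t -> 0 <= X <= 1 -> 0 <= E -> 0 <= Q -> D ^+ 2 <= E * Q ->
  0 <= C -> 0 <= ep -> 0 <= s -> 0 <= d -> 0 <= r -> r <= m -> 0 <= pos ->
  K = 8 * t * C * ep -> Q <= (2 * ep * r) ^+ 2 * (C * d * s) ->
  E / t <= vV -> m + s * m' = 2 * pos ->
  dZ = 4 * X ^+ 3 * D + 4 * K * X * ep * m * r * d * s + X ^+ 4 * vV - 2 * X ^+ 2 * K * d * (m + s * m') ->
  X ^+ 4 * E / (2 * t) <= dZ + 4 * K * (pos * d).
Proof.
move=> t0 /andP[X0 X1] E0 Q0 DEQ C0 ep0 s0 d0 r0 rm pos0 KE QC EV mE ->.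
have K0 : 0 <= K by rewrite KE !mulr_ge0 // ltW.
have h1 := absorb_cross_term t0 X0 E0 Q0 DEQ.
have h2 : 8 * t * X ^+ 2 * Q <= 4 * K * X * ep * m * r * d * s.
  apply: (@le_trans _ _ (8 * t * X ^+ 2 * ((2 * ep * r) ^+ 2 * (C * d * s)))).
    by rewrite ler_wpM2l // !mulr_ge0 ?exprn_ge0 // ltW.
  have -> : 8 * t * X ^+ 2 * ((2 * ep * r) ^+ 2 * (C * d * s)) = 4 * K * X * ep * r * d * s * (X * r).
    by rewrite KE; ring.
  have -> : 4 * K * X * ep * m * r * d * s = 4 * K * X * ep * r * d * s * m by ring.
  rewrite ler_wpM2l ?mulr_ge0 //; apply: le_trans rm.
  by rewrite ler_piMl.
have h3 : X ^+ 4 * E / t <= X ^+ 4 * vV by rewrite -mulrA ler_wpM2l // exprn_ge0.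
have h4 : X ^+ 2 * (4 * K * (pos * d)) <= 4 * K * (pos * d).
  by rewrite ler_piMl ?mulr_ge0 // exprn_ile1.
have h5 : X ^+ 4 * E / t = X ^+ 4 * E / (2 * t) + X ^+ 4 * E / (2 * t).
  by field; rewrite gt_eqF.
rewrite mE; have -> : 2 * X ^+ 2 * K * d * (2 * pos) = X ^+ 2 * (4 * K * (pos * d)) by ring.
rewrite h5 in h3; move: h1 h2 h3 h4; clear; lra.
Qed.

End EnergyAlgebra.

Section RadialWeight.
Context {R : realType}.

(** t * radial_weight t is concave and increasing up to t = 1 and constant
    afterwards, so that its derivative has compact support in [0, +oo[. *)
Definition radial_weight (t : R) : R := (Num.max t 1)^-1 + Num.max (1 - t) 0.
Definition radial_weight' (t : R) : R := - (Num.max t 1)^-1 ^+ 2.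

Lemma is_derive_radial_weight (t : R) : is_derive t (1 : R) radial_weight (radial_weight' t).
Proof.
apply: (@is_derive_quadratic _ _ _ _ 2) => h; rewrite /radial_weight /radial_weight'.
set y := t + h; have -> : h = y - t by rewrite /y; ring.
have h2 : 0 <= (y - t) ^+ 2 by exact: sqr_ge0.
case: (lerP y 1) => y1; case: (lerP t 1) => t1.
- rewrite !max_l ?subr_ge0 // !invr1.
  set X := (X in `|X|); have -> : X = 0 by rewrite /X; ring.
  by rewrite normr0 mulr_ge0.
- rewrite max_l ?subr_ge0 // max_r ?subr_le0 ?(ltW t1) //.
  have t0 : 0 < t by exact: lt_trans t1.
  set X := (X in `|X|).
  have -> : X = (1 - t^-1) * ((1 - y) + (t - y) / t) by rewrite /X invr1; field; rewrite gt_eqF.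
  have v0 : 0 < t^-1 by rewrite invr_gt0.
  have v1 : t^-1 < 1 by rewrite invf_lt1.
  have tv : t * t^-1 = 1 by rewrite divff // gt_eqF.
  have a0 : 0 <= 1 - t^-1 by lra.
  have a1 : 1 - t^-1 <= t - y.
    have : 0 <= (t - 1) ^+ 2 * t^-1 by rewrite mulr_ge0 ?sqr_ge0 // ltW.
    have -> : (t - 1) ^+ 2 * t^-1 = t - 2 + t^-1 by field; rewrite gt_eqF.
    lra.
  have b0 : 0 <= (1 - y) + (t - y) / t by rewrite addr_ge0 ?mulr_ge0 ?(ltW v0) //; lra.
  have b1 : (1 - y) + (t - y) / t <= 2 * (t - y).
    have : (t - y) / t <= (t - y) * 1 by rewrite ler_wpM2l ?(ltW v1) //; lra.
    lra.
  rewrite ger0_norm ?mulr_ge0 //.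
  have -> : 2 * (y - t) ^+ 2 = (t - y) * (2 * (t - y)) by ring.
  by apply: ler_pM.
- have y0 : 0 < y by exact: lt_trans y1.
  rewrite max_r ?subr_le0 ?(ltW y1) // max_l ?subr_ge0 // invr1.
  set X := (X in `|X|); have -> : X = (y - 1) ^+ 2 * y^-1 by rewrite /X; field; rewrite gt_eqF.
  rewrite ger0_norm; last by apply: mulr_ge0; [exact: sqr_ge0|rewrite invr_ge0 ltW].
  apply: (@le_trans _ _ ((y - 1) ^+ 2 * 1)).
    by rewrite ler_wpM2l ?sqr_ge0 // invf_le1 // ltW.
  have h3 : 0 <= y - 1 by lra.
  have h4 : 0 <= y - t by lra.
  have : (y - 1) ^+ 2 <= (y - t) ^+ 2 by rewrite ler_sqr ?nnegrE //; lra.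
  lra.
- have y0 : 0 < y by exact: lt_trans y1.
  have t0 : 0 < t by exact: lt_trans t1.
  rewrite !max_r ?subr_le0 ?(ltW y1) ?(ltW t1) //.
  set X := (X in `|X|); have -> : X = (y - t) ^+ 2 * (y^-1 * (t^-1 * t^-1)).
    by rewrite /X; field; rewrite !gt_eqF.
  have v0 : 0 <= t^-1 <= 1 by rewrite invr_ge0 ltW //= invf_le1 // ltW.
  have y'0 : 0 <= y^-1 <= 1 by rewrite invr_ge0 ltW //= invf_le1 // ltW.
  move: v0 y'0 => /andP[v0 v1] /andP[u0 u1].
  have vv : t^-1 * t^-1 <= 1 by exact: mulr_ile1.
  have vv0 : 0 <= t^-1 * t^-1 by exact: mulr_ge0.
  have uv : y^-1 * (t^-1 * t^-1) <= 1 by exact: mulr_ile1.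
  have uv0 : 0 <= y^-1 * (t^-1 * t^-1) by exact: mulr_ge0.
  rewrite ger0_norm; last exact: mulr_ge0.
  by apply: (@le_trans _ _ ((y - t) ^+ 2 * 1)); [exact: ler_wpM2l|lra].
Qed.

Lemma radial_weight_flux (t : R) :
  radial_weight t + t * radial_weight' t = 2 * Num.max (1 - t) 0.
Proof.
rewrite /radial_weight /radial_weight'; case: (lerP t 1) => t1.
  by rewrite max_l ?subr_ge0 // invr1; ring.
have t0 : t != 0 by rewrite gt_eqF // (lt_trans _ t1).
by rewrite max_r ?subr_le0 ?(ltW t1) //; field.
Qed.

Lemma radial_weight_ge (t : R) : 0 <= t -> (1 + t)^-1 <= radial_weight t.
Proof.
move=> t0; apply: (@le_trans _ _ (Num.max t 1)^-1).
  have M0 : 0 < Num.max t 1 by rewrite lt_max ltr01 orbT.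
  have t1 : 0 < 1 + t by lra.
  by rewrite lef_pV2 ?posrE // ge_max; apply/andP; split; lra.
by rewrite lerDl le_max lexx orbT.
Qed.

End RadialWeight.

(** * Coordinates adapted to a planar solution *)

Section DerivationCalculus.
Context {R : realType} {V : normedModType R}.
Implicit Types (F G : V -> R) (z v : V) (a b : R).

Lemma diff_is_derive F z v : differentiable F z -> is_derive z v F ('D_v F z).
Proof. by move=> dF; apply: DeriveDef => //; exact: diff_derivable. Qed.

Lemma is_derive_add F G z v a b : is_derive z v F a -> is_derive z v G b ->
  is_derive z v (fun x => F x + G x : R) (a + b).
Proof. by move=> hF hG; exact: (is_deriveD hF hG). Qed.

Lemma is_derive_opp F z v a : is_derive z v F a -> is_derive z v (fun x => - F x : R) (- a).
Proof. by move=> hF; exact: (is_deriveN hF). Qed.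

Lemma is_derive_mul F G z v a b : is_derive z v F a -> is_derive z v G b ->
  is_derive z v (fun x => F x * G x : R) (a * G z + F z * b).
Proof.
move=> hF hG; apply: is_derive_eq (is_deriveM hF hG) _.
by rewrite /GRing.scale /= addrC; congr (_ + _); exact: mulrC.
Qed.

Lemma is_derive_const (c : R) z v : is_derive z v (fun _ : V => c : R) 0.
Proof. exact: is_derive_cst. Qed.

Lemma is_derive_chain (phi : R -> R) c F z v : differentiable F z ->
  is_derive (F z) (1 : R) phi c -> is_derive z v (fun x => phi (F x) : R) (c * 'D_v F z).
Proof.
move=> dF hphi; have [d D] := derive_scalar_comp v dF hphi.
by apply: DeriveDef => //; exact: diff_derivable.
Qed.

Lemma smoothD F G : smooth_on setT F -> smooth_on setT G -> smooth_on setT (fun x => F x + G x : R).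
Proof. by move=> sF sG k; apply: CkD; [exact: openT|exact: sF|exact: sG]. Qed.

Lemma smoothM F G : smooth_on setT F -> smooth_on setT G -> smooth_on setT (fun x => F x * G x : R).
Proof. by move=> sF sG k; apply: CkM; [exact: openT|exact: sF|exact: sG]. Qed.

Lemma smoothN F : smooth_on setT F -> smooth_on setT (fun x => - F x : R).
Proof.
move=> sF k; apply: (@Ck_ext _ _ _ _ setT (fun x => -1 * F x : R)); first exact: openT.
  by move=> x _; rewrite mulN1r.
by apply: CkM; [exact: openT|exact: Ck_cst|exact: sF].
Qed.

Lemma smooth_cst (c : R) : smooth_on setT (fun _ : V => c : R).
Proof. by move=> k; exact: Ck_cst. Qed.

Lemma smoothV F : (forall x, F x != 0) -> smooth_on setT F -> smooth_on setT (fun x => (F x)^-1 : R).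
Proof. by move=> F0 sF k; apply: CkV; [exact: openT|move=> x _; exact: F0|exact: sF]. Qed.

Lemma smooth_derive F v : smooth_on setT F -> smooth_on setT (fun x => 'D_v F x : R).
Proof. by move=> sF k; have [_ H] := sF k.+1; exact: H. Qed.

Lemma smooth_differentiable F z : smooth_on setT F -> differentiable F z.
Proof. by move=> sF; have [H _] := sF 1; exact: H. Qed.

Lemma Ck0_max F G : Ck 0 setT F -> Ck 0 setT G -> Ck 0 setT (fun x => Num.max (F x) (G x) : R).
Proof. by move=> cF cG x _; apply: continuous_max; [exact: (cF x I)|exact: (cG x I)]. Qed.

End DerivationCalculus.

Section PlanePrimitive.
Context {R : realType}.
Local Notation e i := (delta_mx 0 i : 'rV[R]_2).

Lemma sum_ord2 (F : 'I_2 -> R) : \sum_i F i = F 0 + F 1.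
Proof. by rewrite big_ord_recl big_ord1; congr (_ + F _); exact/val_inj. Qed.

Lemma ord2P (i : 'I_2) : i = 0 \/ i = 1.
Proof. by case: i => -[|[|]] // hi; [left|right]; exact/val_inj. Qed.

(** Normalized at the origin, where the radial primitive vanishes. *)
Lemma closed_form_primitive (P Q : 'rV[R]_2 -> R) : smooth_on setT P -> smooth_on setT Q ->
  (forall z, 'D_(e 0) Q z = 'D_(e 1) P z) ->
  exists xi : 'rV[R]_2 -> R, [/\ smooth_on setT xi, xi 0 = 0 &
    forall z v, is_derive z v xi (v 0 0 * P z + v 0 1 * Q z)].
Proof.
move=> sP sQ PQ; pose A (i : 'I_2) := if i == 0 then P else Q.
have sA i : smooth_on setT (A i) by rewrite /A; case: ifP.
have symA i j z : 'D_(e i) (A j) z = 'D_(e j) (A i) z.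
  by case: (ord2P i) => ->; case: (ord2P j) => ->; rewrite /A //= PQ.
have HA := radial_primitive_derive sA symA.
exists (radial_primitive A); split; first exact: (gradient_smooth sA HA).
  rewrite /radial_primitive.
  have -> : (fun t : R => \sum_i (0 : 'rV[R]_2) 0 i * A i (t *: 0)) = cst 0.
    by apply/funext => t; apply: big1 => i _; rewrite mxE mul0r.
  exact: (etrans (segment_integral_cst 0 ler01) (mul0r _)).
by move=> z v; apply: is_derive_eq (HA z v) _; rewrite sum_ord2.
Qed.

End PlanePrimitive.

Section Liouville.
Context {R : realType}.
Local Notation e i := (delta_mx 0 i : 'rV[R]_2).
Variables (f w : 'rV[R]_2 -> R) (t1 t2 : R).
Hypotheses (sf : smooth_on setT f) (sw : smooth_on setT w) (t10 : 0 < t1).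
Hypotheses (fb : forall z, t1 <= f z <= t2) (w0 : forall z, 0 < w z).
Hypothesis wE : forall z, w z ^+ 2 = 1 + w z ^+ 2 * \sum_i ('D_(e i) f z) ^+ 2.
Hypothesis eqn : forall z, \sum_i 'D_(e i) (fun z => w z * 'D_(e i) f z : R) z =
  2%:R / f z * (w z - 1).

Let p z : R := 'D_(e 0) f z.
Let q z : R := 'D_(e 1) f z.
Let u z : R := (f z)^-1.
Let W z : R := (w z)^-1.
Let c : R := t1^-1 * t1^-1 + 1.
Let b z : R := u z * u z * (W z + -1) + c.
Let k z : R := u z * u z * w z.
Let S z : R := p z * p z + q z * q z.
Let a z : R := b z + k z * S z.
Let b11 z : R := b z + k z * (q z * q z).
Let b12 z : R := - (k z * (p z * q z)).
Let b22 z : R := b z + k z * (p z * p z).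

Let f0 z : 0 < f z. Proof. by have /andP[h _] := fb z; exact: lt_le_trans h. Qed.
Let fn0 z : f z != 0. Proof. by rewrite gt_eqF. Qed.
Let wn0 z : w z != 0. Proof. by rewrite gt_eqF. Qed.
Let w1 z : 1 <= w z. Proof. exact: (tilt_ge1 w0 wE). Qed.
Let wW z : w z * W z = 1. Proof. exact: divff. Qed.
Let W0 z : 0 < W z. Proof. by rewrite invr_gt0. Qed.
Let W1 z : W z <= 1. Proof. by rewrite invf_le1. Qed.

Let wS z : w z * S z = w z - W z.
Proof.
apply: (mulfI (wn0 z)); rewrite mulrBr wW.
transitivity (w z ^+ 2 * \sum_i ('D_(e i) f z) ^+ 2).
  by rewrite sum_ord2 /S /p /q; ring.
by rewrite -expr2 [in RHS]wE [RHS]addrC addKr.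
Qed.

Let sp : smooth_on setT p. Proof. exact: smooth_derive. Qed.
Let sq : smooth_on setT q. Proof. exact: smooth_derive. Qed.
Let su : smooth_on setT u. Proof. exact: smoothV. Qed.
Let sW : smooth_on setT W. Proof. exact: smoothV. Qed.
Let sb : smooth_on setT b.
Proof.
apply: smoothD; last exact: smooth_cst.
by apply: smoothM; [exact: smoothM|apply: smoothD => //; exact: smooth_cst].
Qed.
Let sk : smooth_on setT k. Proof. by apply: smoothM => //; exact: smoothM. Qed.
Let sb11 : smooth_on setT b11.
Proof. by apply: smoothD => //; apply: smoothM => //; exact: smoothM. Qed.
Let sb12 : smooth_on setT b12.
Proof. by apply: smoothN; apply: smoothM => //; exact: smoothM. Qed.
Let sb22 : smooth_on setT b22.
Proof. by apply: smoothD => //; apply: smoothM => //; exact: smoothM. Qed.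

Let dI z v (F : 'rV[R]_2 -> R) (sF : smooth_on setT F) := diff_is_derive v (smooth_differentiable z sF).

Let Sv v z : R := p z * 'D_v p z + q z * 'D_v q z.

Let Du v z : is_derive z v u (- (u z * u z) * 'D_v f z).
Proof.
apply: is_derive_eq (dI z v su) _.
rewrite (derive_inv v (fn0 z) (smooth_differentiable z sf)) /u.
have alg (r d : R) : r != 0 -> - d / r ^+ 2 = - (r^-1 * r^-1) * d by move=> r0; field.
exact: (alg _ _ (fn0 z)).
Qed.

Let DW v z : is_derive z v W (- w z * Sv v z).
Proof.
apply: is_derive_eq (dI z v sW) _.
have H1 := is_derive_mul (dI z v sW) (dI z v sW).
have H2 := is_derive_add (is_derive_const 1 z v) (is_derive_opp (is_derive_add
  (is_derive_mul (dI z v sp) (dI z v sp)) (is_derive_mul (dI z v sq) (dI z v sq)))).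
have E : (fun x => W x * W x : R) = (fun x => 1 + - (p x * p x + q x * q x) : R).
  apply/funext => x; rewrite -/(S x); apply: (mulfI (wn0 x)).
  rewrite mulrA wW mul1r mulrDr mulr1 mulrN wS; ring.
rewrite E in H1; have [_ h1] := H1; have [_ h2] := H2; rewrite h2 in h1.
have alg (m n x y P Q r : R) : m * n = 1 ->
    0 + - (P * x + x * P + (Q * y + y * Q)) = r * n + n * r -> r = - m * (x * P + y * Q).
  move=> mn h; apply: (mulfI (_ : 2 != 0)) => //.
  apply: (@etrans _ _ (m * (r * n + n * r) + 2 * r * (1 - m * n))); first by ring.
  by rewrite -h mn; ring.
exact: (alg _ _ _ _ _ _ _ (wW z) h1).
Qed.

Let Dw v z : is_derive z v w (w z * (w z * w z) * Sv v z).
Proof.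
apply: is_derive_eq (dI z v sw) _.
have H1 := is_derive_mul (dI z v sw) (DW v z).
have E : (fun x => w x * W x : R) = (fun _ => 1 : R) by apply/funext => x; exact: wW.
rewrite E in H1; have [_ h1] := H1; have [_ h2] := is_derive_const (1 : R) z v.
rewrite h2 in h1.
have alg (m n s r : R) : m * n = 1 -> 0 = r * n + m * (- m * s) -> r = m * (m * m) * s.
  move=> mn h; apply: (@etrans _ _ (m * (r * n + m * (- m * s)) + r * (1 - m * n) + m * (m * m) * s)); first by ring.
  by rewrite -h mn; ring.
exact: (alg _ _ _ _ (wW z) h1).
Qed.

Let Db v z : is_derive z v b (2 * u z * (- (u z * u z) * 'D_v f z) * (W z - 1) + u z * u z * (- w z * Sv v z)).
Proof.
have H := is_derive_add (is_derive_mul (is_derive_mul (Du v z) (Du v z))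
  (is_derive_add (DW v z) (is_derive_const (-1) z v))) (is_derive_const c z v).
have alg (d d' n n' : R) : (d' * d + d * d') * (n + -1) + d * d * (n' + 0) + 0 =
  2 * d * d' * (n - 1) + d * d * n' by ring.
by apply: is_derive_eq H _; exact: alg.
Qed.

Let Dk v z : is_derive z v k (2 * u z * (- (u z * u z) * 'D_v f z) * w z + u z * u z * (w z * (w z * w z) * Sv v z)).
Proof.
have H := is_derive_mul (is_derive_mul (Du v z) (Du v z)) (Dw v z).
have alg (d d' m m' : R) : (d' * d + d * d') * m + d * d * m' = 2 * d * d' * m + d * d * m' by ring.
by apply: is_derive_eq H _; exact: alg.
Qed.

Let Db11 v z := is_derive_add (Db v z) (is_derive_mul (Dk v z) (is_derive_mul (dI z v sq) (dI z v sq))).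
Let Db12 v z := is_derive_opp (is_derive_mul (Dk v z) (is_derive_mul (dI z v sp) (dI z v sq))).
Let Db22 v z := is_derive_add (Db v z) (is_derive_mul (Dk v z) (is_derive_mul (dI z v sp) (dI z v sp))).

Let sym z : 'D_(e 1) p z = 'D_(e 0) q z. Proof. exact: derive_sym. Qed.

Let eqn2 z : w z * (w z * w z) * Sv (e 0) z * p z + w z * 'D_(e 0) p z +
  (w z * (w z * w z) * Sv (e 1) z * q z + w z * 'D_(e 1) q z) = 2 * u z * (w z - 1).
Proof.
have := eqn z; rewrite sum_ord2.
have [_ ->] := is_derive_mul (Dw (e 0) z) (dI z (e 0) sp).
by have [_ ->] := is_derive_mul (Dw (e 1) z) (dI z (e 1) sq).
Qed.

Let closed1 z : 'D_(e 0) b12 z = 'D_(e 1) b11 z.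
Proof.
have alg (x y d m n P Q T : R) :
    m * (m * m) * (x * P + y * Q) * x + m * P + (m * (m * m) * (x * Q + y * T) * y + m * T) =
      2 * d * (m - 1) -> m * (x * x + y * y) = m - n ->
    - ((2 * d * (- (d * d) * x) * m + d * d * (m * (m * m) * (x * P + y * Q))) * (x * y) +
       d * d * m * (P * y + x * Q)) =
    2 * d * (- (d * d) * y) * (n - 1) + d * d * (- m * (x * Q + y * T)) +
      ((2 * d * (- (d * d) * y) * m + d * d * (m * (m * m) * (x * Q + y * T))) * (y * y) +
       d * d * m * (T * y + y * T)).
  move=> E Ew; apply/subr0_eq.
  transitivity (- (y * (d * d)) * ((m * (m * m) * (x * P + y * Q) * x + m * P +
     (m * (m * m) * (x * Q + y * T) * y + m * T)) - 2 * d * (m - 1)) +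
     2 * (d * d * d) * y * (m * (x * x + y * y) - (m - n))); first by ring.
  by rewrite E Ew !subrr !mulr0 addr0.
have [_ h1] := Db12 (e 0) z; have [_ h2] := Db11 (e 1) z.
have E := eqn2 z; rewrite /Sv sym in E.
rewrite [LHS]h1 [RHS]h2 /Sv sym.
exact: (alg _ _ _ _ _ _ _ _ E (wS z)).
Qed.

Let closed2 z : 'D_(e 0) b22 z = 'D_(e 1) b12 z.
Proof.
have alg (x y d m n P Q T : R) :
    m * (m * m) * (x * P + y * Q) * x + m * P + (m * (m * m) * (x * Q + y * T) * y + m * T) =
      2 * d * (m - 1) -> m * (x * x + y * y) = m - n ->
    2 * d * (- (d * d) * x) * (n - 1) + d * d * (- m * (x * P + y * Q)) +
      ((2 * d * (- (d * d) * x) * m + d * d * (m * (m * m) * (x * P + y * Q))) * (x * x) +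
       d * d * m * (P * x + x * P)) =
    - ((2 * d * (- (d * d) * y) * m + d * d * (m * (m * m) * (x * Q + y * T))) * (x * y) +
       d * d * m * (Q * y + x * T)).
  move=> E Ew; apply/subr0_eq.
  transitivity ((x * (d * d)) * ((m * (m * m) * (x * P + y * Q) * x + m * P +
     (m * (m * m) * (x * Q + y * T) * y + m * T)) - 2 * d * (m - 1)) -
     2 * (d * d * d) * x * (m * (x * x + y * y) - (m - n))); first by ring.
  by rewrite E Ew !subrr !mulr0 subr0.
have [_ h1] := Db22 (e 0) z; have [_ h2] := Db12 (e 1) z.
have E := eqn2 z; rewrite /Sv sym in E.
rewrite [LHS]h1 [RHS]h2 /Sv sym.
exact: (alg _ _ _ _ _ _ _ _ E (wS z)).
Qed.

Let u2 z : u z * u z <= t1^-1 * t1^-1 /\ t2^-1 <= u z.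
Proof.
have /andP[h1 h2] := fb z; have fz := f0 z.
have t20 : 0 < t2 by exact: lt_le_trans h2.
have u1 : u z <= t1^-1 by rewrite /u lef_pV2 ?posrE.
split; last by rewrite /u lef_pV2 ?posrE.
by apply: ler_pM => //; rewrite invr_ge0 ltW.
Qed.

Let b1 z : 1 <= b z <= c.
Proof.
have [h1 _] := u2 z; have h0 : 0 <= u z * u z by rewrite -expr2 sqr_ge0.
have h2 : u z * u z * (1 - W z) <= u z * u z.
  by rewrite ler_piMr //; have := W0 z; lra.
have h3 : 0 <= u z * u z * (1 - W z) by rewrite mulr_ge0 //; have := W1 z; lra.
have E : b z = c - u z * u z * (1 - W z) by rewrite /b; ring.
by rewrite E /c; apply/andP; split; lra.
Qed.

Let S0 z : 0 <= S z. Proof. by rewrite addr_ge0 // -expr2 sqr_ge0. Qed.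

Let aE z : a z = u z * u z * (w z - 1) + c.
Proof.
rewrite /a; have -> : k z * S z = u z * u z * (w z * S z) by rewrite /k; ring.
by rewrite wS /b; ring.
Qed.

Let C : R := 2 * c + c * (t2 * t2).

Let c1 : 1 <= c.
Proof. by rewrite lerDr -expr2 sqr_ge0. Qed.

Let C0 : 0 <= C.
Proof.
have c0 : 0 <= c by exact: le_trans c1.
by apply: addr_ge0; apply: mulr_ge0 => //; exact: sqr_ge0 t2.
Qed.

Let aW z : a z * W z <= C * b z.
Proof.
have [h1 _] := u2 z; have /andP[hb _] := b1 z.
have h0 : 0 <= u z * u z by rewrite -expr2 sqr_ge0.
have E : a z * W z = u z * u z * (1 - W z) + c * W z.
  rewrite aE; transitivity (u z * u z * (w z * W z - W z) + c * W z); first by ring.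
  by rewrite wW.
have h2 : u z * u z * (1 - W z) <= u z * u z by rewrite ler_piMr //; have := W0 z; lra.
have h3 : c * W z <= c by rewrite ler_piMr ?W1 // (le_trans _ c1).
have h4 : C <= C * b z by rewrite ler_peMr.
have h5 : 0 <= c * (t2 * t2).
  by apply: mulr_ge0; [exact: le_trans c1|exact: sqr_ge0 t2].
have alg (T uu A B D c' C' : R) : uu <= T -> A <= uu -> B <= c' -> 0 <= D -> c' = T + 1 ->
  C' = 2 * c' + D -> A + B <= C' by lra.
by rewrite E; apply: le_trans h4; exact: (alg _ _ _ _ _ _ _ h1 h2 h3 h5).
Qed.

Let bw z : b z * w z <= C * a z.
Proof.
have [_ h1] := u2 z; have /andP[_ hb] := b1 z; have hw := w1 z.
have t20 : 0 < t2 by have /andP[_ h] := fb z; exact: lt_le_trans h.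
have h2 : 1 <= (t2 * u z) * (t2 * u z).
  have h : 1 <= t2 * u z by rewrite -(divff (lt0r_neq0 t20)) ler_wpM2l // ltW.
  by rewrite -[1]mulr1; apply: ler_pM.
have a0 : 0 <= a z.
  rewrite aE; apply: addr_ge0; last exact: le_trans c1.
  by apply: mulr_ge0; [exact: sqr_ge0 (u z)|rewrite subr_ge0].
have h3 : w z - 1 <= (t2 * u z) * (t2 * u z) * (w z - 1).
  by rewrite ler_peMl // subr_ge0.
have t12 : t1 <= t2 by have /andP[g1 g2] := fb z; exact: le_trans g2.
have h4 : 1 <= t2 * t2 * c.
  have h : 1 <= t2 * t1^-1 by rewrite ler_pdivlMr // mul1r.
  have : 1 <= (t2 * t1^-1) * (t2 * t1^-1) by rewrite -[1]mulr1; apply: ler_pM.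
  have -> : t2 * t2 * c = (t2 * t1^-1) * (t2 * t1^-1) + t2 * t2 by rewrite /c; ring.
  have : 0 <= t2 * t2 by rewrite mulr_ge0 // ltW.
  lra.
have h5 : w z <= t2 * t2 * a z.
  have -> : t2 * t2 * a z = (t2 * u z) * (t2 * u z) * (w z - 1) + t2 * t2 * c by rewrite aE; ring.
  lra.
have cc : 0 <= c by exact: le_trans c1.
apply: (@le_trans _ _ (c * w z)); first by rewrite ler_wpM2r // ltW.
apply: (@le_trans _ _ (c * (t2 * t2 * a z))); first by rewrite ler_wpM2l.
have -> : C * a z = c * (t2 * t2 * a z) + 2 * c * a z by rewrite /C; ring.
by rewrite lerDl !mulr_ge0.
Qed.

Let k0 z : 0 <= k z.
Proof. by apply: mulr_ge0; [exact: sqr_ge0 (u z)|exact: ltW]. Qed.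

(** The equation implies that the symmetric tensor
    T = b I + k Df Df^T, b = f^-2 (1/w - 1) + c, k = f^-2 w,
    is divergence free: it is the stress-energy tensor attached to the
    translations of the plane. In dimension two this says that the rows of its
    cofactor matrix B are closed, so that B is the Jacobian matrix of a map xi
    of the plane. As the constant c makes B at least the identity, xi grows at
    least linearly; and however large w may be, the energy of a function
    of xi is controlled by its Dirichlet energy in the xi-plane. *)
Lemma conjugate_coordinates : exists (B11 B12 B22 xi1 xi2 : 'rV[R]_2 -> R) (C : R),
  [/\ [/\ 0 <= C, smooth_on setT B11, smooth_on setT B12 & smooth_on setT B22],
      [/\ smooth_on setT xi1, smooth_on setT xi2,
        forall z v, is_derive z v xi1 (v 0 0 * B11 z + v 0 1 * B12 z) &
        forall z v, is_derive z v xi2 (v 0 0 * B12 z + v 0 1 * B22 z)],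
      forall z, 0 <= B11 z * B22 z - B12 z * B12 z,
      forall z x y y0 y1, y0 = B11 z * x + B12 z * y -> y1 = B12 z * x + B22 z * y ->
        (w z)^-1 * (y0 * y0 + y1 * y1) + w z * ('D_(e 0) f z * y0 + 'D_(e 1) f z * y1) ^+ 2 <=
        C * (B11 z * B22 z - B12 z * B12 z) * (x * x + y * y) &
      forall z : 'rV[R]_2, z 0 0 * z 0 0 + z 0 1 * z 0 1 <= xi1 z * xi1 z + xi2 z * xi2 z].
Proof.
have [xi1 [sx1 x10 D1]] := closed_form_primitive sb11 sb12 closed1.
have [xi2 [sx2 x20 D2]] := closed_form_primitive sb12 sb22 closed2.
have dE z : b11 z * b22 z - b12 z * b12 z = b z * a z.
  have alg (B K x y : R) : (B + K * (y * y)) * (B + K * (x * x)) - - (K * (x * y)) * - (K * (x * y)) =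
    B * (B + K * (x * x + y * y)) by ring.
  exact: alg.
have b0 z : 0 <= b z by have /andP[h _] := b1 z; exact: le_trans h.
have a0 z : 0 <= a z by apply: addr_ge0 => //; exact: mulr_ge0.
exists b11, b12, b22, xi1, xi2, C; split=> //; first by move=> z; rewrite dE mulr_ge0.
  move=> z x y _ _ -> ->; rewrite dE; have Ew : W z + w z * S z = w z by rewrite wS addrC subrK.
  exact: (cofactor_energy x y (ltW (W0 z)) Ew (b0 z) (a0 z) (aW z) (bw z)).
move=> z; pose h (t : R) := z 0 0 * xi1 (t *: z) + z 0 1 * xi2 (t *: z).
pose dh (t : R) := z 0 0 * (z 0 0 * b11 (t *: z) + z 0 1 * b12 (t *: z)) +
   z 0 1 * (z 0 0 * b12 (t *: z) + z 0 1 * b22 (t *: z)).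
have line (F : 'rV[R]_2 -> R) (l t : R) : smooth_on setT F -> is_derive (t *: z) z F l ->
    is_derive t (1 : R) (fun t : R => F (t *: z)) l.
  move=> sF [_ <-]; have d : differentiable F (0 + t *: z) by exact: smooth_differentiable.
  have := is_derive_line d; rewrite add0r.
  by have -> // : (fun s : R => F (0 + s *: z)) = (fun s : R => F (s *: z)) by apply/funext => s; rewrite add0r.
have Hh (t : R) : is_derive t (1 : R) h (dh t).
  have H1 := is_derive_mul (is_derive_const (z 0 0) t (1 : R)) (line xi1 _ t sx1 (D1 _ z)).
  have H2 := is_derive_mul (is_derive_const (z 0 1) t (1 : R)) (line xi2 _ t sx2 (D2 _ z)).
  by apply: is_derive_eq (is_derive_add H1 H2) _; rewrite !mul0r !add0r.
have [t _ E] : exists2 t, t \in `]0, 1[%R & h 1 - h 0 = dh t * (1 - 0).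
  by apply: MVT => //; apply: derivable_within_continuous => x _; case: (Hh x).
have E1 : dh t = h 1.
  by rewrite -[dh t]mulr1 -[X in _ * X]subr0 -E /h scale0r x10 x20 !mulr0 addr0 subr0.
have lower (x y B K P Q : R) : 1 <= B -> 0 <= K ->
    x * x + y * y <= x * (x * (B + K * (Q * Q)) + y * (- (K * (P * Q)))) +
      y * (x * (- (K * (P * Q))) + y * (B + K * (P * P))).
  move=> B1 K0; rewrite -subr_ge0.
  set X := (X in 0 <= X); have -> : X = (B - 1) * (x ^+ 2 + y ^+ 2) + K * (x * Q - y * P) ^+ 2.
    by rewrite /X; ring.
  by rewrite addr_ge0 // mulr_ge0 ?subr_ge0 ?addr_ge0 ?sqr_ge0.
have /andP[bt _] := b1 (t *: z).
have := lower (z 0 0) (z 0 1) _ _ (p (t *: z)) (q (t *: z)) bt (k0 (t *: z)).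
rewrite -/(b12 (t *: z)) -/(b11 (t *: z)) -/(b22 (t *: z)) -/(dh t) E1 /h scale1r.
have cs (x y X Y : R) : x * x + y * y <= x * X + y * Y -> x * x + y * y <= X * X + Y * Y.
  move=> H; have : 0 <= (X - x) ^+ 2 + (Y - y) ^+ 2 by rewrite addr_ge0 ?sqr_ge0.
  have -> : (X - x) ^+ 2 + (Y - y) ^+ 2 = X * X + Y * Y - 2 * (x * X + y * Y) + (x * x + y * y) by ring.
  lra.
exact: cs.
Qed.

End Liouville.

(** * The logarithmic cutoff argument *)

Section Caccioppoli.
Context {R : realType}.
Local Notation e i := (delta_mx 0 i : 'rV[R]_2).
Variables (f w : 'rV[R]_2 -> R) (t1 t2 : R).
Hypotheses (sf : smooth_on setT f) (sw : smooth_on setT w) (t10 : 0 < t1).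
Hypotheses (fb : forall z, t1 <= f z <= t2) (w0 : forall z, 0 < w z).
Hypothesis wE : forall z, w z ^+ 2 = 1 + w z ^+ 2 * \sum_i ('D_(e i) f z) ^+ 2.
Hypothesis eqn : forall z, \sum_i 'D_(e i) (fun z => w z * 'D_(e i) f z : R) z =
  2%:R / f z * (w z - 1).
Variables (B11 B12 B22 xi1 xi2 : 'rV[R]_2 -> R) (C : R).
Hypotheses (C0 : 0 <= C) (sB11 : smooth_on setT B11) (sB12 : smooth_on setT B12).
Hypotheses (sB22 : smooth_on setT B22) (sx1 : smooth_on setT xi1) (sx2 : smooth_on setT xi2).
Hypothesis D1 : forall z v, is_derive z v xi1 (v 0 0 * B11 z + v 0 1 * B12 z).
Hypothesis D2 : forall z v, is_derive z v xi2 (v 0 0 * B12 z + v 0 1 * B22 z).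
Hypothesis det0 : forall z, 0 <= B11 z * B22 z - B12 z * B12 z.
Hypothesis energy : forall z x y y0 y1, y0 = B11 z * x + B12 z * y -> y1 = B12 z * x + B22 z * y ->
  (w z)^-1 * (y0 * y0 + y1 * y1) + w z * ('D_(e 0) f z * y0 + 'D_(e 1) f z * y1) ^+ 2 <=
  C * (B11 z * B22 z - B12 z * B12 z) * (x * x + y * y).
Hypothesis coercive : forall z : 'rV[R]_2,
  z 0 0 * z 0 0 + z 0 1 * z 0 1 <= xi1 z * xi1 z + xi2 z * xi2 z.

Let p z : R := 'D_(e 0) f z.
Let q z : R := 'D_(e 1) f z.
Let sp : smooth_on setT p. Proof. exact: smooth_derive. Qed.
Let sq : smooth_on setT q. Proof. exact: smooth_derive. Qed.
Let s z : R := xi1 z * xi1 z + xi2 z * xi2 z.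
Let d z : R := B11 z * B22 z - B12 z * B12 z.
Let E z : R := w z * (p z * p z + q z * q z).
Let sE : smooth_on setT E.
Proof. by apply: smoothM => //; apply: smoothD; exact: smoothM. Qed.
Let ss : smooth_on setT s. Proof. by apply: smoothD; exact: smoothM. Qed.
Let s0 z : 0 <= s z. Proof. by apply: addr_ge0; [exact: sqr_ge0 (xi1 z)|exact: sqr_ge0 (xi2 z)]. Qed.
Let E0 z : 0 <= E z.
Proof.
apply: mulr_ge0; first exact: ltW.
by apply: addr_ge0; [exact: sqr_ge0 (p z)|exact: sqr_ge0 (q z)].
Qed.

Let dI z v (F : 'rV[R]_2 -> R) (sF : smooth_on setT F) := diff_is_derive v (smooth_differentiable z sF).

Let D10 z : is_derive z (e 0) xi1 (B11 z).
Proof. by apply: is_derive_eq (D1 z (e 0)) _; rewrite !mxE /= mul1r mul0r addr0. Qed.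
Let D11 z : is_derive z (e 1) xi1 (B12 z).
Proof. by apply: is_derive_eq (D1 z (e 1)) _; rewrite !mxE /= mul1r mul0r add0r. Qed.
Let D20 z : is_derive z (e 0) xi2 (B12 z).
Proof. by apply: is_derive_eq (D2 z (e 0)) _; rewrite !mxE /= mul1r mul0r addr0. Qed.
Let D21 z : is_derive z (e 1) xi2 (B22 z).
Proof. by apply: is_derive_eq (D2 z (e 1)) _; rewrite !mxE /= mul1r mul0r add0r. Qed.

Let closed1 z : 'D_(e 0) B12 z = 'D_(e 1) B11 z.
Proof.
have <- : (fun x => 'D_(e 1) xi1 x : R) = B12 by apply/funext => x; case: (D11 x).
have <- : (fun x => 'D_(e 0) xi1 x : R) = B11 by apply/funext => x; case: (D10 x).
exact: derive_sym.
Qed.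

Let closed2 z : 'D_(e 0) B22 z = 'D_(e 1) B12 z.
Proof.
have <- : (fun x => 'D_(e 1) xi2 x : R) = B22 by apply/funext => x; case: (D21 x).
have <- : (fun x => 'D_(e 0) xi2 x : R) = B12 by apply/funext => x; case: (D20 x).
exact: derive_sym.
Qed.

Let s_0 z : R := 2 * (xi1 z * B11 z + xi2 z * B12 z).
Let s_1 z : R := 2 * (xi1 z * B12 z + xi2 z * B22 z).

Let alg2 (x y a b : R) : a * x + x * a + (b * y + y * b) = 2 * (x * a + y * b).
Proof. by ring. Qed.

Let Ds0 z : is_derive z (e 0) s (s_0 z).
Proof.
apply: is_derive_eq (is_derive_add (is_derive_mul (D10 z) (D10 z)) (is_derive_mul (D20 z) (D20 z))) _.
exact: alg2.
Qed.

Let Ds1 z : is_derive z (e 1) s (s_1 z).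
Proof.
apply: is_derive_eq (is_derive_add (is_derive_mul (D11 z) (D11 z)) (is_derive_mul (D21 z) (D21 z))) _.
exact: alg2.
Qed.

Let ccut : Ck 0 setT (fun z => Num.max (1 - s z) 0 * d z : R).
Proof.
have sd : smooth_on setT d.
  by apply: smoothD; [exact: smoothM|apply: smoothN; exact: smoothM].
apply: (CkM openT _ (sd 0)); apply: Ck0_max; last exact: Ck_cst.
exact: (CkD openT (Ck_cst 0 setT (1 : R)) (smoothN ss 0)).
Qed.

Section Cutoff.
Variables (ep K : R).
Hypotheses (ep0 : 0 < ep) (KE : K = 8 * t2 * C * ep).

Let r z : R := (1 + s z)^-1.
Let x z : R := 1 + - (ep * ln (1 + s z)).
Let X z : R := Num.max (x z) 0.
Let G z : R := pos_sq (x z).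
Let m z : R := radial_weight (s z).
Let m' z : R := radial_weight' (s z).
Let V0 z : R := w z * p z.
Let V1 z : R := w z * q z.
Let Y0 z : R := B22 z * xi1 z + - (B12 z * xi2 z).
Let Y1 z : R := - (B12 z * xi1 z) + B11 z * xi2 z.
Let Z0 z : R := G z * (G z * V0 z + - (K * (m z * Y0 z))).
Let Z1 z : R := G z * (G z * V1 z + - (K * (m z * Y1 z))).

Let s1 z : 0 < 1 + s z. Proof. by rewrite ltr_wpDr. Qed.
Let s11 : smooth_on setT (fun z => 1 + s z : R).
Proof. by apply: smoothD => //; exact: smooth_cst. Qed.

Let cr : Ck 0 setT r.
Proof. by apply: (smoothV _ s11) => z; rewrite gt_eqF. Qed.

Let cx : Ck 1 setT x.
Proof.
apply: CkD; [exact: openT|exact: Ck_cst|].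
apply: (@Ck_ext _ _ _ _ setT (fun z => - ep * ln (1 + s z) : R)); [exact: openT|by move=> z _; rewrite mulNr|].
apply: CkM; [exact: openT|exact: Ck_cst|].
apply: (@Ck1_comp _ _ (@ln R) (fun t => t^-1) _ (s11 1)); last exact: cr.
by move=> z; exact: is_derive1_ln.
Qed.

Let cX : Ck 0 setT X.
Proof. by apply: Ck0_max; [exact: CkS cx|exact: Ck_cst]. Qed.

Let cG : Ck 1 setT G.
Proof.
apply: (@Ck1_comp _ _ pos_sq (fun t => 2 * Num.max t 0) _ cx).
  by move=> z; exact: is_derive_pos_sq.
by apply: CkM; [exact: openT|exact: Ck_cst|exact: cX].
Qed.

Let cm : Ck 1 setT m.
Proof.
apply: (@Ck1_comp _ _ radial_weight radial_weight' _ (ss 1)).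
  by move=> z; exact: is_derive_radial_weight.
pose M z : R := (Num.max (s z) 1)^-1.
have cM : Ck 0 setT M.
  apply: CkV; [exact: openT| |by apply: Ck0_max; [exact: ss|exact: Ck_cst]].
  by move=> z _; rewrite gt_eqF // lt_max ltr01 orbT.
apply: (@Ck_ext _ _ _ _ setT (fun z => -1 * (M z * M z) : R)); first exact: openT.
  by move=> z _; rewrite mulN1r.
exact: (CkM openT (Ck_cst 0 setT (-1 : R)) (CkM openT cM cM)).
Qed.

Let cZ (V Y : 'rV[R]_2 -> R) : smooth_on setT V -> smooth_on setT Y ->
  Ck 1 setT (fun z => G z * (G z * V z + - (K * (m z * Y z))) : R).
Proof.
move=> sV sY.
have cN : Ck 1 setT (fun z => - (K * (m z * Y z)) : R).
  apply: (@Ck_ext _ _ _ _ setT (fun z => - K * (m z * Y z) : R)); [exact: openT|by move=> z _; rewrite mulNr|].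
  exact: (CkM openT (Ck_cst 1 setT (- K)) (CkM openT cm (sY 1))).
exact: (CkM openT cG (CkD openT (CkM openT cG (sV 1)) cN)).
Qed.

Let sV0 : smooth_on setT V0. Proof. exact: smoothM. Qed.
Let sV1 : smooth_on setT V1. Proof. exact: smoothM. Qed.
Let sY0 : smooth_on setT Y0.
Proof. by apply: smoothD; [exact: smoothM|apply: smoothN; exact: smoothM]. Qed.
Let sY1 : smooth_on setT Y1.
Proof. by apply: smoothD; [apply: smoothN; exact: smoothM|exact: smoothM]. Qed.
Let cZ0 : Ck 1 setT Z0. Proof. exact: (cZ sV0 sY0). Qed.
Let cZ1 : Ck 1 setT Z1. Proof. exact: (cZ sV1 sY1). Qed.

Let x_ (si : 'rV[R]_2 -> R) z : R := - (ep * (r z * si z)).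

Let Dx v (si : 'rV[R]_2 -> R) : (forall z, is_derive z v s (si z)) ->
  forall z, is_derive z v x (x_ si z).
Proof.
move=> Hs z.
have H1 := is_derive_add (is_derive_const (1 : R) z v) (Hs z).
have H2 := is_derive_chain v (smooth_differentiable z s11) (is_derive1_ln (s1 z)).
have [_ h1] := H1; rewrite h1 add0r in H2.
have H3 := is_derive_add (is_derive_const (1 : R) z v)
  (is_derive_opp (is_derive_mul (is_derive_const ep z v) H2)).
by apply: is_derive_eq H3 _; rewrite mul0r !add0r.
Qed.

Let DG v (si : 'rV[R]_2 -> R) : (forall z, is_derive z v s (si z)) ->
  forall z, is_derive z v G (2 * X z * x_ si z).
Proof.
move=> Hs z; have [dx _] := cx; have [_ h] := Dx Hs z.
by have := is_derive_chain v (dx z I) (is_derive_pos_sq (x z)); rewrite h.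
Qed.

Let Dm v (si : 'rV[R]_2 -> R) : (forall z, is_derive z v s (si z)) ->
  forall z, is_derive z v m (m' z * si z).
Proof.
move=> Hs z; have [_ h] := Hs z.
by have := is_derive_chain v (smooth_differentiable z ss) (is_derive_radial_weight (s z)); rewrite h.
Qed.

Let DY0 z : is_derive z (e 0) Y0 ('D_(e 0) B22 z * xi1 z + B22 z * B11 z +
  - ('D_(e 0) B12 z * xi2 z + B12 z * B12 z)).
Proof.
exact: (is_derive_add (is_derive_mul (dI z (e 0) sB22) (D10 z))
  (is_derive_opp (is_derive_mul (dI z (e 0) sB12) (D20 z)))).
Qed.

Let DY1 z : is_derive z (e 1) Y1 (- ('D_(e 1) B12 z * xi1 z + B12 z * B12 z) +
  ('D_(e 1) B11 z * xi2 z + B11 z * B22 z)).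
Proof.
exact: (is_derive_add (is_derive_opp (is_derive_mul (dI z (e 1) sB12) (D11 z)))
  (is_derive_mul (dI z (e 1) sB11) (D21 z))).
Qed.

Let DZ v (si V Y : 'rV[R]_2 -> R) V' Y' z : (forall z, is_derive z v s (si z)) ->
  is_derive z v V V' -> is_derive z v Y Y' ->
  is_derive z v (fun z => G z * (G z * V z + - (K * (m z * Y z))) : R)
   (2 * X z * x_ si z * (G z * V z + - (K * (m z * Y z))) +
    G z * (2 * X z * x_ si z * V z + G z * V' +
      - (0 * (m z * Y z) + K * (m' z * si z * Y z + m z * Y')))).
Proof.
move=> Hs HV HY.
exact: (is_derive_mul (DG Hs z) (is_derive_add (is_derive_mul (DG Hs z) HV)
  (is_derive_opp (is_derive_mul (is_derive_const K z v) (is_derive_mul (Dm Hs z) HY))))).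
Qed.

Let vV z : R := 2 / f z * (w z - 1).

Let divV z : 'D_(e 0) V0 z + 'D_(e 1) V1 z = vV z.
Proof. by have := eqn z; rewrite sum_ord2. Qed.

Let divZ z : 'D_(e 0) Z0 z + 'D_(e 1) Z1 z =
  4 * X z ^+ 3 * (V0 z * x_ s_0 z + V1 z * x_ s_1 z) + 4 * K * X z * ep * m z * r z * d z * s z +
  X z ^+ 4 * vV z - 2 * X z ^+ 2 * K * d z * (m z + s z * m' z).
Proof.
have [_ h0] := DZ Ds0 (dI z (e 0) sV0) (DY0 z).
have [_ h1] := DZ Ds1 (dI z (e 1) sV1) (DY1 z).
rewrite [X in X + _]h0 [X in _ + X]h1 closed1 closed2 -divV.
have alg (xx k mm mm' b11 b12 b22 a1 a2 rr V W V' W' g h : R) :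
  let S0 := 2 * (a1 * b11 + a2 * b12) in let S1 := 2 * (a1 * b12 + a2 * b22) in
  let x0 := - (ep * (rr * S0)) in let x1 := - (ep * (rr * S1)) in
  let y0 := b22 * a1 + - (b12 * a2) in let y1 := - (b12 * a1) + b11 * a2 in
  2 * xx * x0 * (xx ^+ 2 * V + - (k * (mm * y0))) +
    xx ^+ 2 * (2 * xx * x0 * V + xx ^+ 2 * V' + - (0 * (mm * y0) + k * (mm' * S0 * y0 + mm *
      (g * a1 + b22 * b11 + - (h * a2 + b12 * b12))))) +
  (2 * xx * x1 * (xx ^+ 2 * W + - (k * (mm * y1))) +
    xx ^+ 2 * (2 * xx * x1 * W + xx ^+ 2 * W' + - (0 * (mm * y1) + k * (mm' * S1 * y1 + mm *
      (- (g * a1 + b12 * b12) + (h * a2 + b11 * b22)))))) =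
  4 * xx ^+ 3 * (V * x0 + W * x1) +
    4 * k * xx * ep * mm * rr * (b11 * b22 - b12 * b12) * (a1 * a1 + a2 * a2) +
    xx ^+ 4 * (V' + W') -
    2 * xx ^+ 2 * k * (b11 * b22 - b12 * b12) * (mm + (a1 * a1 + a2 * a2) * mm').
  by move=> /=; ring.
exact: alg.
Qed.

Let wS z : (w z)^-1 + E z = w z.
Proof.
have wn0 : w z != 0 by rewrite gt_eqF.
apply: (mulfI wn0); rewrite mulrDr divff //.
apply: (@etrans _ _ (1 + w z ^+ 2 * \sum_i ('D_(e i) f z) ^+ 2)); last by rewrite -wE expr2.
rewrite sum_ord2 /E -/(p z) -/(q z); move: (w z) (p z) (q z) => a b c; ring.
Qed.

(** The divergence of the field G (G w Df - K m T xi), where G = X^2, bounds the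
    energy density where X is positive, up to a term supported in |xi| <= 1.
    Here div(T m xi) = (2 m + 2 s m') det B because T is divergence free and
    T B = (det B) I; it replaces the change of variables by xi in the integral
    of the cutoff energy. *)
Lemma cutoff_pointwise z :
  X z ^+ 4 * E z / (2 * t2) <=
  'D_(e 0) Z0 z + 'D_(e 1) Z1 z + 4 * K * (Num.max (1 - s z) 0 * d z).
Proof.
have /andP[f1 f2] := fb z; have fz : 0 < f z by exact: lt_le_trans f1.
have t20 : 0 < t2 by exact: lt_le_trans f2.
have wz := w0 z; have Wz : 0 < (w z)^-1 by rewrite invr_gt0.
have wW : w z * (w z)^-1 = 1 by rewrite divff // gt_eqF.
have r0 : 0 < r z by rewrite invr_gt0.
have X0 : 0 <= X z by rewrite le_max lexx orbT.
have X1 : X z <= 1.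
  rewrite ge_max ler01 andbT gerDl oppr_le0 mulr_ge0 ?(ltW ep0) // ln_ge0 // lerDl //.
pose Q := (w z)^-1 * (x_ s_0 z * x_ s_0 z + x_ s_1 z * x_ s_1 z) +
  w z * (p z * x_ s_0 z + q z * x_ s_1 z) ^+ 2.
have Q0 : 0 <= Q.
  apply: addr_ge0; apply: mulr_ge0; [exact: ltW| |exact: ltW|exact: sqr_ge0].
  by apply: addr_ge0; [exact: sqr_ge0 (x_ s_0 z)|exact: sqr_ge0 (x_ s_1 z)].
have DEQ : (V0 z * x_ s_0 z + V1 z * x_ s_1 z) ^+ 2 <= E z * Q.
  have -> : V0 z * x_ s_0 z + V1 z * x_ s_1 z = w z * (p z * x_ s_0 z + q z * x_ s_1 z).
    by rewrite mulrDr !mulrA.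
  exact: (tilt_cauchy_schwarz (x_ s_0 z) (x_ s_1 z) wW (wS z)).
have QC : Q <= (2 * ep * r z) ^+ 2 * (C * d z * s z).
  have H := @energy z (xi1 z) (xi2 z) _ _ erefl erefl.
  have H2 := ler_wpM2l (sqr_ge0 (2 * ep * r z)) H.
  have alg (k1 k2 P P' b11 b12 b22 a1 a2 rr : R) :
    let S0 := - (ep * (rr * (2 * (a1 * b11 + a2 * b12)))) in
    let S1 := - (ep * (rr * (2 * (a1 * b12 + a2 * b22)))) in
    k2 * (S0 * S0 + S1 * S1) + k1 * (P * S0 + P' * S1) ^+ 2 =
    (2 * ep * rr) ^+ 2 * (k2 * ((b11 * a1 + b12 * a2) * (b11 * a1 + b12 * a2) +
       (b12 * a1 + b22 * a2) * (b12 * a1 + b22 * a2)) +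
       k1 * (P * (b11 * a1 + b12 * a2) + P' * (b12 * a1 + b22 * a2)) ^+ 2).
    by move=> /=; ring.
  apply: le_trans H2; rewrite le_eqVlt; apply/orP; left; apply/eqP.
  exact: (alg (w z) (w z)^-1 (p z) (q z) (B11 z) (B12 z) (B22 z) (xi1 z) (xi2 z) (r z)).
have EV : E z / t2 <= vV z.
  have w1 : 1 <= w z by exact: (tilt_ge1 w0 wE).
  have W1 : (w z)^-1 <= 1 by rewrite invf_le1.
  have h1 : E z <= 2 * (w z - 1).
    have : 0 <= (w z - 1) * (1 - (w z)^-1) by rewrite mulr_ge0 // subr_ge0.
    have -> : (w z - 1) * (1 - (w z)^-1) = w z + (w z)^-1 - 1 - w z * (w z)^-1.
      by move: (w z) (w z)^-1 => a b; ring.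
    have alg (a b c : R) : b + c = a -> 0 <= a + b - 1 - 1 -> c <= 2 * (a - 1) by lra.
    by rewrite wW; exact: alg (wS z).
  have h2 : t2^-1 <= (f z)^-1 by rewrite lef_pV2 ?posrE.
  have -> : vV z = 2 * (w z - 1) * (f z)^-1 by rewrite /vV mulrAC.
  by apply: ler_pM => //; rewrite invr_ge0 ltW.
have mE : m z + s z * m' z = 2 * Num.max (1 - s z) 0 by exact: radial_weight_flux.
apply: (cutoff_inequality t20 _ (E0 z) Q0 DEQ C0 (ltW ep0) (s0 z) (det0 z) (ltW r0)
  (radial_weight_ge (s0 z)) _ KE QC EV mE (divZ z)).
  by rewrite X0.
by rewrite le_max lexx orbT.
Qed.

Let large_radius (L : R) (z : 'rV[R]_2) : 1 <= L -> expR ep^-1 <= L ->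
  L <= `|z 0 0| \/ L <= `|z 0 1| -> G z = 0.
Proof.
move=> L1 eL zL.
have Ls : L <= s z.
  apply: le_trans (coercive z).
  have sqL (y : R) : L <= `|y| -> L <= y * y.
    move=> yL; have -> : y * y = `|y| * `|y| by rewrite -normrM ger0_norm // -expr2 sqr_ge0.
    by apply: (le_trans yL); rewrite ler_peMl // (le_trans L1).
  have n0 := sqr_ge0 (z 0 0); have n1 := sqr_ge0 (z 0 1).
  by case: zL => /sqL h; apply: (le_trans h); rewrite ?lerDl ?lerDr -expr2.
have h : ep^-1 <= ln (1 + s z).
  rewrite -[ep^-1]expRK ler_ln ?posrE ?expR_gt0 //.
  by apply: (le_trans eL); apply: (le_trans Ls); rewrite lerDr.
have x0 : x z <= 0.
  have := ler_wpM2l (ltW ep0) h; rewrite mulfV ?gt_eqF // => h1.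
  by rewrite subr_le0.
by rewrite /G /pos_sq max_r // expr0n.
Qed.

Lemma cutoff_energy_continuous : Ck 0 setT (fun z => X z ^+ 4 * E z / (2 * t2) : R).
Proof.
have cXX := CkM openT cX cX.
apply: (Ck_ext openT _ (CkM openT (CkM openT (CkM openT cXX cXX) (sE 0)) (Ck_cst 0 setT (2 * t2)^-1))).
by move=> z _; congr (_ * _ * _); rewrite !exprS expr0 mulr1 !mulrA.
Qed.

(** On a large box the divergence integrates to zero, and the remaining term
    lives on the fixed set where |xi| <= 1. *)
Lemma cutoff_integral_le (L0 : R) : 0 <= L0 ->
  box_integral L0 (fun z => X z ^+ 4 * E z / (2 * t2)) <=
  4 * K * box_integral 1 (fun z => Num.max (1 - s z) 0 * d z).
Proof.
move=> L00; have t20 : 0 < t2 by have /andP[h1 h2] := fb 0; exact: lt_le_trans (le_trans h1 h2).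
(* The cutoff vanishes as soon as |xi|^2 >= exp (1 / ep). *)
pose L := L0 + expR ep^-1 + 1.
have e0 := expR_gt0 ep^-1.
have L1 : 1 <= L by rewrite /L; move: (expR _) e0 => y y0; lra.
have Le : expR ep^-1 <= L by rewrite /L; move: (expR _) e0 => y y0; lra.
have L0L : L0 <= L by rewrite /L; move: (expR _) e0 => y y0; lra.
have Lpos : 0 < L by exact: lt_le_trans L1.
have nonneg z : 0 <= X z ^+ 4 * E z / (2 * t2).
  apply: divr_ge0; last by apply: mulr_ge0 => //; exact: ltW.
  by apply: mulr_ge0 => //; apply: exprn_ge0; rewrite le_max lexx orbT.
apply: (le_trans (box_integral_mono L00 L0L cutoff_energy_continuous nonneg)).
have [_ dZ0] := cZ0; have [_ dZ1] := cZ1.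
have cdiv := @CkD _ _ _ 0 setT _ _ openT (dZ0 (e 0)) (dZ1 (e 1)).
have crhs := CkM openT (Ck_cst 0 setT (4 * K)) ccut.
apply: (le_trans (box_integral_le cutoff_energy_continuous (CkD openT cdiv crhs) (fun z _ _ => cutoff_pointwise z))).
rewrite (box_integralD L cdiv crhs) (box_integralZ L (4 * K) ccut).
rewrite (box_divergence Lpos cZ0 cZ1).
  rewrite add0r (@box_integral_support _ 1 L) //.
  move=> z z1; suff -> : Num.max (1 - s z) 0 = 0 by rewrite mul0r.
  apply: max_r; rewrite subr_le0; apply: le_trans (coercive z).
  have sqL (y : R) : 1 <= `|y| -> 1 <= y * y.
    move=> y1; have -> : y * y = `|y| * `|y| by rewrite -normrM ger0_norm // -expr2 sqr_ge0.
    by rewrite -[X in X <= _]mulr1; apply: ler_pM.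
  have n0 := sqr_ge0 (z 0 0); have n1 := sqr_ge0 (z 0 1).
  by case: z1 => /sqL h; apply: (le_trans h); rewrite ?lerDl ?lerDr -expr2.
by move=> z /(large_radius L1 Le) Gz; rewrite /Z0 /Z1 Gz !mul0r.
Qed.

End Cutoff.

(** The right-hand side of cutoff_integral_le is O(ep) while the cutoff tends
    to 1 on every box. *)
Lemma gradient_eq0 z : p z = 0 /\ q z = 0.
Proof.
have t20 : 0 < t2 by have /andP[h1 h2] := fb 0; exact: lt_le_trans (le_trans h1 h2).
(* A point of positive energy is impossible: the energy in a fixed square is
   bounded by a multiple of ep. *)
have [Ez|] := leP (E z) 0.
  have : p z * p z + q z * q z <= 0 by rewrite -(pmulr_rle0 _ (w0 z)).
  have n0 := sqr_ge0 (p z); have n1 := sqr_ge0 (q z).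
  rewrite -!expr2 => h.
  have /eqP : p z ^+ 2 = 0 by apply/eqP; rewrite eq_le; apply/andP; split => //; lra.
  have /eqP : q z ^+ 2 = 0 by apply/eqP; rewrite eq_le; apply/andP; split => //; lra.
  by rewrite !sqrf_eq0 => /eqP -> /eqP ->.
move=> Ez; exfalso.
have [L L0 I0] := box_integral_gt0 (sE 0) E0 Ez.
have [S S0 HS] := bounded_on_ball L (Ck0_continuous (ss 0)).
set J := box_integral 1 (fun z => Num.max (1 - s z) 0 * d z).
set I := box_integral L E in I0.
have J0 : 0 <= J.
  apply: (box_integral_ge0 ler01 ccut) => y; apply: mulr_ge0; last exact: det0.
  by rewrite le_max lexx orbT.
have l0 : 0 <= ln (1 + S) by rewrite ln_ge0 // lerDl.
(* The first bound makes the cutoff at least 1/2 on the square of size L, the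
   second makes the right-hand side smaller than the energy there. *)
have [ep [ep0 ep1 ep2]] : exists ep : R,
    [/\ 0 < ep, ep * ln (1 + S) <= 1 / 2 & ep * (1024 * t2 * t2 * C * J) < I].
  have A0 : 0 <= 1024 * t2 * t2 * C * J.
    exact: (mulr_ge0 (mulr_ge0 (mulr_ge0 (mulr_ge0 (ler0n _ _) (ltW t20)) (ltW t20)) C0) J0).
  move: (1024 * t2 * t2 * C * J) (ln (1 + S)) A0 l0 (I) I0 => A l A0 l0 c c0.
  have A1 : 0 <= A / c by rewrite divr_ge0 // ltW.
  have T0 : 0 < 2 * l + A / c + 1 by rewrite ltr_wpDl // addr_ge0 // mulr_ge0.
  exists (2 * l + A / c + 1)^-1; split; first by rewrite invr_gt0.
    by rewrite mulrC ler_pdivrMr // mulrDr mulrDr; move: (A / c) A1 => y y0; lra.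
  by rewrite mulrC ltr_pdivrMr // -ltr_pdivrMl // mulrC; move: (A / c) A1 => y y0; lra.
have := cutoff_integral_le ep0 erefl (ltW L0).
rewrite -/J leNgt => /negP; apply.
have lower : 1 / 16 / (2 * t2) * I <= box_integral L (fun z =>
    Num.max (1 + - (ep * ln (1 + s z))) 0 ^+ 4 * E z / (2 * t2)).
  rewrite -box_integralZ; last exact: (sE 0).
  apply: box_integral_le; [exact: (CkM openT (Ck_cst _ _ _) (sE 0))|exact: cutoff_energy_continuous|].
  move=> y y0 y1; have sS : s y <= S.
    have := HS y (mx_norm_le (ltW L0) _); rewrite ger0_norm //; apply.
    by move=> i j; rewrite ord1; case: (ord2P j) => ->.
  have xl : 1 / 2 <= Num.max (1 + - (ep * ln (1 + s y))) 0.
    rewrite le_max; apply/orP; left.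
    have : ep * ln (1 + s y) <= ep * ln (1 + S).
      rewrite ler_wpM2l ?(ltW ep0) // ler_ln ?posrE ?lerD2l //; first by rewrite ltr_wpDr.
      by rewrite ltr_wpDr.
    lra.
  rewrite mulrAC ler_wpM2r ?invr_ge0 ?mulr_ge0 ?(ltW t20) //.
  rewrite ler_wpM2r //; have -> : 1 / 16 = (1 / 2) ^+ 4 :> R by field.
  by apply: lerXn2r => //; rewrite nnegrE; lra.
apply: lt_le_trans lower.
have -> : 1 / 16 / (2 * t2) * I = I / (32 * t2) by field; rewrite gt_eqF.
rewrite ltr_pdivlMr ?mulr_gt0 //.
by have -> : 4 * (8 * t2 * C * ep) * J * (32 * t2) = ep * (1024 * t2 * t2 * C * J) by ring.
Qed.

End Caccioppoli.

Section Liouville.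
Context {R : realType}.
Local Notation e i := (delta_mx 0 i : 'rV[R]_2).

(** A Bernstein theorem in which bounds on the height take the place of a bound on
    the gradient. *)
Theorem bounded_entire_solution_cst (f w : 'rV[R]_2 -> R) (t1 t2 : R) :
  smooth_on setT f -> smooth_on setT w -> 0 < t1 -> (forall z, t1 <= f z <= t2) ->
  (forall z, 0 < w z) ->
  (forall z, w z ^+ 2 = 1 + w z ^+ 2 * \sum_i ('D_(e i) f z) ^+ 2) ->
  (forall z, \sum_i 'D_(e i) (fun z => w z * 'D_(e i) f z : R) z = 2%:R / f z * (w z - 1)) ->
  forall z, f z = f 0.
Proof.
move=> sf sw t10 fb w0 wE eqn.
have [B11 [B12 [B22 [xi1 [xi2 [C [[C0 s11 s12 s22] [sx1 sx2 D1 D2] det0 en co]]]]]]] :=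
  conjugate_coordinates sf sw t10 fb w0 wE eqn.
have grad := gradient_eq0 sf sw t10 fb w0 wE eqn C0 s11 s12 s22 sx1 sx2 D1 D2 det0 en co.
have D z v : 'D_v f z = 0.
  rewrite (derive_sum_coord v (smooth_differentiable z sf)) sum_ord2.
  by have [-> ->] := grad z; rewrite !scaler0 addr0.
move=> z; pose g (t : R) := f (0 + t *: z); pose dg (t : R) : R := 0.
have Hg (t : R) : is_derive t (1 : R) g (dg t).
  have d : differentiable f (0 + t *: z) by exact: smooth_differentiable.
  by apply: is_derive_eq (is_derive_line d) _; exact: D.
have [t _] : exists2 t, t \in `]0, 1[%R & g 1 - g 0 = dg t * (1 - 0).
  by apply: MVT => //; apply: derivable_within_continuous => x _; case: (Hg x).
by rewrite /dg mul0r /g scale1r scale0r !add0r => /subr0_eq.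
Qed.

End Liouville.

(** * Entire graphs of constant height are slices *)

Section SliceImage.
Context {R : realType} {n : nat}.
Variables (a b : 'rV[R]_n.+2) (E : 'I_n -> 'rV[R]_n.+2).
Hypothesis frame : forall x y, lorentz x y =
  lorentz x a * lorentz y b + lorentz x b * lorentz y a +
  \sum_i lorentz x (E i) * lorentz y (E i).
Context {M : smoothManifold R n}.
Variable psi : M -> 'rV[R]_n.+2.
Hypothesis hpsi : spacelike_hypersurface a psi.
Variable g : 'rV[R]_n -> M.
Hypothesis hg : graph_section a E psi setT g.
Hypothesis gK : forall p, g (coords a E psi p) = p.

(** Both inclusions rest on the half-space coordinates being injective on the
    steady state space. *)
Lemma entire_graph_cst_slice : (forall z, graph_height a psi g z = graph_height a psi g 0) ->
  exists2 tau : R, 0 < tau & range psi = slice a tau.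
Proof.
move=> fcst; pose tau := lorentz (psi (g 0)) a.
have hs := hyp_steady hpsi.
have height z : lorentz (psi (g z)) a = tau by apply: invr_inj; exact: fcst.
exists tau; first by case: (hs (g 0)).
apply/seteqP; split=> [_ [p _ <-]|x [[x1 xa] xtau]].
  by split; [exact: hs|rewrite -(gK p) height].
exists (g (half_space_proj a E x)) => //.
have [y1 ya] := hs (g (half_space_proj a E x)).
apply: (half_space_inj frame y1 x1 ya); first by rewrite height xtau.
exact: (graph_coords hg).
Qed.

End SliceImage.

Theorem theorem3 (R : realType) (n : nat) (hn : (1 <= n)%N)
  (a : 'rV[R]_n.+2) (ha : null_past_pointing a)
  (M : smoothManifold R n) (psi N : M -> 'rV[R]_n.+2) (H : R)
  (hpsi : spacelike_hypersurface a psi)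
  (hcomplete : complete_hypersurface psi)
  (hN : future_gauss_map psi N)
  (hH : forall p : M, mean_curvature_at psi N p H)
  (hbounded : bounded_away_from_infinity a psi) :
  H = 1 /\
  (n = 2%N -> exists2 tau : R, 0 < tau & range psi = slice a tau).
Proof.
have [b [E frame]] := null_frame ha.
have [tau1 [tau2 [tau10 tau12 htau]]] := hbounded.
have tau20 : 0 < tau2 by exact: lt_trans tau12.
have [p0 _] := hyp_nonempty hpsi.
have htau2 p : lorentz (psi p) a <= tau2 by case/andP: (htau p).
have [g [hg gK]] := entire_graph frame hpsi hcomplete (ltW tau20) htau2 p0.
have fb z : tau2^-1 <= graph_height a psi g z <= tau1^-1.
  have /andP[h1 h2] := htau (g z).
  have h0 : 0 < lorentz (psi (g z)) a by exact: lt_le_trans h1.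
  by rewrite /graph_height !lef_pV2 ?posrE // h1 h2.
have tau2V : 0 < tau2^-1 by rewrite invr_gt0.
have sf := graph_height_smooth frame hpsi hg.
have sw := graph_tilt_smooth frame hpsi hN hg.
have w0 := graph_tilt_gt0 ha hpsi hN g.
have wE := graph_tilt_sqr frame hpsi hN hg.
have eqn z := graph_equation frame hpsi hN hH hg z hn.
have H1 : H = 1 by exact: (mean_curvature_eq1 hn sf sw tau2V fb w0 wE eqn).
split=> // n2; apply: (entire_graph_cst_slice frame hpsi hg gK).
move: (graph_height a psi g) (graph_tilt a psi N g) sf sw fb w0 wE eqn.
rewrite H1 n2 => f w sf sw fb w0 wE eqn.
exact: (bounded_entire_solution_cst sf sw tau2V fb w0 wE eqn).
Qed.
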